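(* Let $n\ge1$, $p\ge 2$, let $\omega$ be a majorant, and let $\tau,\eta\ge0$ be constants with $\eta+\tau<4n/p$. Let $f\in\mathcal{C}^{2}(\mathbb{B}^{n})$ satisfy $\Delta f=\tau f+\eta\,\mathrm{Re}(f)$ in $\mathbb{B}^n$. If there is a positive constant $M^{\ast}$ such that $$M_{p}(r, D^{\ast}_{f})\leq M^{\ast}\omega\Big(\frac{1}{1-r}\Big)\quad\text{for all } r\in(0,1),$$ then for all $r\in(0,1)$ $$M_{p}(r,D_{f})\leq \sqrt{M^{\ast}_{2}}\left[\|D_{f}(0)\|^{2}+M^{\ast}_{1}\int_{0}^{1}\omega\Big(\frac{1}{1-rt}\Big)dt\right]^{1/2},$$ where $M^{\ast}_{1}=2p(2p-3)(M^{\ast})^{2}\omega(1)$ and $M^{\ast}_{2}=1/\big[1-p(\eta+\tau)/(4n)\big]$; moreover $f\in \mathcal{H}_{g}^{p}(\mathbb{B}^{n})$.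
   Context: A majorant is a continuous increasing function $\omega:[0,\infty)\to[0,\infty)$ with $\omega(0)=0$ such that $\omega(t)/t$ is non-increasing for $t>0$. $\mathbb{B}^n$ is the open unit ball of $\mathbb{C}^n$, $d\sigma$ the normalized surface measure on $\partial\mathbb{B}^n$, $\Delta=4\sum_k\partial^2/\partial z_k\partial\overline{z}_k$. For $f\in\mathcal{C}^1$, $\nabla f=(f_{z_1},\dots,f_{z_n})$, $\overline{\nabla}f=(f_{\overline z_1},\dots,f_{\overline z_n})$, $D_f=(\nabla f,\overline\nabla f)$ and $\|D_f\|=(\|\nabla f\|^2+\|\overline\nabla f\|^2)^{1/2}$. Further $$D^{\ast}_{f}=\Big[\sum_{j=1}^{n}\sum_{k=1}^{n}\big(|f_{z_{k}z_{j}}|^{2}+|f_{z_{k}\overline{z}_{j}}|^{2}+|f_{\overline{z}_{k}z_{j}}|^{2}+|f_{\overline{z}_{k}\overline{z}_{j}}|^{2}\big)\Big]^{1/2}.$$ For a nonnegative (or norm-valued) quantity $g$ on $\mathbb{B}^n$, $M_p(r,g)=\big(\int_{\partial\mathbb{B}^n}g(r\zeta)^pd\sigma(\zeta)\big)^{1/p}$; in particular $M_p(r,D_f)$ uses $\|D_f\|$ and $M_p(r,f)$ uses $|f|$. $\mathcal{H}_g^p(\mathbb{B}^n)$ is the set of measurable $f$ with $M_p(r,f)$ defined for all $r\in(0,1)$ and $\sup_{0<r<1}M_p(r,f)<\infty$. *)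

(* Defs.v *)
From HB Require Import structures.
From mathcomp Require Import all_boot all_order all_algebra.
From mathcomp Require Import all_classical all_reals all_analysis.
Set Implicit Arguments. Unset Strict Implicit. Unset Printing Implicit Defensive.
Import Order.TTheory GRing.Theory Num.Theory.
Import numFieldNormedType.Exports.
Local Open Scope classical_set_scope.
Local Open Scope ring_scope.

(* C^n is identified with R^(2n) = 'rV[R]_(n + n):
   z_k = x_k + i y_k, x_k = coordinate (lshift n k), y_k = coordinate (rshift n k).
   A complex-valued function f is a map into R * R, (f x).1 = Re f, (f x).2 = Im f. *)
Section Defs.
Variables (R : realType) (n : nat).
Local Notation V := 'rV[R]_(n + n).

Definition enorm (x : V) : R := Num.sqrt (\sum_(i < n + n) x 0 i ^+ 2).

Definition unit_ball : set V := [set x | enorm x < 1].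

Definition pd (i : 'I_(n + n)) (g : V -> R) : V -> R :=
  fun x => 'D_(delta_mx 0 i) g x.

Definition dx (k : 'I_n) := pd (lshift n k).
Definition dy (k : 'I_n) := pd (rshift n k).

(* Wirtinger derivatives  f_{z_k} = (1/2)(d/dx_k - i d/dy_k) f,
   f_{zbar_k} = (1/2)(d/dx_k + i d/dy_k) f, written out on (Re f, Im f). *)
Definition dz (k : 'I_n) (f : V -> R * R) : V -> R * R := fun x =>
  ((dx k (fun y => (f y).1) x + dy k (fun y => (f y).2) x) / 2,
   (dx k (fun y => (f y).2) x - dy k (fun y => (f y).1) x) / 2).
Definition dzb (k : 'I_n) (f : V -> R * R) : V -> R * R := fun x =>
  ((dx k (fun y => (f y).1) x - dy k (fun y => (f y).2) x) / 2,
   (dx k (fun y => (f y).2) x + dy k (fun y => (f y).1) x) / 2).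

Definition cabs2 (z : R * R) : R := z.1 ^+ 2 + z.2 ^+ 2.

Definition cabsf (f : V -> R * R) : V -> R := fun x => Num.sqrt (cabs2 (f x)).

Definition normDf (f : V -> R * R) : V -> R := fun x =>
  Num.sqrt (\sum_(k < n) (cabs2 (dz k f x) + cabs2 (dzb k f x))).

Definition Dstar (f : V -> R * R) : V -> R := fun x =>
  Num.sqrt (\sum_(j < n) \sum_(k < n)
    (cabs2 (dz j (dz k f) x) + cabs2 (dzb j (dz k f) x)
     + cabs2 (dz j (dzb k f) x) + cabs2 (dzb j (dzb k f) x))).

Definition lap (f : V -> R * R) : V -> R * R := fun x =>
  (4 * \sum_(k < n) (dz k (dzb k f) x).1, 4 * \sum_(k < n) (dz k (dzb k f) x).2).

Definition C2_on (B : set V) (g : V -> R) : Prop :=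
  (forall x, B x -> {for x, continuous g}) /\
  (forall i x, B x -> derivable g x (delta_mx 0 i)) /\
  (forall i x, B x -> {for x, continuous (pd i g)}) /\
  (forall i j x, B x -> derivable (pd i g) x (delta_mx 0 j)) /\
  (forall i j x, B x -> {for x, continuous (pd j (pd i g))}).

Definition cC2_on (B : set V) (f : V -> R * R) : Prop :=
  C2_on B (fun x => (f x).1) /\ C2_on B (fun x => (f x).2).

End Defs.

Local Open Scope ereal_scope.

(* Lebesgue integral on R^m of a nonnegative function, as iterated
   one-dimensional Lebesgue integrals (Tonelli). Points are coded by seq R. *)
Fixpoint iint (R : realType) (m : nat) : (seq R -> \bar R) -> \bar R :=
  match m with
  | 0 => fun h => h [::]
  | m'.+1 => fun h =>
      \int[@lebesgue_measure R]_(t in [set: R]) iint m' (fun s => h (t :: s))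
  end.

Definition vint (R : realType) (m : nat) (h : 'rV[R]_m -> \bar R) : \bar R :=
  iint m (fun s => h (\row_(i < m) nth 0%R s i)).

Definition ball_vol (R : realType) (n : nat) : \bar R :=
  vint (fun x : 'rV[R]_(n + n) => (if enorm x < 1 then 1 else 0)%R%:E).

(* integral with respect to the normalized surface measure sigma on the unit
   sphere of C^n = R^(2n), via the cone-measure definition
   sigma(E) = V({t z : 0 < t <= 1, z in E}) / V(B^n). *)
Definition sphere_int (R : realType) (n : nat) (h : 'rV[R]_(n + n) -> \bar R)
  : \bar R :=
  vint (fun x : 'rV[R]_(n + n) =>
          if (enorm x < 1)%R then h ((enorm x)^-1 *: x) else 0)
  * ((fine (ball_vol R n))^-1)%:E.

Definition Mp (R : realType) (n : nat) (p r : R) (g : 'rV[R]_(n + n) -> R)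
  : \bar R :=
  (sphere_int (fun z => ((g (r *: z)) `^ p)%:E)) `^ (p^-1).

Definition majorant (R : realType) (omega : R -> R) : Prop :=
  [/\ {within [set t : R | (0 <= t)%R], continuous omega},
      (forall s t : R, (0 <= s)%R -> (s < t)%R -> (omega s < omega t)%R),
      omega 0%R = 0%R,
      (forall t : R, (0 <= t)%R -> (0 <= omega t)%R) &
      (forall s t : R, (0 < s)%R -> (s <= t)%R -> (omega t / t <= omega s / s)%R)].

Definition Hgp (R : realType) (n : nat) (p : R) (f : 'rV[R]_(n + n) -> R * R)
  : Prop :=
  exists C : R, forall r : R, (0 < r < 1)%R -> Mp p r (cabsf f) <= C%:E.

(* Main.v *)
(* The components [u] of [f] satisfy [Delta u = c_u u] with [0 <= c_u <= eta + tau].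
   For a finite family [u] of such functions put [w = eps + |u|^2] and let [m s] be
   the spherical mean of [w ^ q] at radius [s], [q = p / 2]. Then
   [Delta (w ^ q) <= 2 q (2 q - 1) w ^ (q - 1) |D u|^2 + 2 q c w ^ q], and the
   divergence theorem [s ^ (N - 1) m' s = int_0^s t ^ (N - 1) mean (Delta (w ^ q)) dt]
   together with Hoelder's inequality bounds [m ^ (1 / q)]: with
   [|D u| <= K om (1 / (1 - s))] in the [p]-mean, the decisive double integral
   [int (r - s) om (1 / (1 - s)) ^ 2 ds] is at most [om 1 int om (1 / (1 - s)) ds],
   because [(1 - s) om (1 / (1 - s)) <= om 1].
   The estimate is wanted for the gradient of [f], which is only [C^1], so [u] runs
   over difference quotients of the components of [f]; these are [C^2] and solve the
   same equations, and no elliptic regularity is needed. The divergence theorem on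
   spheres is obtained by integrating by parts against radial cutoffs in the iterated
   integral that defines [sphere_int]. Finally [f] lies in the Hardy space because
   the gradient bound is [O ((1 - r) ^ (-1/2))], which is integrable in [r]. *)
Require Import Defs.
From HB Require Import structures.
From mathcomp Require Import all_boot all_order all_algebra.
From mathcomp Require Import all_classical all_reals all_analysis.
From mathcomp Require Import measurable_realfun ring lra.
Import Order.TTheory GRing.Theory Num.Theory.
Import numFieldNormedType.Exports.
Set Implicit Arguments. Unset Strict Implicit. Unset Printing Implicit Defensive.
Local Open Scope classical_set_scope.
Local Open Scope ring_scope.

(** The constant [eps] keeps [w] positive, since negative powers of [w] occur when [q < 2]; the
    error of the difference quotients is absorbed in the same constant, and both are sent to 0
    together. Hoelder produces the factor [m s ^ (1 - 1/q)]. As [Delta (w ^ q) >= 0], [m] is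
    nondecreasing, so this factor may be frozen at [A = m r ^ (1 - 1/q)], a constant in the
    comparison argument, and divided out at the end. The zero-order term contributes a multiple of
    [m r] that moves to the left; with [q = p/2] and [N = 2n] it leaves
    [1 - p (eta + tau) r^2 / (4n)], the origin of the constant under the first root. In real
    partials, the square of [normDf] is one half and that of [Dstar] one quarter of a sum of
    squares. Hence the factor that comes out is [2p (p - 1)], and [p >= 2] bounds it by
    [2p (2p - 3)]. The iterated integral behind [sphere_int] is awkward to estimate with. It is
    traded once for a probability space [P] with a random unit vector [Z]; after that, the geometry
    of the sphere enters only through the vanishing mean of tangential divergences. *)

Lemma is_diff_eps (R : realType) (V W : normedModType R) (f : V -> W)
    (df : {linear V -> W}) (x : V) : continuous df ->
  (forall e, 0 < e -> \forall y \near x, `|f y - f x - df (y - x)| <= e * `|y - x|) <->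
  is_diff x f df.
Proof.
move=> cdf; split=> [H|fdf].
  have dE : f \o shift x = cst (f x) + df +o_ 0 id.
    apply/eqaddoP => e e0; have := H e e0.
    rewrite (near_shift 0 x) subr0; apply: filterS => y /=.
    by rewrite addrK !fctE /= opprD addrA.
  have dv := diff_unique cdf dE.
  by apply: DiffDef => //; apply/diff_locallyP; rewrite dv.
move=> e e0; have /diff_locally : differentiable f x by [].
rewrite diff_val => /eqaddoP /(_ _ e0).
rewrite (near_shift 0 x) subr0; apply: filterS => y /=.
by rewrite addrK !fctE /= opprD addrA.
Qed.

Lemma continuous_at_sum (T : topologicalType) (R : realType) (J : Type) (s : seq J)
    (f : J -> T -> R) (x : T) : (forall j, {for x, continuous (f j)}) ->
  {for x, continuous (fun y => \sum_(j <- s) f j y)}.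
Proof.
move=> cf; elim: s => [|j s IH].
  have -> : (fun y => \sum_(j <- [::]) f j y) = fun=> 0.
    by apply/funext => y; rewrite big_nil.
  exact: cst_continuous.
have -> : (fun y => \sum_(k <- j :: s) f k y) = fun y => f j y + \sum_(k <- s) f k y.
  by apply/funext => y; rewrite big_cons.
by apply: continuousD; [exact: cf|exact: IH].
Qed.

(** * Gradients of real functions on row vectors *)

Section gradients.
Variables (R : realType) (N : nat).
Local Notation V := 'rV[R]_N.
Implicit Types (f g : V -> R) (G H : 'I_N -> R) (x y h : V).

Definition dotg G h := \sum_i h 0 i * G i.

Fact dotg_is_linear G : linear (dotg G : V -> R^o).
Proof.
move=> a u v; rewrite /dotg /= /GRing.scale /= mulr_sumr -big_split /=.
by apply: eq_bigr => i _; rewrite !mxE mulrDl mulrA.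
Qed.

HB.instance Definition _ G :=
  GRing.isLinear.Build R V R^o _ (dotg G : V -> R^o) (dotg_is_linear G).

Lemma coord_le_norm h i : `|h 0 i| <= `|h|.
Proof.
rewrite [leRHS]/Num.Def.normr/= mx_normrE.
exact: (le_bigmax _ (fun ij => `|h ij.1 ij.2|) (0, i)).
Qed.

Lemma dotg_cont G : continuous (dotg G).
Proof.
move=> h; apply: (@continuous_at_sum _ _ _ _ (fun i (h : V) => h 0 i * G i)) => i.
by apply: continuousM; [exact: coord_continuous|exact: cst_continuous].
Qed.

(** Carrying the gradient vector as an argument lets the product and chain rules compute it, with
    differentiability included. *)
Definition hasgrad g G x := is_diff x g (dotg G).

Lemma hasgradP g G x :
  (forall e, 0 < e -> \forall y \near x, `|g y - g x - dotg G (y - x)| <= e * `|y - x|) <->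
  hasgrad g G x.
Proof. exact: (@is_diff_eps R V R^o g (dotg G : {linear V -> R^o}) x (@dotg_cont G)). Qed.

Lemma hasgrad_differentiable g G x : hasgrad g G x -> differentiable g x.
Proof. by case. Qed.

Lemma hasgrad_diff g G x v : hasgrad g G x -> 'd g x v = dotg G v.
Proof. by case=> _ ->. Qed.

Lemma hasgrad_cont g G x : hasgrad g G x -> {for x, continuous g}.
Proof. by move=> /hasgrad_differentiable; exact: differentiable_continuous. Qed.

Lemma hasgrad_derive g G x v : hasgrad g G x -> is_derive x v g (dotg G v).
Proof.
move=> gG; have dg := hasgrad_differentiable gG.
apply: DeriveDef; first exact: diff_derivable.
by rewrite deriveE// (hasgrad_diff v gG).
Qed.

Lemma dotg_delta G i : dotg G (delta_mx 0 i) = G i.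
Proof.
rewrite /dotg (bigD1 i)//= mxE !eqxx mul1r big1 ?addr0// => j ji.
by rewrite mxE (negbTE ji) mul0r.
Qed.

Lemma hasgrad_partial g G x i : hasgrad g G x -> is_derive x (delta_mx 0 i) g (G i).
Proof. by move/hasgrad_derive => /(_ (delta_mx 0 i)); rewrite dotg_delta. Qed.

Lemma hasgrad_eq g G H x : hasgrad g G x -> G =1 H -> hasgrad g H x.
Proof. by move=> + /funext <-. Qed.

Lemma hasgrad_cst c x : hasgrad (fun=> c) (fun=> 0) x.
Proof.
apply: (@is_diff_eq _ _ _ (cst c) 0); apply/funext => h.
by rewrite /dotg big1 // => i _; rewrite mulr0.
Qed.

Lemma hasgradD f g G H x : hasgrad f G x -> hasgrad g H x ->
  hasgrad (fun y => f y + g y) (fun i => G i + H i) x.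
Proof.
rewrite /hasgrad => fG gH; apply: (@is_diff_eq _ _ _ (f + g) (dotg G + dotg H)).
apply/funext => h; rewrite /dotg fctE -big_split /=.
by apply: eq_bigr => i _; rewrite mulrDr.
Qed.

Lemma hasgradM f g G H x : hasgrad f G x -> hasgrad g H x ->
  hasgrad (fun y => f y * g y) (fun i => f x * H i + g x * G i) x.
Proof.
rewrite /hasgrad => fG gH; apply: (@is_diff_eq _ _ _ (f * g) (f x *: dotg H + g x *: dotg G)).
apply/funext => h; rewrite /dotg !fctE /= /GRing.scale/= !mulr_sumr -big_split /=.
by apply: eq_bigr => i _; ring.
Qed.

Lemma hasgradZ c f G x : hasgrad f G x ->
  hasgrad (fun y => c * f y) (fun i => c * G i) x.
Proof.
move=> fG; apply: hasgrad_eq (hasgradM (hasgrad_cst c x) fG) _.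
by move=> i; rewrite mulr0 addr0.
Qed.

Lemma hasgrad_sum (J : Type) (s : seq J) (f : J -> V -> R) (G : J -> 'I_N -> R) x :
  (forall j, hasgrad (f j) (G j) x) ->
  hasgrad (fun y => \sum_(j <- s) f j y) (fun i => \sum_(j <- s) G j i) x.
Proof.
move=> fG; elim: s => [|j s IH].
  rewrite (_ : (fun y => _) = fun=> 0); last by apply/funext => y; rewrite big_nil.
  by apply: hasgrad_eq (hasgrad_cst _ _) _ => i; rewrite big_nil.
rewrite (_ : (fun y => _) = fun y => f j y + \sum_(j <- s) f j y); last first.
  by apply/funext => y; rewrite big_cons.
by apply: hasgrad_eq (hasgradD (fG j) IH) _ => i; rewrite big_cons.
Qed.

Lemma hasgrad_coord j x : hasgrad (fun y => y 0 j) (fun i => (i == j)%:R) x.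
Proof.
apply/hasgradP => e e0; near=> y.
rewrite /dotg (bigD1 j)//= eqxx mulr1 big1 ?addr0; last first.
  by move=> i /negbTE ->; rewrite mulr0.
by rewrite !mxE subrr normr0 mulr_ge0// ltW.
Unshelve. all: by end_near. Qed.

Lemma hasgrad_comp (phi : R -> R) a g G x : is_derive (g x) 1 phi a ->
  hasgrad g G x -> hasgrad (fun y => phi (g y)) (fun i => a * G i) x.
Proof.
rewrite /hasgrad => dphi gG.
have dp : is_diff (g x) phi (fun k : R => k * a).
  apply: DiffDef; first by apply/derivable1_diffP.
  rewrite deriv1E// derive1E; apply/funext => h.
  by rewrite derive_val /GRing.scale.
apply: (@is_diff_eq _ _ _ (phi \o g) ((fun k : R => k * a) \o dotg G)).
apply/funext => h; rewrite /= /dotg mulr_suml.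
by apply: eq_bigr => i _; ring.
Qed.

Lemma hasgrad_curve g G (c : R -> V) (c' : 'I_N -> R) t :
  hasgrad g G (c t) -> (forall i, is_derive t 1 (fun s => c s 0 i) (c' i)) ->
  is_derive t 1 (fun s => g (c s)) (\sum_i c' i * G i).
Proof.
move=> gG dc.
have dC : derivable c t 1.
  by apply/derivable_mxP => i j; rewrite ord1; have := dc j; case.
have dC' : differentiable c t by apply/derivable1_diffP.
have dg := hasgrad_differentiable gG.
apply: DeriveDef.
  by apply/derivable1_diffP; exact: differentiable_comp.
rewrite -[LHS]/('D_1 (g \o c) t) deriveE; last exact: differentiable_comp.
rewrite diff_comp// /= (hasgrad_diff _ gG) -deriveE// derive_mx// /dotg.
by apply: eq_bigr => i _; rewrite mxE derive_val.
Qed.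

Lemma line_derive g v x t : derivable g (t *: v + x) v ->
  is_derive t 1 (fun s => g (s *: v + x)) ('D_v g (t *: v + x)).
Proof.
move=> dg.
have E : (fun h : R => h^-1 *: (g ((h *: (1 : R) + t) *: v + x) - g (t *: v + x))) =
         (fun h : R => h^-1 *: (g (h *: v + (t *: v + x)) - g (t *: v + x))).
  apply/funext => h; congr (_ *: (g _ - _)).
  by rewrite addrA -scalerDl /GRing.scale /= mulr1.
by apply: DeriveDef; rewrite /derivable /derive /= E.
Qed.

Lemma line_MVT g v x b :
  (forall t, Num.min 0 b <= t <= Num.max 0 b -> derivable g (t *: v + x) v) ->
  exists2 c, Num.min 0 b <= c <= Num.max 0 b &
    g (b *: v + x) - g x = b * 'D_v g (c *: v + x).
Proof.
move=> dg.
pose F s := g (s *: v + x).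
have cF : {within `[Num.min 0 b, Num.max 0 b], continuous F}.
  apply: derivable_within_continuous => t; rewrite in_itv/= => tb.
  by have [] := line_derive (dg t tb).
have [||c] := @MVT_segment R F (fun t => 'D_v g (t *: v + x)) _ _ _ _ cF.
- by rewrite ge_min !le_max !lexx.
- move=> t; rewrite in_itv /= => /andP[t0 t1].
  by apply: line_derive; apply: dg; rewrite !ltW.
rewrite in_itv /= => cb; rewrite /F => FE; exists c => //; move: FE.
case: (leP 0 b) => b0; rewrite scale0r add0r.
  by move=> ->; rewrite subr0 mulrC.
by rewrite sub0r mulrN mulrC => /(congr1 -%R); rewrite opprB opprK.
Qed.

(** One passes from [x] to [y] by changing one coordinate at a time. The mean value theorem turns
    each increment into a partial derivative at a point no farther from [x] than [y] in the sup
    norm, where it is close to its value at [x]. *)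
Lemma C1_hasgrad g x :
  (\forall y \near x, forall i, derivable g y (delta_mx 0 i)) ->
  (forall i, {for x, continuous (fun y => 'D_(delta_mx 0 i) g y)}) ->
  hasgrad g (fun i => 'D_(delta_mx 0 i) g x) x.
Proof.
move=> dg cg; apply/hasgradP => e e0.
pose G i := 'D_(delta_mx 0 i) g x.
pose e' := e / N.+1%:R.
have e'0 : 0 < e' by rewrite divr_gt0// ltr0n.
have : \forall y \near x, (forall i, derivable g y (delta_mx 0 i)) /\
    forall i, `|'D_(delta_mx 0 i) g y - G i| <= e'.
  near=> y; split; first by near: y.
  near: y.
  apply: filter_forall => i.
  by have := cg i => /cvgrPdist_le /(_ _ e'0); apply: filterS => y; rewrite distrC.
move=> /nbhs_ballP[d /= d0 dP].
apply/nbhs_ballP; exists d => //= y; rewrite -ball_normE /ball_ /= => xyd.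
(* The [k]-th vertex of the path: the first [k] coordinates come from [y], the others from [x]. *)
pose a (k : nat) : V := \row_i (if (i < k)%N then y 0 i else x 0 i).
have a0 : a 0%N = x by apply/rowP => i; rewrite mxE.
have aN : a N = y by apply/rowP => i; rewrite mxE ltn_ord.
have step (k : 'I_N) : `|g (a k.+1) - g (a k) - (y - x) 0 k * G k| <= e' * `|y - x|.
  pose b := y 0 k - x 0 k.
  pose c (t : R) : V := t *: delta_mx 0 k + a k.
  have aS : a k.+1 = c b.
    apply/rowP => i; rewrite !mxE eqxx /=; case: (ltngtP i k) => ik.
    - by rewrite ltnS (ltnW ik) -val_eqE /= ltn_eqF// mulr0 add0r.
    - by rewrite ltnS leqNgt ik -val_eqE /= gtn_eqF// mulr0 add0r.
    - by rewrite ltnS (val_inj ik) leqnn eqxx mulr1 subrK.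
  have cB t : Num.min 0 b <= t <= Num.max 0 b -> ball x d (c t).
    move=> tb; rewrite -ball_normE /ball_ /=; apply: le_lt_trans xyd.
    rewrite [leLHS]/Num.Def.normr/= mx_normrE; apply: bigmax_le => //= -[i j] _ /=.
    rewrite [i]ord1; apply: le_trans (coord_le_norm _ j).
    rewrite !mxE eqxx /=; case: (ltngtP j k) => ik.
    - by rewrite -val_eqE /= ltn_eqF// mulr0 add0r.
    - by rewrite -val_eqE /= gtn_eqF// mulr0 add0r subrr normr0.
    - rewrite (val_inj ik) eqxx mulr1 opprD addrCA subrr addr0 normrN (distrC (x 0 k)) -/b.
      move: tb; case: (leP 0 b) => b0 /andP[t0 t1].
        by rewrite !ger0_norm// ltW.
      by rewrite !ler0_norm ?lerN2// ltW.
  have [t tb tE] := line_MVT (fun t tb => (dP _ (cB t tb)).1 k).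
  rewrite aS /c tE !mxE -/b -mulrBr normrM mulrC.
  apply: ler_pM => //; first by have [_] := dP _ (cB _ tb); exact.
  by have := coord_le_norm (y - x) k; rewrite !mxE.
have -> : g y - g x = \sum_(k < N) (g (a k.+1) - g (a k)).
  by rewrite -(big_mkord xpredT (fun k => g (a k.+1) - g (a k))) telescope_sumr// a0 aN.
rewrite /dotg -sumrB.
apply: (le_trans (ler_norm_sum _ _ _)).
apply: (le_trans (ler_sum _ (fun k _ => step k))).
rewrite sumr_const card_ord -mulr_natl mulrA ler_wpM2r//.
by rewrite /e' mulrCA -[leRHS]mulr1 ler_pM2l// ler_pdivrMr ?ltr0n// mul1r ler_nat.
Unshelve. all: by end_near. Qed.

End gradients.

(** * Measurability and iterated integrals *)

(** Here [g] is continuous only at the values of [Y] (later, at points of the sphere), so it need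
    not be Borel on the whole space. Rounding [Y] to the grid of mesh [1/(k+1)] leaves countably
    many values, each taken on a measurable set, and continuity at [Y t] gives pointwise
    convergence. *)
Lemma measurable_comp_row d (T : measurableType d) (R : realType) m
    (Y : T -> 'rV[R]_m) (g : 'rV[R]_m -> R) :
  (forall i, measurable_fun setT (fun t => Y t 0 i)) ->
  (forall t, {for Y t, continuous g}) ->
  measurable_fun setT (fun t => g (Y t)).
Proof.
move=> mY cg.
pose W k t : 'rV[int]_m := \row_i Num.floor (k.+1%:R * Y t 0 i).
pose D k (z : 'rV[int]_m) : 'rV[R]_m := \row_i ((z 0 i)%:~R / k.+1%:R).
apply: (@measurable_fun_cvg _ _ _ _ (fun k t => g (D k (W k t)))); last first.
  move=> t _; apply: (@cvg_comp _ _ _ (fun k => D k (W k t)) g); last exact: cg.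
  apply/cvg_ballP => e e0; near=> k; split => // i j.
  rewrite !mxE /ball /=.
  have k0 : 0 < k.+1%:R :> R by rewrite ltr0n.
  have -> : Y t i j - (Num.floor (k.+1%:R * Y t 0 j))%:~R / k.+1%:R =
      (k.+1%:R * Y t 0 j - (Num.floor (k.+1%:R * Y t 0 j))%:~R) / k.+1%:R.
    by rewrite ord1; field; rewrite gt_eqF.
  set y := k.+1%:R * Y t 0 j.
  have y1 := floor_le y; have y2 := floorD1_gt y.
  rewrite ger0_norm ?divr_ge0 ?subr_ge0 ?(ltW k0)//.
  rewrite ltr_pdivrMr//.
  have : 1 < e * k.+1%:R.
    by rewrite -ltr_pdivrMr// mul1r; near: k; exact: (near_infty_natSinv_lt (PosNum e0)).
  apply: lt_trans; rewrite ltrBlDl; move: y2; rewrite intrD.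
  by [].
move=> k _ B mB; rewrite setTI.
rewrite [X in measurable X](_ : _ =
   \bigcup_(z in [set: 'rV[int]_m])
     (if pselect (B (g (D k z))) then [set t | W k t = z] else set0)); last first.
  apply/seteqP; split => t /=.
    by move=> h; exists (W k t) => //; case: pselect.
  by case=> z zT; case: (pselect _) => [Bz|nBz] //= ->.
apply: countable_bigcupT_measurable; first exact: countableP.
move=> z; case: (pselect _) => [Bz|nBz] /=; last exact: measurable0.
rewrite [X in measurable X](_ : _ =
   \bigcap_(i in [set: 'I_m]) [set t | Num.floor (k.+1%:R * Y t 0 i) = z 0 i]); last first.
  apply/seteqP; split => t /=.
    by move=> <- i _; rewrite /= mxE.
  by move=> h; apply/rowP => i; rewrite mxE; exact: h.
apply: fin_bigcap_measurable; first exact: finite_finset.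
move=> i _.
rewrite [X in measurable X](_ : _ =
   setT `&` (fun t => k.+1%:R * Y t 0 i) @^-1` `[(z 0 i)%:~R, (z 0 i + 1)%:~R[%classic); last first.
  rewrite setTI; apply/seteqP; split => t /=.
    by move=> <-; rewrite in_itv/= floor_le floorD1_gt.
  by rewrite in_itv /= => h; exact: floor_def.
have mf : measurable_fun setT (fun t => k.+1%:R * Y t 0 i) by exact: measurable_funM.
exact: mf.
Unshelve. all: by end_near. Qed.

Lemma sigma_finite_product (R : realType) d d' (T : measurableType d)
    (T' : measurableType d') (mu : {sigma_finite_measure set T -> \bar R})
    (nu : {sigma_finite_measure set T' -> \bar R}) :
  sigma_finite setT (mu \x nu)%E.
Proof.
have /sigma_finiteP[F [TF ndF Foo]] := sigma_finiteT mu.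
have /sigma_finiteP[G [TG ndG Goo]] := sigma_finiteT nu.
exists (fun n => F n `*` G n).
  apply/seteqP; split=> // -[x y] _.
  have [[i _ Fx] [j _ Gy]] : (\bigcup_i F i) x /\ (\bigcup_i G i) y by rewrite -TF -TG.
  exists (maxn i j) => //; split => /=.
    by move: x Fx; exact/subsetPset/ndF/leq_maxl.
  by move: y Gy; exact/subsetPset/ndG/leq_maxr.
move=> k; have [mF Fk] := Foo k; have [mG Gk] := Goo k.
split; first exact: measurableX.
by rewrite product_measure1E// lte_mul_pinfty// ge0_fin_numE.
Qed.

(** Replaces the iterated integral by one against a sigma-finite product measure, so that
    convergence theorems apply. The last clause is what integration by parts needs: Fubini lets the
    [i]-th variable be integrated first. It concerns signed functions, so boundedness and support in
    a cube are assumed to have integrability. *)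
Lemma iint_product_measure (R : realType) (m : nat) :
  exists (d : measure_display) (T : measurableType d)
    (mu : {sigma_finite_measure set T -> \bar R}) (X : T -> seq R),
  [/\ (forall u, size (X u) = m),
      (forall i, measurable_fun setT (fun u => nth 0 (X u) i)),
      (forall h : seq R -> \bar R, (forall s, (0 <= h s)%E) ->
        measurable_fun setT (h \o X) ->
        iint m h = (\int[mu]_u h (X u))%E),
      (forall a b, a <= b ->
        measurable [set u | all (fun x => a <= x <= b) (X u)] /\
        mu [set u | all (fun x => a <= x <= b) (X u)] = ((b - a) ^+ m)%:E) &
      (forall (h : seq R -> R) (M K : R) (i : nat),
        measurable_fun setT (h \o X) ->
        (forall s, `|h s| <= M) ->
        (forall s, size s = m -> ~~ all (fun x => - K <= x <= K) s -> h s = 0) -> 0 <= K ->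
        (i < m)%N ->
        (forall s, size s = m ->
          (\int[@lebesgue_measure R]_t (h (set_nth 0 s i t))%:E = 0)%E) ->
        (\int[mu]_u (h (X u))%:E = 0)%E)].
Proof.
elim: m => [|m [d [T [mu [X [sX mX iX boxX divX]]]]]].
  exists _, (measurableTypeR R), (\d_(0 : measurableTypeR R)), (fun=> [::]).
  split => //=.
  - by move=> h h0 mh; rewrite integral_dirac// diracT mul1e.
  - move=> a b ab; split; first by rewrite (_ : [set _ | _] = setT)//; apply/seteqP.
    by rewrite (_ : [set _ | _] = setT) ?diracT ?expr0//; apply/seteqP.
pose L : {sigma_finite_measure set (measurableTypeR R) -> \bar R} := @lebesgue_measure R.
pose X' (z : measurableTypeR R * T) := z.1 :: X z.2.
pose LM := HB.pack_for {sigma_finite_measure set (measurableTypeR R * T)%type -> \bar R}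
  (L \x mu)%E (Measure_isSigmaFinite.Build _ _ _ (L \x mu)%E (sigma_finite_product L mu)).
exists _, _, LM, X'.
have sec h t : measurable_fun setT (h \o X') ->
    measurable_fun setT ((fun s => h (t :: s) : \bar R) \o X).
  by move=> mh; exact: (measurableT_comp mh (pair1_measurable t)).
have boxE a b : [set u | all (fun x => a <= x <= b) (X' u)] =
    `[a, b]%classic `*` [set u | all (fun x => a <= x <= b) (X u)].
  apply/seteqP; split => -[t u] /=; rewrite in_itv/=.
    by case/andP.
  by case=> -> ->.
have mbox a b : a <= b -> measurable [set u | all (fun x => a <= x <= b) (X' u)].
  move=> ab; rewrite boxE; apply: measurableX; first exact: measurable_itv.
  by have [] := boxX _ _ ab.
have vbox a b : a <= b -> (L \x mu)%E [set u | all (fun x => a <= x <= b) (X' u)]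
    = ((b - a) ^+ m.+1)%:E.
  move=> ab; have [mB vB] := boxX _ _ ab.
  have LE : L `[a, b]%classic = (b - a)%:E.
    have /= -> := lebesgue_measure_itv `[a, b]; rewrite lte_fin -EFinB.
    by case: ltP => // ba; rewrite (@le_anti _ _ a b) ?ab ?subrr.
  rewrite boxE product_measure1E// vB exprS EFinM; congr (_ * _)%E; exact: LE.
split => //.
- by move=> u /=; rewrite sX.
- case=> [|i] /=; first exact: measurable_fst.
  exact: measurableT_comp (mX i) measurable_snd.
- move=> h h0 mh /=.
  rewrite fubini_tonelli1//; apply: eq_integral => t _ /=.
  by rewrite iX//; exact: sec.
- by move=> a b ab; split; [exact: mbox|exact: vbox].
move=> h M K i mh hM hK K0 im h0.
have ih : (L \x mu)%E.-integrable setT (fun z => (h (X' z))%:E).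
  set B := [set u | all (fun x => - K <= x <= K) (X' u)].
  have KK : - K <= K by lra.
  have mB : measurable B by exact: mbox.
  have -> : (fun z => (h (X' z))%:E) = (EFin \o (h \o X')) \_ B.
    apply/funext => z; rewrite patchE; case: ifPn => // /negP zB /=.
    by rewrite hK//= ?sX//; apply/negP => zB'; apply: zB; rewrite inE.
  apply/(integrable_mkcond _ mB); apply: measurable_bounded_integrable => //.
  - have vB : ((L \x mu)%E B < +oo)%E by have /= := vbox _ _ KK; rewrite /B => ->; rewrite ltry.
    exact: vB.
  - exact: measurable_funTS.
  - exists M; split; first exact: num_real.
    by move=> x Mx y _ /=; apply: le_trans (ltW Mx); exact: hM.
(* For [i = 0] the order of integration is chosen so that the first variable is innermost; otherwise
   the first variable is outermost and the induction hypothesis handles each slice. *)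
case: i im h0 => [|i] im h0.
  rewrite -integral21_prod_meas1//.
  rewrite integral0_eq// => u _; rewrite /fubini_G /=.
  by have := h0 (0 :: X u); rewrite /= sX; exact.
rewrite -integral12_prod_meas1//.
rewrite integral0_eq// => t _; rewrite /fubini_F /=.
have [tK|tK] := boolP (- K <= t <= K); last first.
  by rewrite integral0_eq// => u _; rewrite /X' hK//= ?sX ?(negbTE tK).
apply: (divX (fun s => h (t :: s)) M K i) => //.
- apply/measurable_EFinP.
  by apply: (sec (EFin \o h)); exact/measurable_EFinP.
- by move=> s ss sK; rewrite hK//= ?ss ?(negbTE sK) ?andbF.
- by move=> s ss; have := h0 (t :: s); rewrite /= ss; exact.
Qed.

Lemma continuous_compact_bounded (R : realType) (T : topologicalType) (K : set T) (g : T -> R) :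
  compact K -> (forall x, K x -> {for x, continuous g}) ->
  exists2 M, 0 <= M & forall x, K x -> `|g x| <= M.
Proof.
move=> cK cg; have [->|K0] := eqVneq K set0; first by exists 0.
have cn : {within K, continuous (fun x => `|g x|)}.
  apply: continuous_in_subspaceT => x; rewrite inE => Kx.
  by apply: continuous_comp; [exact: cg|exact: norm_continuous].
have [c cK' cM] := compact_EVT_max ((set0P _).1 K0) cK cn.
by exists `|g c| => // x Kx; apply: cM; rewrite inE.
Qed.

Lemma continuous_compact_support_bounded (R : realType) N (g : 'rV[R]_N -> R) (K : R) :
  continuous g -> (forall x : 'rV[R]_N, (exists i, K < `|x 0 i|) -> g x = 0) ->
  exists2 M, 0 <= M & forall x, `|g x| <= M.
Proof.
move=> cg gK.
have cK : compact [set x : 'rV[R]_N | forall i, x 0 i \in `[- K, K]].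
  exact: (@rV_compact _ _ (fun=> `[- K, K]%classic) (fun=> @segment_compact _ _ _)).
have [M M0 MP] := continuous_compact_bounded cK (fun x _ => cg x).
exists M => // x; have [xK|] := pselect (forall i, x 0 i \in `[- K, K]); first exact: MP.
move=> /existsNP[i xi]; rewrite gK ?normr0//; exists i.
by rewrite ltNge -(rwP negP); move=> xK; apply: xi; rewrite in_itv/= -ler_norml.
Qed.

(** The first-order remainder is at most [(y - t) ^ 2] for all signs of [y] and [t]. This makes the
    cutoff below differentiable across the edge of its support. *)
Lemma is_derive_sqr_max0 (R : realType) (t : R) :
  is_derive t 1 (fun s => Num.max s 0 ^+ 2) (2 * Num.max t 0).
Proof.
pose df : {linear R^o -> R^o} := *:%R (2 * Num.max t 0).
have cdf : continuous df by exact: scaler_continuous.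
have : is_diff t (fun s : R^o => (Num.max s 0 ^+ 2 : R^o)) df.
  apply/(is_diff_eps _ _ cdf) => e e0; near=> y.
  have yt : `|y - t| <= e by near: y; apply: cvgr_distC_le.
  apply: (@le_trans _ _ (`|y - t| * `|y - t|)); last by rewrite ler_wpM2r.
  rewrite -normrM; have h : 0 <= (y - t) * (y - t) by rewrite -expr2 sqr_ge0.
  rewrite /df /= /GRing.scale /= (ger0_norm h) ler_norml.
  case: (leP y 0) => y0; case: (leP t 0) => t0; rewrite ?expr0n /= ?expr2.
  - by apply/andP; split; nra.
  - have h' : 0 <= - y * t by apply: mulr_ge0; lra.
    by have := sqr_ge0 y; rewrite expr2 => yy; apply/andP; split; nra.
  - have h' : 0 <= y * - t by apply: mulr_ge0; lra.
    by have := sqr_ge0 t; rewrite expr2 => yy; apply/andP; split; nra.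
  - by apply/andP; split; nra.
move=> [d1 d2]; apply: DeriveDef; first exact: diff_derivable.
by rewrite deriveE// d2 /df /= /GRing.scale /= mulr1.
Unshelve. all: by end_near. Qed.

Lemma integral_derive_compact_support (R : realType) (F f : R -> R) (K : R) :
  (forall t : R, is_derive t 1 F (f t)) -> continuous f ->
  (forall t : R, K <= `|t| -> F t = 0 /\ f t = 0) ->
  (\int[@lebesgue_measure R]_t (f t)%:E = 0)%E.
Proof.
move=> dF cf FK.
pose K' := `|K| + 1.
have K'0 : 0 < K' by rewrite ltr_wpDl.
have KK : K <= K' by rewrite /K'; have := ler_norm K; lra.
have -> : (\int[@lebesgue_measure R]_t (f t)%:E =
           \int[@lebesgue_measure R]_(t in `[(- K')%R, K']) (f t)%:E)%E.
  rewrite [RHS]integral_mkcond; apply: eq_integral => t _.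
  rewrite patchE; case: ifPn => //; rewrite notin_setE /= in_itv /= => /negP tK.
  rewrite (FK t _).2//; apply: le_trans KK _.
  by rewrite leNgt; apply: contra tK => /ltW; rewrite ler_norml.
rewrite (@continuous_FTC2 R f F (- K') K').
- by rewrite (FK K' _).1 ?(FK (- K') _).1 ?normrN ?subee// ger0_norm// ltW.
- by rewrite -subr_gt0 opprK addr_gt0.
- exact: continuous_subspaceT.
- split.
  + by move=> x _; have [] := dF x.
  + apply: cvg_at_right_filter; apply/differentiable_continuous/derivable1_diffP.
    by have [] := dF (- K').
  + apply: cvg_at_left_filter; apply/differentiable_continuous/derivable1_diffP.
    by have [] := dF K'.
- by move=> x _; rewrite derive1E; have [_] := dF x.
Qed.

(** * The Euclidean norm and the radial projection onto the sphere *)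

Section sphere.
Variables (R : realType) (n : nat).
Local Notation N := (n + n)%N.
Local Notation V := 'rV[R]_N.
Implicit Types x y : V.

Definition sqnorm x := \sum_i x 0 i ^+ 2.

Lemma sqnorm_ge0 x : 0 <= sqnorm x.
Proof. by apply: sumr_ge0 => i _; exact: sqr_ge0. Qed.

Lemma enorm_ge0 x : 0 <= enorm x.
Proof. exact: sqrtr_ge0. Qed.

Lemma sqr_enorm x : enorm x ^+ 2 = sqnorm x.
Proof. by rewrite sqr_sqrtr// sqnorm_ge0. Qed.

Lemma coord_le_enorm x i : `|x 0 i| <= enorm x.
Proof.
rewrite -sqrtr_sqr ler_wsqrtr// (bigD1 i)//= lerDl.
by apply: sumr_ge0 => j _; exact: sqr_ge0.
Qed.

Lemma enorm_eq0 x : enorm x = 0 -> x = 0.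
Proof.
move=> x0; apply/rowP => i; rewrite mxE; apply/eqP.
by rewrite -normr_le0 -x0 coord_le_enorm.
Qed.

Lemma enormZ a x : enorm (a *: x) = `|a| * enorm x.
Proof.
rewrite -sqrtr_sqr -sqrtrM ?sqr_ge0// mulr_sumr; congr Num.sqrt.
by apply: eq_bigr => i _; rewrite !mxE exprMn.
Qed.

Lemma enorm0 : enorm (0 : V) = 0.
Proof. by rewrite -(scale0r (0 : V)) enormZ normr0 mul0r. Qed.

Lemma enorm_delta i : enorm (delta_mx 0 i : V) = 1.
Proof.
rewrite /enorm (bigD1 i)//= mxE !eqxx big1 ?addr0 ?expr1n ?sqrtr1// => j ji.
by rewrite mxE (negbTE ji) expr0n.
Qed.

Lemma hasgrad_sqnorm x : hasgrad sqnorm (fun i => 2 * x 0 i) x.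
Proof.
have := hasgrad_sum (index_enum 'I_N)
  (fun j => hasgradM (hasgrad_coord j x) (hasgrad_coord j x)).
rewrite (_ : (fun y => _) = sqnorm) => [/hasgrad_eq|]; last first.
  by apply/funext => y; apply: eq_bigr => i _; rewrite expr2.
apply=> i; rewrite (bigD1 i)//= eqxx /= big1 ?addr0 => [|j ji]; last first.
  by rewrite eq_sym (negbTE ji) mulr0 addr0.
by rewrite mulr1 mulr_natl mulr2n.
Qed.

Lemma hasgrad_enorm x : x != 0 -> hasgrad (@enorm R n) (fun i => x 0 i / enorm x) x.
Proof.
move=> x0; have s0 : 0 < enorm x.
  by rewrite lt_neqAle enorm_ge0 andbT eq_sym; apply: contra x0 => /eqP/enorm_eq0->.
have q0 : 0 < sqnorm x by rewrite -sqr_enorm exprn_gt0.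
apply: hasgrad_eq (hasgrad_comp (is_derive1_sqrt q0) (hasgrad_sqnorm x)) _ => i.
rewrite -[Num.sqrt _]/(enorm x); field.
by rewrite gt_eqF.
Qed.

Lemma enorm_continuous : continuous (@enorm R n).
Proof.
move=> x; apply: (@continuous_comp _ _ _ sqnorm Num.sqrt); last exact: sqrt_continuous.
exact: hasgrad_cont (hasgrad_sqnorm x).
Qed.

Definition sdir x := (enorm x)^-1 *: x.

Lemma enorm_sdir x : x != 0 -> enorm (sdir x) = 1.
Proof.
move=> x0; rewrite enormZ ger0_norm ?invr_ge0 ?enorm_ge0// mulVf//.
by apply: contra x0 => /eqP/enorm_eq0->.
Qed.

Lemma sdir_continuous x : x != 0 -> {for x, continuous sdir}.
Proof.
move=> x0; have cV : {for x, continuous (fun y : V => (enorm y)^-1)}.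
  apply: continuousV; last exact: enorm_continuous.
  by apply: contra x0 => /eqP/enorm_eq0->.
exact: (cvgZ cV (@cvg_id _ (nbhs x))).
Qed.

Lemma hasgrad_sdir x j : x != 0 ->
  hasgrad (fun y => sdir y 0 j)
    (fun i => (i == j)%:R / enorm x - sdir x 0 i * sdir x 0 j / enorm x) x.
Proof.
move=> x0; have s0 : enorm x != 0 by apply: contra x0 => /eqP/enorm_eq0->.
have dV : is_derive (enorm x) 1 (fun s : R => s^-1) (- (enorm x) ^- 2).
  by have := @is_deriveV R id (enorm x) 1 1 s0 (is_derive_id _ _); rewrite /GRing.scale /= mulr1.
have := hasgradM (hasgrad_comp dV (hasgrad_enorm x0)) (hasgrad_coord j x).
rewrite (_ : (fun y => _) = (fun y => sdir y 0 j)) => [/hasgrad_eq|]; last first.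
  by apply/funext => y; rewrite mxE.
by apply=> i; rewrite !mxE; field.
Qed.

(* The derivative along [delta_mx 0 i] of [T \o sdir], the projection of a
   neighbourhood of the sphere onto it along rays *)
Lemma derive_comp_sdir (T : V -> R) (T' : 'I_N -> R) x i : x != 0 ->
  hasgrad T T' (sdir x) ->
  is_derive x (delta_mx 0 i) (T \o sdir)
    ((T' i - sdir x 0 i * \sum_j sdir x 0 j * T' j) / enorm x).
Proof.
move=> x0 hT.
pose c (t : R) := sdir (t *: delta_mx 0 i + x).
have c0 : c 0 = sdir x by rewrite /c scale0r add0r.
have dc (j : 'I_N) : is_derive (0 : R) 1 (fun s : R => c s 0 j)
    ((i == j)%:R / enorm x - sdir x 0 i * sdir x 0 j / enorm x).
  have hj := hasgrad_partial i (hasgrad_sdir j x0).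
  have E : 0 *: delta_mx 0 i + x = x by rewrite scale0r add0r.
  have := @line_derive _ _ (fun y => sdir y 0 j) (delta_mx 0 i) x 0.
  by rewrite E derive_val; apply; case: hj.
have hT0 : hasgrad T T' (c 0) by rewrite c0.
have [d1 d2] := hasgrad_curve hT0 dc.
have D : derivable (T \o sdir) x (delta_mx 0 i) by apply/derivable1P.
apply: DeriveDef => //.
have E : 0 *: delta_mx 0 i + x = x by rewrite scale0r add0r.
have := @line_derive _ _ (T \o sdir) (delta_mx 0 i) x 0; rewrite E => /(_ D)[_].
rewrite -[LHS]/('D_1 (fun s => T (c s)) 0) d2 => <-.
rewrite mulrBl mulr_sumr mulr_suml.
under eq_bigr do rewrite mulrBl.
rewrite sumrB; congr (_ - _).
  rewrite (bigD1 i)//= eqxx big1 ?addr0; first by rewrite mulrC mul1r.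
  by move=> j ji; rewrite eq_sym (negbTE ji) !mul0r.
by apply: eq_bigr => j _; ring.
Qed.

End sphere.

(** * Radial cutoffs *)

Section cutoff.
Variables (R : realType) (e : R).
Hypotheses (e0 : 0 < e).
Implicit Types s : R.

(* A C^1 function of [s = |x|^2], supported in [e <= s <= 1], which tends to 1
   on ]0, 1[ as [e] tends to 0 *)
Definition bump s := Num.max ((s - e) * (1 - s)) 0 ^+ 2.
Definition bump' s := 2 * Num.max ((s - e) * (1 - s)) 0 * (1 + e - 2 * s).
Definition cutoff s := bump s / (bump s + e).
Definition cutoff' s := e * bump' s / (bump s + e) ^+ 2.

Lemma bump_ge0 s : 0 <= bump s. Proof. exact: sqr_ge0. Qed.

Lemma bumpe_gt0 s : 0 < bump s + e. Proof. by rewrite ltr_wpDl// bump_ge0. Qed.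

Lemma cutoff_eq0 s : (s <= e) || (1 <= s) -> e < 1 -> cutoff s = 0 /\ cutoff' s = 0.
Proof.
move=> se e1.
have m0 : (s - e) * (1 - s) <= 0.
  by case/orP: se => se; [rewrite mulr_le0_ge0|rewrite mulr_ge0_le0]; lra.
by rewrite /cutoff /cutoff' /bump /bump' max_r// expr0n /= mulr0 !mul0r mulr0 mul0r.
Qed.

Lemma cutoff_ge0_le1 s : 0 <= cutoff s <= 1.
Proof.
rewrite /cutoff; have b0 := bump_ge0 s; have be := bumpe_gt0 s.
rewrite divr_ge0 ?(ltW be)//= ler_pdivrMr// mul1r lerDl; exact: ltW.
Qed.

Lemma is_derive_bump s : is_derive s 1 bump (bump' s).
Proof.
have d1 : is_derive s 1 (fun t : R => (t - e) * (1 - t)) (1 + e - 2 * s).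
  by apply: is_derive_eq; rewrite /GRing.scale /=; ring.
have := @is_derive1_comp R (fun t => Num.max t 0 ^+ 2) (fun t => (t - e) * (1 - t)) s _ _
  (is_derive_sqr_max0 _) d1.
exact.
Qed.

Lemma is_derive_cutoff s : is_derive s 1 cutoff (cutoff' s).
Proof.
have be := bumpe_gt0 s.
have d1 := is_derive_bump s.
have d2 : is_derive s 1 (fun t => bump t + e) (bump' s).
  by apply: is_derive_eq; rewrite addr0.
have d3 := @is_deriveV R (fun t => bump t + e) s _ 1 (lt0r_neq0 be) d2.
apply: (is_derive_eq (is_deriveM d1 d3)).
rewrite /GRing.scale /= /cutoff'; field.
by rewrite gt_eqF.
Qed.

Lemma cutoff_continuous : continuous cutoff.
Proof.
move=> s; apply/differentiable_continuous/derivable1_diffP.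
by have [] := is_derive_cutoff s.
Qed.

Lemma bump_continuous : continuous bump.
Proof.
move=> s; apply/differentiable_continuous/derivable1_diffP.
by have [] := is_derive_bump s.
Qed.

Lemma cutoff'_continuous : continuous cutoff'.
Proof.
move=> s; have cm : {for s, continuous (fun t => (t - e) * (1 - t))}.
  by apply: continuousM; apply: continuousB => //; exact: cst_continuous.
have cb : {for s, continuous bump'}.
  apply: (@continuousM _ _ (fun t => 2 * Num.max ((t - e) * (1 - t)) 0) (fun t => 1 + e - 2 * t)).
    apply: continuousM; first exact: cst_continuous.
    by apply: continuous_max => //; exact: cst_continuous.
  apply: continuousB; first exact: cst_continuous.
  by apply: continuousM => //; exact: cst_continuous.
apply: (@continuousM _ _ (fun t => e * bump' t) (fun t => ((bump t + e) ^+ 2)^-1)).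
  by apply: continuousM => //; exact: cst_continuous.
apply: continuousV; first by rewrite expf_neq0// gt_eqF// bumpe_gt0.
apply: (@continuousM _ _ (fun t => bump t + e) (fun t => bump t + e));
  by apply: continuousD; [exact: bump_continuous|exact: cst_continuous].
Qed.

End cutoff.

(** * Tangential divergence as a sum of exact derivatives *)

Section tangential_divergence.
Variables (R : realType) (n : nat).
Local Notation N := (n + n)%N.
Local Notation V := 'rV[R]_N.
Variables (T : 'I_N -> V -> R) (T' : 'I_N -> 'I_N -> V -> R).
Hypothesis dT : forall x, enorm x = 1 -> forall i,
  hasgrad (T i) (T' i ^~ x) x /\ forall j, {for x, continuous (T' i j)}.
Hypothesis tanT : forall x, enorm x = 1 -> \sum_i x 0 i * T i x = 0.

(** At a unit vector this is the divergence of the radially constant extension [T \o sdir]: the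
    trace of the derivative minus its normal-normal entry. *)
Definition tan_div (x : V) :=
  \sum_i T' i i x - \sum_i \sum_j x 0 i * x 0 j * T' i j x.

Variable e : R.
Hypothesis (e01 : 0 < e < 1).

(** The factor [enorm x] cancels the [1 / enorm x] produced by differentiating [sdir]. [E i] is the
    derivative of [G i] in direction [i]. *)
Let G i (x : V) := enorm x * cutoff e (sqnorm x) * T i (sdir x).
Let E i (x : V) := sdir x 0 i * cutoff e (sqnorm x) * T i (sdir x)
   + enorm x * (cutoff' e (sqnorm x) * (2 * x 0 i)) * T i (sdir x)
   + cutoff e (sqnorm x) *
       (T' i i (sdir x) - sdir x 0 i * \sum_j sdir x 0 j * T' i j (sdir x)).

Let GE_eq0 i x : (sqnorm x <= e) || (1 <= sqnorm x) -> G i x = 0 /\ E i x = 0.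
Proof.
have /andP[e0 e1] := e01; move=> /cutoff_eq0/(_ e1)[c c'].
by rewrite /G /E c c' !(mulr0,mul0r,addr0).
Qed.

(** The cutoff vanishes on a whole neighbourhood of the origin, where [sdir] is singular; this
    settles differentiability and continuity there. *)
Let near0 : \forall y \near (0 : V), sqnorm y <= e.
Proof.
have /andP[e0 e1] := e01.
have : {for (0 : V), continuous (@sqnorm R n)} by exact: hasgrad_cont (hasgrad_sqnorm _).
rewrite /prop_for /continuous_at -(sqr_enorm 0) enorm0 expr0n /= => /cvgrPdist_le/(_ _ e0).
by apply: filterS => y; rewrite sub0r normrN ger0_norm// sqnorm_ge0.
Qed.

Let sq0 : sqnorm (0 : V) <= e.
Proof. by rewrite -sqr_enorm enorm0 expr0n /= ltW//; have /andP[] := e01. Qed.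

Let derG i x : is_derive x (delta_mx 0 i) (G i) (E i x).
Proof.
have /andP[e0 e1] := e01.
have [->|x0] := eqVneq x 0.
  rewrite (GE_eq0 i _).2 ?sq0//; apply: (@near_eq_is_derive _ _ _ (fun=> 0)).
    by apply: filterS near0 => y ye; rewrite (GE_eq0 i _).1// ye.
have s0 : enorm x != 0 by apply: contra x0 => /eqP/enorm_eq0->.
have [dTi _] := dT (enorm_sdir x0) i.
have d1 := hasgradM (hasgrad_enorm x0)
  (hasgrad_comp (is_derive_cutoff e0 (sqnorm x)) (hasgrad_sqnorm x)).
apply: (is_derive_eq (is_deriveM (hasgrad_partial i d1) (derive_comp_sdir i x0 dTi))).
rewrite /GRing.scale /= /E !mxE; field.
exact: s0.
Qed.

Let contE i : continuous (E i).
Proof.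
have /andP[e0 e1] := e01; move=> x.
have [->|x0] := eqVneq x 0.
  rewrite /continuous_at (GE_eq0 i _).2 ?sq0//.
  have nE : \forall y \near (0 : V), E i y = 0.
    by apply: filterS near0 => y ye; rewrite (GE_eq0 i _).2// ye.
  move=> P P0; apply: filterS nE => y /= ->; exact: nbhs_singleton P0.
have cs := sdir_continuous x0.
have csi j : {for x, continuous (fun y : V => sdir y 0 j)}.
  exact: (continuous_comp cs (@coord_continuous _ _ _ 0 j _)).
have csq : {for x, continuous (@sqnorm R n)} by exact: hasgrad_cont (hasgrad_sqnorm _).
have cT : {for x, continuous (fun y => T i (sdir y))}.
  by apply: (continuous_comp cs); have [/hasgrad_cont] := dT (enorm_sdir x0) i.
have cT' j : {for x, continuous (fun y => T' i j (sdir y))}.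
  by apply: (continuous_comp cs); have [_] := dT (enorm_sdir x0) i; exact.
have cc : {for x, continuous (fun y => cutoff e (sqnorm y))}.
  exact: (continuous_comp csq (@cutoff_continuous _ _ e0 _)).
have cc' : {for x, continuous (fun y => cutoff' e (sqnorm y))}.
  exact: (continuous_comp csq (@cutoff'_continuous _ _ e0 _)).
have c1 : {for x, continuous (fun y =>
    sdir y 0 i * cutoff e (sqnorm y) * T i (sdir y))}.
  by apply: continuousM => //; exact: continuousM.
have c2 : {for x, continuous (fun y =>
    enorm y * (cutoff' e (sqnorm y) * (2 * y 0 i)) * T i (sdir y))}.
  apply: continuousM => //; apply: continuousM; first exact: enorm_continuous.
  apply: continuousM => //; apply: continuousM; first exact: cst_continuous.
  exact: coord_continuous.
have c3 : {for x, continuous (fun y => cutoff e (sqnorm y) *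
    (T' i i (sdir y) - sdir y 0 i * \sum_j sdir y 0 j * T' i j (sdir y)))}.
  apply: continuousM => //; apply: continuousB => //; apply: continuousM => //.
  by apply: continuous_at_sum => j; exact: continuousM.
exact: (continuousD (continuousD c1 c2) c3).
Qed.

(** Each [F i] is a derivative in direction [i] of a function that vanishes off the unit ball, so
    its integral along every line in that direction is 0. Only the sum over [i] has a geometric
    meaning. *)
Lemma tangential_divergence_form : exists F : 'I_N -> V -> R,
  [/\ (forall i, continuous (F i)),
      (forall i (x : V), (exists j, 1 < `|x 0 j|) -> F i x = 0),
      (forall i (x : V), x 0 i = 0 ->
         (\int[@lebesgue_measure R]_t (F i (t *: delta_mx 0 i + x))%:E = 0)%E) &
      (forall x : V, \sum_i F i x = cutoff e (sqnorm x) * tan_div (sdir x))].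
Proof.
have /andP[e0 e1] := e01.
have big (x : V) j : 1 <= `|x 0 j| -> 1 <= sqnorm x.
  move=> xj; rewrite -sqr_enorm -(expr1n _ 2) ler_pXn2r ?nnegrE ?enorm_ge0//.
  exact: le_trans xj (coord_le_enorm _ _).
exists E; split.
- exact: contE.
- by move=> i x [j xj]; rewrite (GE_eq0 i _).2// (big _ j) ?orbT// ltW.
- move=> i x xi; apply: (@integral_derive_compact_support _
     (fun t => G i (t *: delta_mx 0 i + x)) _ 1).
  + move=> t; have [dG vG] := derG i (t *: delta_mx 0 i + x).
    by rewrite -vG; exact: line_derive.
  + move=> t; apply: (@continuous_comp _ _ _ (fun s : R => s *: delta_mx 0 i + x)); last exact: contE.
    apply: cvgD; last exact: cvg_cst.
    by apply: cvgZr_tmp; exact: cvg_id.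
  + move=> t t1; apply: GE_eq0; rewrite (big _ i) ?orbT//.
    by rewrite !mxE xi !eqxx addr0 mulr1.
- move=> x; have [->|x0] := eqVneq x 0.
    rewrite big1 => [|i _]; last by rewrite (GE_eq0 i _).2 ?sq0.
    by rewrite (cutoff_eq0 _ e1).1 ?mul0r// sq0.
  have s0 : enorm x != 0 by apply: contra x0 => /eqP/enorm_eq0->.
  (* The terms in which a radial factor is differentiated add up to multiples of the normal
     component of [T], which is zero. *)
  have tan := tanT (enorm_sdir x0).
  rewrite !big_split /= -mulr_sumr sumrB.
  have -> : \sum_i sdir x 0 i * cutoff e (sqnorm x) * T i (sdir x) =
      cutoff e (sqnorm x) * \sum_i sdir x 0 i * T i (sdir x).
    by rewrite mulr_sumr; apply: eq_bigr => i _; ring.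
  have -> : \sum_i enorm x * (cutoff' e (sqnorm x) * (2 * x 0 i)) * T i (sdir x) =
      enorm x ^+ 2 * cutoff' e (sqnorm x) * 2 * \sum_i sdir x 0 i * T i (sdir x).
    rewrite mulr_sumr; apply: eq_bigr => i _; rewrite mxE; field.
    exact: s0.
  rewrite tan !mulr0 !add0r /tan_div; congr (_ * (_ - _)).
  by apply: eq_bigr => i _; rewrite mulr_sumr; apply: eq_bigr => j _; rewrite mulrA.
Qed.

End tangential_divergence.

(** * The surface measure as a probability space *)

Section sphere_measure.
Variables (R : realType) (n : nat).
Hypothesis n0 : (0 < n)%N.
Local Notation N := (n + n)%N.
Local Notation V := 'rV[R]_N.

Lemma compact_sphere : compact [set x : V | enorm x = 1].
Proof.
apply: bounded_closed_compact.
  exists 1; split; first exact: num_real.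
  move=> M M1 x /= x1; rewrite [leLHS]/Num.Def.normr/= mx_normrE.
  apply: bigmax_le => [|[i j] _ /=]; first exact: le_trans ler01 (ltW M1).
  by rewrite [i]ord1 (le_trans (coord_le_enorm _ _))// x1 ltW.
apply: (@preimage_closed _ _ (@enorm R n) [set 1]).
  by move=> x _; exact: enorm_continuous.
exact: closed_eq.
Qed.

Lemma continuous_tan_div (T' : 'I_N -> 'I_N -> V -> R) x :
  (forall i j, {for x, continuous (T' i j)}) -> {for x, continuous (tan_div T')}.
Proof.
move=> cT.
have c1 : {for x, continuous (fun y => \sum_i T' i i y)} by exact: continuous_at_sum.
have c2 : {for x, continuous (fun y : V => \sum_i \sum_j y 0 i * y 0 j * T' i j y)}.
  apply: continuous_at_sum => i; apply: continuous_at_sum => j.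
  apply: continuousM => //; apply: continuousM; exact: coord_continuous.
exact: (continuousB c1 c2).
Qed.

(** [P] is normalized Lebesgue measure on the unit ball and [Z] the direction of the random point,
    which is the cone-measure description of [sigma]. The last clause is the divergence theorem on
    the closed manifold [|x| = 1], the only fact about the geometry of [sigma] used afterwards. *)
Lemma sphere_measure_exists : exists (d : measure_display) (T : measurableType d)
    (P : {measure set T -> \bar R}) (Z : T -> V),
  [/\ P setT = 1%E,
      (forall i, measurable_fun setT (fun t => Z t 0 i)),
      (forall t, enorm (Z t) = 1),
      (forall h : V -> R, (forall x, 0 <= h x) ->
        measurable_fun setT (fun t => h (Z t)) ->
        sphere_int (fun x => (h x)%:E) = (\int[P]_t (h (Z t))%:E)%E) &
      (forall (T : 'I_N -> V -> R) (T' : 'I_N -> 'I_N -> V -> R),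
        (forall x, enorm x = 1 -> forall i,
          hasgrad (T i) (T' i ^~ x) x /\ forall j, {for x, continuous (T' i j)}) ->
        (forall x, enorm x = 1 -> \sum_i x 0 i * T i x = 0) ->
        \int[P]_t tan_div T' (Z t) = 0)].
Proof.
have [d [T [mu [X [sX mX iX boxX divX]]]]] := @iint_product_measure R N.
pose Y t : V := \row_(i < N) nth 0 (X t) i.
have mY i : measurable_fun setT (fun t => Y t 0 i).
  by under eq_fun do rewrite mxE; exact: mX.
have mEn : measurable_fun setT (fun t => enorm (Y t)).
  by apply: (@measurable_comp_row _ _ _ _ _ (@enorm R n)) => // t; exact: enorm_continuous.
pose D := [set t | enorm (Y t) < 1].
have mD : measurable D.
  have := mEn measurableT _ (measurable_itv `]-oo, (1 : R)[).
  by rewrite setTI; congr measurable; apply/seteqP; split => t /=; rewrite in_itv.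
have memD t : (t \in D) = (enorm (Y t) < 1) by apply/idP/idP; rewrite inE.
have XY t (a b : R) : all (fun x => a <= x <= b) (X t) <-> forall i, a <= Y t 0 i <= b.
  split=> [/(all_nthP 0) H i|H]; first by rewrite mxE; apply: H; rewrite sX.
  by apply/(all_nthP 0) => i; rewrite sX => iN; have := H (Ordinal iN); rewrite mxE.
have muD_fin : (mu D < +oo)%E.
  have [mB vB] := boxX (-1) 1 (ltac:(lra)).
  apply: (@le_lt_trans _ _ ((1 - -1) ^+ N)%:E); last exact: ltry.
  rewrite -vB; apply: le_measure; rewrite ?inE// => t /= tD.
  by apply/XY => i; rewrite -ler_norml (le_trans (coord_le_enorm _ _))// ltW.
have muD_gt0 : (0 < mu D)%E.
  (* The cube of side [1/(N+1)] at the origin lies in the ball, since [N / (N+1)^2 < 1]; so the ball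
     has positive measure. *)
  pose a : R := N.+1%:R^-1.
  have a0 : 0 < a by rewrite invr_gt0 ltr0n.
  have [mB vB] := boxX 0 a (ltW a0).
  apply: (@lt_le_trans _ _ ((a - 0) ^+ N)%:E).
    by rewrite subr0 lte_fin exprn_gt0.
  rewrite -vB; apply: le_measure; rewrite ?inE// => t /= /XY tB.
  rewrite /D /= -sqrtr1 ltr_sqrt//.
  apply: (@le_lt_trans _ _ (\sum_(i < N) a ^+ 2)).
    by apply: ler_sum => i _; have /andP[? ?] := tB i; rewrite ler_pXn2r// nnegrE// ltW.
  rewrite sumr_const card_ord -mulr_natl expr2 mulrA.
  apply: (@le_lt_trans _ _ (1 * a)).
    by rewrite ler_pM2r// /a ler_pdivrMr ?ltr0n// mul1r ler_nat.
  by rewrite mul1r invf_lt1 ?ltr0n// ltr1n ltnS addn_gt0 n0.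
have muD : mu D = (fine (mu D))%:E by rewrite fineK// ge0_fin_numE.
pose vol := fine (mu D).
have vol0 : 0 < vol by rewrite -lte_fin -muD.
have volE : ball_vol R n = mu D.
  rewrite /ball_vol /vint iX.
  - rewrite -[RHS]mul1e -integral_cst//; rewrite [RHS]integral_mkcond.
    by apply: eq_integral => t _; rewrite patchE memD; case: ifP.
  - by move=> s; rewrite lee_fin; case: ifP.
  - apply/measurable_EFinP; apply: measurable_fun_ifT => //.
    exact: measurable_fun_ltr.
pose i0 : 'I_N := Ordinal (leq_trans n0 (leq_addr n n)).
(* At the origin an arbitrary unit vector is chosen, so that [Z] takes values in the sphere
   everywhere. *)
pose Z t : V := if enorm (Y t) == 0 then delta_mx 0 i0 else sdir (Y t).
have mZ0 : measurable_fun setT (fun t => enorm (Y t) == 0).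
  exact: measurable_fun_eqr.
have mZ i : measurable_fun setT (fun t => Z t 0 i).
  rewrite (_ : (fun t => _) = (fun t => if enorm (Y t) == 0 then (delta_mx 0 i0 : V) 0 i
     else enorm (Y t) `^ (-1) * Y t 0 i)); last first.
    apply/funext => t; rewrite /Z; case: ifP => // _.
    by rewrite mxE powR_inv1// enorm_ge0.
  apply: measurable_fun_ifT => //; apply: measurable_funM => //.
  exact: (measurableT_comp (measurable_powR (-1)) mEn).
have Z1 t : enorm (Z t) = 1.
  rewrite /Z; case: ifPn => [_|Y0]; first exact: enorm_delta.
  by apply: enorm_sdir; apply: contra Y0 => /eqP ->; rewrite enorm0.
have Y0_null : mu [set t | enorm (Y t) = 0] = 0%E /\ measurable [set t | enorm (Y t) = 0].
  have [mB vB] := boxX 0 0 (lexx 0).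
  have -> : [set t | enorm (Y t) = 0] = [set u | all (fun x => 0 <= x <= 0) (X u)].
    apply/seteqP; split => t /=.
      by move=> /enorm_eq0 Y0; apply/XY => i; rewrite Y0 mxE lexx.
    move=> /XY H; rewrite (_ : Y t = 0) ?enorm0//; apply/rowP => i; rewrite [RHS]mxE.
    by apply/le_anti; rewrite andbC.
  by rewrite vB subrr expr0n addn_eq0 eqn0Ngt n0.
have [Yn mYn] := Y0_null.
pose kV : {nonneg R} := NngNum (ltac:(by rewrite invr_ge0 ltW) : 0 <= vol^-1).
pose P : {measure set T -> \bar R} := mscale kV (mrestr mu mD).
have intP (h : T -> R) : (forall t, 0 <= h t) -> measurable_fun setT h ->
    (\int[P]_t (h t)%:E = vol^-1%:E * \int[mu]_(t in D) (h t)%:E)%E.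
  move=> h0 mh; rewrite ge0_integral_mscale//; last first.
  - by move=> t _; rewrite lee_fin.
  - exact/measurable_EFinP.
  congr (_ * _)%E.
  rewrite -(setvU D) ge0_integral_setU//; last first.
  - by rewrite disj_set2E setICl.
  - by move=> t _; rewrite lee_fin.
  - by rewrite setvU; exact/measurable_EFinP.
  - exact: measurableC.
  rewrite null_set_integral ?add0e//.
  - by apply: eq_measure_integral => A mA AD; rewrite /= /mrestr setIidl.
  - exact: measurableC.
  - by apply: measurable_funTS; exact/measurable_EFinP.
  - by rewrite /= /mrestr setICl.
exists d, T, P, Z; split => //.
- rewrite /P /= /mscale /= /mrestr setTI muD -EFinM mulVf// gt_eqF//.
- move=> h h0 mh; rewrite intP// muleC /sphere_int volE; congr (_ * _)%E.
  (* At the origin [sphere_int] evaluates [h] at [0], because [0^-1 = 0], while [Z] is a unit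
     vector. The two integrands differ only on that null set. *)
  have mh' : measurable_fun setT (fun t => if enorm (Y t) == 0 then h 0 else h (Z t)).
    exact: measurable_fun_ifT.
  rewrite /vint iX.
  + transitivity (\int[mu]_(t in D) (if enorm (Y t) == 0 then h 0 else h (Z t))%:E)%E.
      rewrite [RHS]integral_mkcond; apply: eq_integral => t _.
      rewrite patchE memD; case: ifP => // _; rewrite /Z.
      by case: eqVneq => [->|//]; rewrite invr0 scale0r.
    apply: ge0_ae_eq_integral => //.
    * by apply: measurable_funTS; exact/measurable_EFinP.
    * by apply: measurable_funTS; exact/measurable_EFinP.
    * by move=> t _; rewrite lee_fin; case: ifP.
    * by move=> t _; rewrite lee_fin.
    * exists [set t | enorm (Y t) = 0]; split => // t /=.
      by apply: contra_notP => /eqP/negbTE Y0 _; rewrite Y0.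
  + by move=> s; case: ifP => _ //; rewrite lee_fin.
  + have -> : (fun s => (if enorm (\row_(i < N) nth 0 s i : V) < 1 then
         (h ((enorm (\row_(i < N) nth 0 s i : V))^-1 *: (\row_(i < N) nth 0 s i)))%:E else 0%E)) \o X =
       (EFin \o (fun t => if enorm (Y t) < 1 then (if enorm (Y t) == 0 then h 0 else h (Z t)) else 0)).
      apply/funext => t /=; rewrite -/(Y t); case: ifP => // _; rewrite /Z.
      by case: eqVneq => [->|//]; rewrite invr0 scale0r.
    apply/measurable_EFinP; apply: measurable_fun_ifT => //.
    exact: measurable_fun_ltr.
move=> F F' dF tanF.
have cq x : enorm x = 1 -> {for x, continuous (tan_div F')}.
  by move=> x1; apply: continuous_tan_div => i j; have [_] := dF _ x1 i; exact.
have mq : measurable_fun setT (fun t => tan_div F' (Z t)).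
  by apply: (measurable_comp_row mZ) => t; exact: cq.
have [M M0 MP] := continuous_compact_bounded compact_sphere cq.
have qM t : `|tan_div F' (Z t)| <= M by exact: MP.
have iq (A : set T) : measurable A -> (mu A < +oo)%E ->
    mu.-integrable A (fun t => (tan_div F' (Z t))%:E).
  move=> mA Aoo; apply: measurable_bounded_integrable => //.
    exact: measurable_funTS.
  by exists M; split => [|m Mm t _]; [exact: num_real|exact: le_trans (qM t) (ltW Mm)].
(* For each cutoff parameter [1/(k+2)] the integral is a sum of integrals of exact derivatives,
   hence 0. The cutoffs tend to 1 on the punctured ball, and dominated convergence removes them. *)
have zero : (\int[mu]_(t in D) (tan_div F' (Z t))%:E = 0)%E.
  pose ee (k : nat) : R := k.+2%:R^-1.
  have ee01 k : 0 < ee k < 1.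
    by rewrite invr_gt0 ltr0n /= invf_lt1 ?ltr0n// ltr1n.
  have ee_cvg0 : ee x @[x --> \oo] --> 0.
    by have := @cvg_harmonic R; rewrite -(cvg_shiftn 1); under eq_fun do rewrite addn1.
  pose f (k : nat) t : R := cutoff (ee k) (sqnorm (Y t)) * tan_div F' (Z t).
  have mf k : measurable_fun setT (f k).
    apply: measurable_funM => //.
    apply: (@measurable_comp_row _ _ _ _ _ (cutoff (ee k) \o @sqnorm R n)) => // t.
    apply: continuous_comp; first exact: hasgrad_cont (hasgrad_sqnorm _).
    by apply: cutoff_continuous; have /andP[] := ee01 k.
  have int0 k : (\int[mu]_(t in D) (f k t)%:E = 0)%E.
    have [E [cE E0 iE EE]] := tangential_divergence_form dF tanF (ee01 k).
    have mE i : measurable_fun setT (fun t => E i (Y t)).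
      by apply: (measurable_comp_row mY) => t; exact: cE.
    have EM i := continuous_compact_support_bounded (cE i) (E0 i).
    have [B [mB vB BE]] : exists B : set T, [/\ measurable B, (mu B < +oo)%E &
        forall t, (t \in B) = all (fun x => - 1 <= x <= 1) (X t)].
      have [mB vB] := boxX (-1) 1 (ltac:(lra)).
      exists [set u | all (fun x => - 1 <= x <= 1) (X u)]; split => //.
        by rewrite vB ltry.
      by move=> t; apply/idP/idP; rewrite inE.
    have intE i : mu.-integrable setT (fun t => (E i (Y t))%:E).
      have -> : (fun t => (E i (Y t))%:E) = (fun t => (E i (Y t))%:E) \_ B.
        apply/funext => t; rewrite patchE; case: ifPn => //; rewrite BE => /negP tB.
        rewrite E0//; apply: contra_notP tB => /forallNP H; apply/XY => j.
        by rewrite -ler_norml leNgt; apply/negP; exact: H.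
      apply/(integrable_mkcond _ mB); apply: measurable_bounded_integrable => //.
      - exact: measurable_funTS.
      - have [M' M'0 EM'] := EM i; exists M'.
        by split => [|m Mm t _]; [exact: num_real|exact: le_trans (EM' _) (ltW Mm)].
    transitivity (\int[mu]_t \sum_(i < N) (E i (Y t))%:E)%E.
      rewrite integral_mkcond; apply: eq_integral => t _.
      rewrite sumEFin EE /f patchE memD.
      have [/enorm_eq0 Y00|Y0] := eqVneq (enorm (Y t)) 0.
        have c0 : cutoff (ee k) (sqnorm (Y t)) = 0.
          have /andP[e0 e1] := ee01 k; apply: (cutoff_eq0 _ e1).1.
          by rewrite Y00 -sqr_enorm enorm0 expr0n /= ltW.
        by rewrite c0 !mul0r; case: ifP.
      rewrite /Z (negbTE Y0); case: ifPn => //; rewrite -leNgt => Y1.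
      have /andP[e0 e1] := ee01 k.
      rewrite (cutoff_eq0 _ e1).1 ?mul0r//; apply/orP; right.
      by rewrite -sqr_enorm -[leLHS](expr1n _ 2) ler_pXn2r ?nnegrE ?enorm_ge0.
    rewrite integral_sum// big1// => i _.
    have [M' M'0 EM'] := EM i.
    apply: (divX (fun s => E i (\row_(j < N) nth 0 s j)) M' 1 i) => //.
    - exact: mE.
    - move=> s ss; rewrite -has_predC => /(has_nthP 0)[j]; rewrite ss /= => jN.
      rewrite -ler_norml -ltNge => z1.
      by apply: E0; exists (Ordinal jN); rewrite mxE.
    - move=> s ss; pose x0 : V := \row_(j < N) nth 0 (set_nth 0 s i 0) j.
      have xi : x0 0 i = 0 by rewrite mxE nth_set_nth /= eqxx.
      rewrite -[RHS](iE i x0 xi); apply: eq_integral => t _; congr (E i _)%:E.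
      apply/rowP => j; rewrite !mxE !nth_set_nth /= ?eqxx /=.
      rewrite -val_eqE /=; case: eqP => _; first by rewrite mulr1 addr0.
      by rewrite mulr0 add0r.
  pose fl t : R := if enorm (Y t) == 0 then 0 else tan_div F' (Z t).
  have mfl : measurable_fun setT fl by exact: measurable_fun_ifT.
  have cvgf t : D t -> (f k t)%:E @[k --> \oo] --> (fl t)%:E.
    move=> Dt; apply: cvg_EFin; first exact: nearW.
    rewrite /comp /= /fl; have [Y0|Y0] := eqVneq (enorm (Y t)) 0.
      have -> : (fun k => f k t) = fun=> 0; last exact: cvg_cst.
      apply/funext => k; have /andP[e0 e1] := ee01 k; rewrite /f (cutoff_eq0 _ e1).1 ?mul0r//.
      by rewrite -sqr_enorm Y0 expr0n /= ltW.
    rewrite -[X in _ --> X]mul1r; apply: cvgM; last exact: cvg_cst.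
    set s := sqnorm (Y t).
    have Yp : 0 < enorm (Y t) by rewrite lt_neqAle eq_sym Y0 enorm_ge0.
    have s0 : 0 < s by rewrite /s -sqr_enorm exprn_gt0.
    have s1 : s < 1 by rewrite /s -sqr_enorm expr_lt1 ?enorm_ge0.
    pose phi (e : R) := Num.max ((s - e) * (1 - s)) 0 ^+ 2 /
      (Num.max ((s - e) * (1 - s)) 0 ^+ 2 + e).
    have b0 : 0 < Num.max ((s - 0) * (1 - s)) 0 ^+ 2.
      by rewrite exprn_gt0// lt_max subr0 mulr_gt0// subr_gt0.
    have -> : 1 = phi 0 by rewrite /phi addr0 divff// gt_eqF.
    apply: (@cvg_comp _ _ _ ee phi _ (nbhs (0 : R))) => //.
    have cb : {for (0 : R), continuous (fun e => Num.max ((s - e) * (1 - s)) 0 ^+ 2)}.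
      have cm : {for (0 : R), continuous (fun e => Num.max ((s - e) * (1 - s)) 0)}.
        apply: continuous_max; last exact: cst_continuous.
        apply: continuousM; last exact: cst_continuous.
        by apply: continuousB => //; exact: cst_continuous.
      exact: (continuousM cm cm).
    apply: (continuousM cb); apply: continuousV; first by rewrite addr0 gt_eqF.
    exact: (continuousD cb).
  have : (\int[mu]_(t in D) (f k t)%:E)%E @[k --> \oo] -->
         (\int[mu]_(t in D) (fl t)%:E)%E.
    apply: (@dominated_cvg _ _ _ mu D mD (fun k t => (f k t)%:E) _ (cst M%:E)) => //.
    - by move=> k; apply: measurable_funTS; exact/measurable_EFinP.
    - apply: measurable_bounded_integrable => //.
      by exists M; split => [|m Mm t _]; [exact: num_real|rewrite /= ger0_norm// ltW].
    - move=> k t _; rewrite lee_fin /f normrM.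
      have /andP[e0 e1] := ee01 k; have /andP[c0 c1] := cutoff_ge0_le1 e0 (sqnorm (Y t)).
      by rewrite (ger0_norm c0) -[leRHS]mul1r ler_pM.
  under eq_fun do rewrite int0.
  move=> /(cvg_unique _)/(_ (cvg_cst _)) fl0.
  rewrite -[RHS](fl0 (@ereal_hausdorff R)); apply: ae_eq_integral => //.
  - by apply: measurable_funTS; exact/measurable_EFinP.
  - by apply: measurable_funTS; exact/measurable_EFinP.
  - exists [set t | enorm (Y t) = 0]; split => // t /=.
    by apply: contra_notP => /eqP/negbTE Y0 _; rewrite /fl Y0.
(* The comparison of [P] with [mu] in [intP] is for nonnegative functions, so the integrand is split
   into positive and negative parts. *)
pose q t := tan_div F' (Z t).
pose h1 t := Num.max (q t) 0.
pose h2 t := Num.max (- q t) 0.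
have qE t : q t = h1 t - h2 t.
  by rewrite /h1 /h2; case: (leP (q t) 0) => ?; case: (leP (- q t) 0) => ?; lra.
have mh1 : measurable_fun setT h1 by exact: measurable_maxr.
have mh2 : measurable_fun setT h2 by apply: measurable_maxr => //; exact: measurableT_comp.
have hM t : `|h1 t| <= M /\ `|h2 t| <= M.
  by have := qM t; rewrite /h1 /h2 -/(q t) !ler_norml => /andP[? ?];
    case: (leP (q t) 0) => ?; case: (leP (- q t) 0) => ?; split; apply/andP; split; lra.
have intb (nu : {measure set T -> \bar R}) (A : set T) (h : T -> R) : measurable A -> (nu A < +oo)%E ->
    measurable_fun setT h -> (forall t, `|h t| <= M) ->
    nu.-integrable A (EFin \o h).
  move=> mA Aoo mh hM'; apply: measurable_bounded_integrable => //.
    exact: measurable_funTS.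
  by exists M; split => [|m Mm t _]; [exact: num_real|exact: le_trans (hM' t) (ltW Mm)].
have P1 : (P setT < +oo)%E.
  by rewrite /P /= /mscale /= /mrestr setTI muD -EFinM ltry.
have RP (h : T -> R) : (forall t, 0 <= h t) -> measurable_fun setT h -> (forall t, `|h t| <= M) ->
    \int[P]_t h t = vol^-1 * \int[mu]_(t in D) h t.
  move=> h0 mh hM'; rewrite /Rintegral intP// fineM//.
  exact: (integrable_fin_num mD (intb mu D h mD muD_fin mh hM')).
have h1M t := (hM t).1; have h2M t := (hM t).2.
under eq_Rintegral do rewrite -/(q _) qE.
have h10 t : 0 <= h1 t by rewrite le_max lexx orbT.
have h20 t : 0 <= h2 t by rewrite le_max lexx orbT.
rewrite RintegralB//; try exact: intb.
rewrite !RP// -mulrBr -RintegralB//; try exact: intb.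
under eq_Rintegral do rewrite -qE.
by rewrite /Rintegral zero mulr0.
Qed.

End sphere_measure.

(** * Spherical means and their radial derivatives *)

Section sphere_means.
Variables (R : realType) (n : nat).
Hypothesis n0 : (0 < n)%N.
Local Notation N := (n + n)%N.
Local Notation V := 'rV[R]_N.
Variables (d : measure_display) (T : measurableType d).
Variables (P : {measure set T -> \bar R}) (Z : T -> V).
Hypothesis P1 : P setT = 1%E.
Hypothesis mZ : forall i, measurable_fun setT (fun t => Z t 0 i).
Hypothesis Z1 : forall t, enorm (Z t) = 1.
Implicit Types h g : V -> R.

Definition sphere_continuous h := forall x, enorm x = 1 -> {for x, continuous h}.

Definition mean h := \int[P]_t h (Z t).

Lemma measurable_sphere h : sphere_continuous h -> measurable_fun setT (fun t => h (Z t)).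
Proof. by move=> ch; apply: (measurable_comp_row mZ) => t; exact: ch. Qed.

Lemma integrable_bounded (f : T -> R) M : measurable_fun setT f ->
  (forall t, `|f t| <= M) -> P.-integrable setT (EFin \o f).
Proof.
move=> mf fM; apply: measurable_bounded_integrable => //; first by rewrite P1 ltry.
by exists M; split => [|m Mm t _]; [exact: num_real|exact: le_trans (fM t) (ltW Mm)].
Qed.

Lemma sphere_bounded h : sphere_continuous h ->
  exists2 M, 0 <= M & forall x, enorm x = 1 -> `|h x| <= M.
Proof. exact: (continuous_compact_bounded (@compact_sphere R n)). Qed.

Lemma integrable_sphere h : sphere_continuous h ->
  P.-integrable setT (EFin \o (fun t => h (Z t))).
Proof.
move=> ch; have [M _ hM] := sphere_bounded ch.
by apply: (@integrable_bounded _ M) => [|t]; [exact: measurable_sphere|exact: hM].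
Qed.

Lemma meanD g h : sphere_continuous g -> sphere_continuous h ->
  mean (fun x => g x + h x) = mean g + mean h.
Proof. by move=> cg ch; rewrite /mean RintegralD//; exact: integrable_sphere. Qed.

Lemma meanZ c h : sphere_continuous h -> mean (fun x => c * h x) = c * mean h.
Proof. by move=> ch; rewrite /mean RintegralZl//; exact: integrable_sphere. Qed.

Lemma eq_mean g h : (forall x, enorm x = 1 -> g x = h x) -> mean g = mean h.
Proof. by move=> gh; apply: eq_Rintegral => t _; exact: gh. Qed.

Lemma le_mean g h : sphere_continuous g -> sphere_continuous h ->
  (forall x, enorm x = 1 -> g x <= h x) -> mean g <= mean h.
Proof.
by move=> cg ch gh; apply: le_Rintegral => // [||t _]; [exact: integrable_sphere..|exact: gh].
Qed.

Lemma mean_cst c : mean (fun=> c) = c.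
Proof. by rewrite /mean Rintegral_cst// P1 mulr1. Qed.

Lemma sphere_continuous_cst c : sphere_continuous (fun=> c).
Proof. by move=> x _; exact: cst_continuous. Qed.

Lemma sphere_continuous_sum (J : Type) (s : seq J) (h : J -> V -> R) :
  (forall j, sphere_continuous (h j)) -> sphere_continuous (fun x => \sum_(j <- s) h j x).
Proof. by move=> ch x x1; apply: continuous_at_sum => j; exact: ch. Qed.

Lemma sphere_continuousM g h : sphere_continuous g -> sphere_continuous h ->
  sphere_continuous (fun x => g x * h x).
Proof. by move=> cg ch x x1; apply: continuousM; [exact: cg|exact: ch]. Qed.

Lemma sphere_continuousD g h : sphere_continuous g -> sphere_continuous h ->
  sphere_continuous (fun x => g x + h x).
Proof. by move=> cg ch x x1; apply: continuousD; [exact: cg|exact: ch]. Qed.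

Lemma sphere_continuous_coord i : sphere_continuous (fun x : V => x 0 i).
Proof. by move=> x _; exact: coord_continuous. Qed.

Lemma sphere_continuous_scale g (s r : R) : `|s| < r ->
  (forall x, enorm x < r -> {for x, continuous g}) ->
  sphere_continuous (fun x => g (s *: x)).
Proof.
move=> sr cg x x1; apply: (@continuous_comp _ _ _ (fun y : V => s *: y)); first exact: scaler_continuous.
by apply: cg; rewrite enormZ x1 mulr1.
Qed.

Lemma mean_sum (J : Type) (s : seq J) (h : J -> V -> R) :
  (forall j, sphere_continuous (h j)) ->
  mean (fun x => \sum_(j <- s) h j x) = \sum_(j <- s) mean (h j).
Proof.
move=> ch; elim: s => [|j s IH].
  by rewrite big_nil -[RHS]mean_cst; apply: eq_mean => x _; rewrite big_nil.
rewrite big_cons -IH -meanD//; last exact: sphere_continuous_sum.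
by apply: eq_mean => x _; rewrite big_cons.
Qed.

Lemma compact_ball r : compact [set x : V | enorm x <= r].
Proof.
apply: bounded_closed_compact.
  exists `|r|; split; first exact: num_real.
  move=> M M1 x /= x1; rewrite [leLHS]/Num.Def.normr/= mx_normrE.
  apply: bigmax_le => [|[i j] _ /=]; first exact: le_trans (normr_ge0 r) (ltW M1).
  rewrite [i]ord1 (le_trans (coord_le_enorm _ _))// (le_trans x1)//.
  exact: le_trans (ler_norm r) (ltW M1).
apply: (@preimage_closed _ _ (@enorm R n) [set y | y <= r]).
  by move=> x _; exact: enorm_continuous.
exact: closed_le.
Qed.

Section jets.
Variable r : R.

Definition C1jet g (g1 : 'I_N -> V -> R) := forall x, enorm x < r ->
  hasgrad g (g1 ^~ x) x /\ forall i, {for x, continuous (g1 i)}.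

(** [g2 i j] is the derivative of [g1 i] in direction [j]; symmetry is not built in. *)
Definition C2jet g (g1 : 'I_N -> V -> R) (g2 : 'I_N -> 'I_N -> V -> R) :=
  C1jet g g1 /\ forall i, C1jet (g1 i) (g2 i).

Lemma C1jet_cont g (g1 : 'I_N -> V -> R) (x : V) : C1jet g g1 -> enorm x < r -> {for x, continuous g}.
Proof. by move=> gg1 /gg1[/hasgrad_cont]. Qed.

Lemma is_derive_ray g (g1 : 'I_N -> V -> R) (z : V) (s : R) : C1jet g g1 -> enorm z = 1 -> `|s| < r ->
  is_derive s 1 (fun u => g (u *: z)) (\sum_i z 0 i * g1 i (s *: z)).
Proof.
move=> gg1 z1 sr.
have zr : enorm (s *: z) < r by rewrite enormZ z1 mulr1.
have [hg _] := gg1 _ zr.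
apply: (hasgrad_curve hg) => i.
rewrite (_ : (fun u => _) = (fun u : R => u * z 0 i)); last by apply/funext => u; rewrite mxE.
by apply: is_derive_eq; rewrite /GRing.scale /=; ring.
Qed.

(** Differentiation under the integral: with [q] strictly between [|s|] and [r], compactness of the
    closed ball of radius [q] supplies a constant dominating function. The weight [a] allows a
    second differentiation, where the coordinates of [z] appear as factors. *)
Lemma is_derive_mean (a g : V -> R) (g1 : 'I_N -> V -> R) (s : R) : sphere_continuous a -> C1jet g g1 -> `|s| < r ->
  is_derive s 1 (fun u => mean (fun z => a z * g (u *: z)))
    (mean (fun z => a z * \sum_i z 0 i * g1 i (s *: z))).
Proof.
move=> ca gg1 sr; pose q := (`|s| + r) / 2.
have qr : q < r by rewrite /q; lra.
have sq : `|s| < q by rewrite /q; lra.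
have [Ma Ma0 aM] := sphere_bounded ca.
have cG x : enorm x <= q -> {for x, continuous (fun y => \sum_i `|g1 i y|)}.
  move=> xq; apply: continuous_at_sum => i; apply: continuous_comp; last exact: norm_continuous.
  by have [_] := gg1 _ (le_lt_trans xq qr); exact.
have [Mg Mg0 gM] := continuous_compact_bounded (@compact_ball q) cG.
pose f (u : R) t := a (Z t) * g (u *: Z t).
have df (u : R) t : `|u| < r ->
    is_derive u 1 (fun u => f u t) (a (Z t) * \sum_i Z t 0 i * g1 i (u *: Z t)).
  move=> ur; have := is_derive_ray gg1 (Z1 t) ur.
  by move=> d1; apply: is_derive_eq; rewrite /GRing.scale /= ?mulr0 ?addr0 ?add0r.
have Iq u : `]-q, q[%classic u -> `|u| < r.
  by rewrite /= in_itv /= -ltr_norml => /lt_trans; apply.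
have := @cvg_differentiation_under_integral R d T P f setT measurableT s (-q) q.
have Is : `]-q, q[%classic s by rewrite /= in_itv /= -ltr_norml.
move=> /(_ Is) H.
have : h^-1 *: (\int[P]_y f (h + s) y - \int[P]_y f s y) @[h --> 0^'] -->
    \int[P]_y partial1of2 f s y.
  apply: (H _ _ (fun=> Ma * Mg)).
  - move=> u /Iq ur; apply: (@integrable_sphere (fun x => a x * g (u *: x))).
    apply: sphere_continuousM => //; apply: (sphere_continuous_scale ur).
    by move=> x; exact: (C1jet_cont gg1).
  - by move=> u t /Iq ur _; have [] := df u t ur.
  - by move=> t; exact: mulr_ge0.
  - by apply: (@integrable_bounded _ (Ma * Mg)) => // t; rewrite ger0_norm// mulr_ge0.
  - move=> u t uq _; rewrite partial1of2E; have [_ ->] := df u t (Iq u uq).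
    rewrite normrM ler_pM//; first exact: aM.
    have uZ : enorm (u *: Z t) <= q.
      rewrite enormZ Z1 mulr1; apply: ltW.
      by move: uq; rewrite /= in_itv /= -ltr_norml.
    apply: le_trans (gM _ uZ); rewrite [leRHS]ger0_norm ?sumr_ge0//.
    apply: (le_trans (ler_norm_sum _ _ _)); apply: ler_sum => i _.
    rewrite normrM -[leRHS]mul1r ler_pM// -(Z1 t); exact: coord_le_enorm.
have -> : \int[P]_y partial1of2 f s y = mean (fun z => a z * \sum_i z 0 i * g1 i (s *: z)).
  apply: eq_Rintegral => t _; rewrite partial1of2E.
  by have [_ ->] := df s t sr.
move=> cv; apply: DeriveDef.
  apply/cvg_ex; eexists; under eq_fun do rewrite /GRing.scale /= mulr1.
  exact: cv.
rewrite /derive; apply/cvg_lim => //.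
by under eq_fun do rewrite /GRing.scale /= mulr1; exact: cv.
Qed.

Hypothesis divZ : forall (F : 'I_N -> V -> R) (F' : 'I_N -> 'I_N -> V -> R),
  (forall x, enorm x = 1 -> forall i,
    hasgrad (F i) (F' i ^~ x) x /\ forall j, {for x, continuous (F' i j)}) ->
  (forall x, enorm x = 1 -> \sum_i x 0 i * F i x = 0) ->
  mean (tan_div F') = 0.

Variables (v : V -> R) (v1 : 'I_N -> V -> R) (v2 : 'I_N -> 'I_N -> V -> R).
Hypothesis vJ : C2jet v v1 v2.

(** On unit vectors [z], [rad] and [rad2] are the first and second derivatives of [s -> v (s z)],
    and [lapl] is the Laplacian of [v] at [s z]. *)
Let rad (s : R) (z : V) := \sum_i z 0 i * v1 i (s *: z).
Let rad2 (s : R) (z : V) := \sum_i z 0 i * \sum_j z 0 j * v2 i j (s *: z).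
Let lapl (s : R) (z : V) := \sum_i v2 i i (s *: z).

Let crad s : `|s| < r -> sphere_continuous (rad s).
Proof.
move=> sr; apply: sphere_continuous_sum => i; apply: sphere_continuousM.
  exact: sphere_continuous_coord.
by apply: (sphere_continuous_scale sr) => x xr; have [_] := vJ.1 x xr; exact.
Qed.

Let cv2 s i j : `|s| < r -> sphere_continuous (fun z => v2 i j (s *: z)).
Proof.
by move=> sr; apply: (sphere_continuous_scale sr) => x xr; have [_] := vJ.2 i x xr; exact.
Qed.

Let crad2 s : `|s| < r -> sphere_continuous (rad2 s).
Proof.
move=> sr; apply: sphere_continuous_sum => i; apply: sphere_continuousM.
  exact: sphere_continuous_coord.
apply: sphere_continuous_sum => j; apply: sphere_continuousM; last exact: cv2.
exact: sphere_continuous_coord.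
Qed.

Let clapl s : `|s| < r -> sphere_continuous (lapl s).
Proof. by move=> sr; apply: sphere_continuous_sum => i; exact: cv2. Qed.

Lemma is_derive_mean_radial (s : R) : `|s| < r ->
  is_derive s 1 (fun u => mean (fun z => v (u *: z))) (mean (rad s)).
Proof.
move=> sr; have := is_derive_mean (@sphere_continuous_cst 1) vJ.1 sr.
rewrite (_ : (fun u => _) = (fun u => mean (fun z => v (u *: z)))); last first.
  by apply/funext => u; apply: eq_mean => x _; rewrite mul1r.
by rewrite (_ : mean _ = mean (rad s))//; apply: eq_mean => x _; rewrite mul1r.
Qed.

Lemma is_derive_mean_radial2 (s : R) : `|s| < r ->
  is_derive s 1 (fun u => mean (rad u)) (mean (rad2 s)).
Proof.
move=> sr.
pose F i (u : R) := mean (fun z => z 0 i * v1 i (u *: z)).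
pose F' i := mean (fun z => z 0 i * \sum_j z 0 j * v2 i j (s *: z)).
have dF i : is_derive s 1 (F i) (F' i).
  exact: (is_derive_mean (@sphere_continuous_coord i) (vJ.2 i) sr).
have dS := @is_derive_sum R R R N F s 1 F' dF.
have -> : mean (rad2 s) = \sum_i F' i.
  rewrite /rad2 mean_sum// => i; apply: sphere_continuousM.
    exact: sphere_continuous_coord.
  apply: sphere_continuous_sum => j; apply: sphere_continuousM; last exact: cv2.
  exact: sphere_continuous_coord.
apply: near_eq_is_derive dS; near=> u.
rewrite fct_sumE /rad mean_sum// => i; apply: sphere_continuousM.
  exact: sphere_continuous_coord.
have ur : `|u| < r.
  near: u; apply: (@cvgr_lt _ _ _ _ (fun u : R => `|u|)) sr.
  exact: norm_continuous.
by apply: (sphere_continuous_scale ur) => x xr; have [_] := vJ.1 x xr; exact.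
Unshelve. all: by end_near. Qed.

(** The tangential part of the gradient, [z -> (grad v) (s z) - rad s z * z], has tangential
    divergence [s lapl - (N - 1) rad - s rad2], and this has mean zero. It is the Laplacian in polar
    coordinates with the spherical part averaged out. *)
Lemma mean_laplacian (s : R) : `|s| < r ->
  s * mean (lapl s) = N.-1%:R * mean (rad s) + s * mean (rad2 s).
Proof.
move=> sr.
pose F i (x : V) := v1 i (s *: x) - x 0 i * rad s x.
pose rad' j (x : V) := v1 j (s *: x) + \sum_k x 0 k * (s * v2 k j (s *: x)).
pose F' (i j : 'I_N) (x : V) := s * v2 i j (s *: x) - ((j == i)%:R * rad s x + x 0 i * rad' j x).
have xs (x : V) : enorm x = 1 -> enorm (s *: x) < r by move=> x1; rewrite enormZ x1 mulr1.
have dv1 (x : V) i : enorm x = 1 ->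
    hasgrad (fun y => v1 i (s *: y)) (fun j => s * v2 i j (s *: x)) x.
  move=> x1; have [h1 _] := vJ.2 i _ (xs x x1).
  have hs : is_diff x (fun y : V => s *: y) (fun y => s *: y) by exact: is_diff_scaler.
  rewrite /hasgrad in h1 *.
  apply: (@is_diff_eq _ _ _ (v1 i \o ( *:%R s)) (dotg (v2 i ^~ (s *: x)) \o ( *:%R s))).
  by apply/funext => y; rewrite /= /dotg; apply: eq_bigr => j _; rewrite mxE; ring.
have sum1 (x : V) : enorm x = 1 -> \sum_i x 0 i * x 0 i = 1.
  by move=> x1; rewrite -(expr1n _ 2) -x1 sqr_enorm; apply: eq_bigr => i _; rewrite expr2.
have drad (x : V) : enorm x = 1 -> hasgrad (rad s) (fun j => rad' j x) x.
  move=> x1; have := hasgrad_sum (index_enum 'I_N)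
    (fun k => hasgradM (hasgrad_coord k x) (dv1 x k x1)).
  move=> /hasgrad_eq; apply => j; rewrite big_split /= addrC; congr (_ + _).
  rewrite (bigD1 j)//= eqxx mulr1 big1 ?addr0// => k kj.
  by rewrite eq_sym (negbTE kj) mulr0.
have div0 : mean (tan_div F') = 0.
  apply: (@divZ F) => [x x1 i|x x1].
    split.
      have dN := hasgradZ (-1) (hasgradM (hasgrad_coord i x) (drad x x1)).
      have := hasgradD (dv1 x i x1) dN.
      rewrite (_ : (fun y => _) = F i); last by apply/funext => y; rewrite /F; ring.
      by move=> /hasgrad_eq; apply => j; rewrite /F'; ring.
    move=> j; have cc : sphere_continuous (F' i j).
      apply: sphere_continuousD.
        apply: sphere_continuousM; [exact: sphere_continuous_cst|exact: cv2].
      have cr' : sphere_continuous (rad' j).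
        apply: sphere_continuousD.
          by apply: (sphere_continuous_scale sr) => y yr; have [_] := vJ.1 y yr; exact.
        apply: sphere_continuous_sum => k; apply: sphere_continuousM.
          exact: sphere_continuous_coord.
        by apply: sphere_continuousM; [exact: sphere_continuous_cst|exact: cv2].
      move=> y y1; apply: continuousN; move: y y1; apply: sphere_continuousD.
        by apply: sphere_continuousM; [exact: sphere_continuous_cst|exact: crad].
      by apply: sphere_continuousM => //; exact: sphere_continuous_coord.
    exact: cc.
  under eq_bigr do rewrite mulrBr mulrA.
  by rewrite sumrB -mulr_suml sum1// mul1r subrr.
have E (x : V) : enorm x = 1 ->
    tan_div F' x = s * lapl s x + ((- N.-1%:R) * rad s x + (- s) * rad2 s x).
  move=> x1; rewrite /tan_div.
  have rad'E : \sum_i x 0 i * rad' i x = rad s x + s * rad2 s x.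
    under eq_bigr do rewrite mulrDr; rewrite big_split /=; congr (_ + _).
    under eq_bigr do rewrite mulr_sumr.
    rewrite exchange_big /= /rad2 mulr_sumr; apply: eq_bigr => k _.
    by rewrite !mulr_sumr; apply: eq_bigr => j _; ring.
  have -> : \sum_i F' i i x = s * lapl s x - N%:R * rad s x - (rad s x + s * rad2 s x).
    rewrite -rad'E /lapl mulr_sumr -[N%:R]/(N%:R) -addrA -opprD.
    have -> : N%:R * rad s x = \sum_(i < N) rad s x.
      by rewrite sumr_const card_ord mulr_natl.
    by rewrite -big_split -sumrB /=; apply: eq_bigr => i _; rewrite /F' eqxx mul1r.
  have -> : \sum_i \sum_j x 0 i * x 0 j * F' i j x =
      s * rad2 s x - (rad s x + (rad s x + s * rad2 s x)).
    transitivity (\sum_i (s * (x 0 i * \sum_j x 0 j * v2 i j (s *: x)) -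
        (x 0 i * x 0 i * rad s x + x 0 i * x 0 i * \sum_j x 0 j * rad' j x))).
      apply: eq_bigr => i _.
      have -> : x 0 i * x 0 i * rad s x = \sum_j x 0 i * x 0 j * ((j == i)%:R * rad s x).
        rewrite (bigD1 i)//= eqxx mul1r big1 ?addr0// => j ji.
        by rewrite (negbTE ji) mul0r mulr0.
      rewrite mulrCA !mulr_sumr -big_split -sumrB /=; apply: eq_bigr => j _.
      by rewrite /F'; ring.
    rewrite sumrB big_split /= -!mulr_suml sum1// !mul1r rad'E; congr (_ - _).
    by rewrite /rad2 mulr_sumr.
  have -> : N.-1%:R = N%:R - 1 :> R.
    by rewrite -[in RHS](prednK (_ : (0 < N)%N)) ?addn_gt0 ?n0// -natr1 addrK.
  by ring.
have := div0; rewrite (eq_mean E).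
have c1 : sphere_continuous (fun x => - N.-1%:R * rad s x).
  by apply: sphere_continuousM; [exact: sphere_continuous_cst|exact: crad].
have c2 : sphere_continuous (fun x => - s * rad2 s x).
  by apply: sphere_continuousM; [exact: sphere_continuous_cst|exact: crad2].
have c3 : sphere_continuous (fun x => s * lapl s x).
  by apply: sphere_continuousM; [exact: sphere_continuous_cst|exact: clapl].
rewrite meanD//; last exact: sphere_continuousD.
rewrite meanD// !meanZ//; [|exact: crad2|exact: crad|exact: clapl].
lra.
Qed.

(** The divergence theorem on balls in differential form: [mean_laplacian] times [s ^ (N - 2)],
    which makes sense because [N = 2n >= 2]. *)
Lemma is_derive_mean_flux (s : R) : 0 < s < r ->
  is_derive s 1 (fun u => u ^+ N.-1 * mean (rad u)) (s ^+ N.-1 * mean (lapl s)).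
Proof.
move=> /andP[s0 sr]; have sr' : `|s| < r by rewrite gtr0_norm.
have d1 := is_derive_mean_radial2 sr'.
have d2 : is_derive s 1 (fun u : R => u ^+ N.-1) (N.-1%:R * s ^+ N.-1.-1).
  apply: DeriveDef; first exact: exprn_derivable.
  by rewrite exp_derive /GRing.scale /= mulr1.
apply: (is_derive_eq (is_deriveM d2 d1)).
have L := mean_laplacian sr'.
have [k Nk] : exists k, N.-1 = k.+1.
  by case: (n) n0 => // m _; exists (m + m)%N; rewrite addSn addnS.
rewrite /GRing.scale /= Nk /= exprS.
have -> : s * s ^+ k * mean (lapl s) = s ^+ k * (s * mean (lapl s)) by ring.
by rewrite L Nk; ring.
Qed.

End jets.

End sphere_means.

(** * Calculus on the line *)

Section real_line.
Variable R : realType.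
Implicit Types (f g : R -> R) (a b s : R).

Lemma is_derive_continuous f (s l : R) : is_derive s 1 f l -> {for s, continuous f}.
Proof. by move=> [df _]; apply/differentiable_continuous/derivable1_diffP. Qed.

Lemma derive_ge0_le f (f' : R -> R) a b : a <= b ->
  (forall s, a < s < b -> is_derive s 1 f (f' s)) ->
  (forall s, a < s < b -> 0 <= f' s) ->
  (forall s, a <= s <= b -> {for s, continuous f}) -> f a <= f b.
Proof.
move=> ab df f'0 cf.
have cf' : {within `[a, b], continuous f}.
  by apply: continuous_in_subspaceT => s; rewrite inE /= in_itv /= => /cf.
have [ab'|] := ltP a b; last first.
  by move=> ba; rewrite (@le_anti _ _ a b)// ab ba.
have df' s : s \in `]a, b[ -> is_derive s 1 f (f' s) by rewrite in_itv; exact: df.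
have [c' c'ab fE'] := MVT ab' df' cf'.
rewrite -subr_ge0 fE' mulr_ge0 ?subr_ge0//.
by apply: f'0; move: c'ab; rewrite in_itv.
Qed.

(** The interval is symmetric, and the integral starts at [- c], so that the primitive has a
    two-sided derivative at 0, where the comparison arguments begin. *)
Lemma primitive_exists f c : 0 < c -> (forall s, `|s| <= c -> {for s, continuous f}) ->
  exists2 F : R -> R, F 0 = 0 & forall s, `|s| < c -> is_derive s 1 F (f s).
Proof.
move=> c0 cf.
pose G (s : R) := \int[@lebesgue_measure R]_(t in `[- c, s]) f t.
exists (fun s => G s - G 0); first by rewrite subrr.
move=> s sc; have /andP[sl sr] : - c < s < c by rewrite -ltr_norml.
have intf : lebesgue_measure.-integrable `[- c, c] (EFin \o f).
  apply: continuous_compact_integrable; first exact: segment_compact.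
  by apply: continuous_in_subspaceT => u; rewrite inE /= in_itv /= -ler_norml => /cf.
have cfs := cf s (ltW sc).
have [dG vG] := @continuous_FTC1 R f (BLeft (- c)) s c sr intf sl cfs.
have dG' : is_derive s 1 G (f s).
  by apply: DeriveDef; [exact: dG|rewrite -vG derive1E].
by apply: is_derive_eq; rewrite subr0.
Qed.

(** * Radial differential inequalities for a spherical mean [m], with [k.+2] as the real
    dimension *)

Section flux.
Variables (k : nat) (r rho : R) (m m1 L : R -> R).
Hypotheses (r0 : 0 < r) (rrho : r < rho).
Hypothesis dm : forall s, `|s| < rho -> is_derive s 1 m (m1 s).
Hypothesis cm1 : forall s, `|s| < rho -> {for s, continuous m1}.
Hypothesis dflux : forall s, 0 < s < rho ->
  is_derive s 1 (fun u : R => u ^+ k.+1 * m1 u) (s ^+ k.+1 * L s).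

Let cflux s : `|s| < rho -> {for s, continuous (fun u : R => u ^+ k.+1 * m1 u)}.
Proof.
by move=> sr; apply: continuousM; [exact: exprn_continuous|exact: cm1].
Qed.

Let norm_lt s : 0 <= s <= r -> `|s| < rho.
Proof. by move=> /andP[s0 sr]; rewrite ger0_norm// (le_lt_trans sr). Qed.

Let cm s : 0 <= s <= r -> {for s, continuous m}.
Proof. by move=> /norm_lt /dm/is_derive_continuous. Qed.

(** The flux [u ^ k.+1 * m1 u] is 0 at the origin and has nonnegative derivative, so [m1 >= 0]. *)
Lemma flux_ge0_nondecreasing : (forall s, 0 < s < r -> 0 <= L s) ->
  forall s t, 0 <= s -> s <= t -> t <= r -> m s <= m t.
Proof.
move=> L0.
have m10 s : 0 < s < r -> 0 <= m1 s.
  move=> /andP[s0 sr]; rewrite -(pmulr_rge0 _ (exprn_gt0 k.+1 s0)).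
  have -> : 0 = 0 ^+ k.+1 * m1 0 by rewrite expr0n mul0r.
  apply: (@derive_ge0_le (fun u : R => u ^+ k.+1 * m1 u) (fun u : R => u ^+ k.+1 * L u)); first exact: ltW.
  - by move=> u /andP[u0 us]; apply: dflux; rewrite u0 (lt_trans us)// (lt_trans sr).
  - by move=> u /andP[u0 us]; rewrite mulr_ge0 ?exprn_ge0 ?(ltW u0)// L0// u0 (lt_trans us).
  - by move=> u /andP[u0 us]; apply/cflux/norm_lt; rewrite u0 (le_trans us)// ltW.
move=> s t s0 st tr; apply: (@derive_ge0_le m m1) => //.
- by move=> u /andP[u0 us]; apply/dm/norm_lt; rewrite (le_trans s0 (ltW u0)) (le_trans (ltW us)).
- by move=> u /andP[u0 us]; rewrite m10// (le_lt_trans s0) ?(lt_le_trans us).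
- by move=> u /andP[u0 us]; apply: cm; rewrite (le_trans s0) ?(le_trans us).
Qed.

(* With [J' = Om ^ 2], [W' = Om], the function [om1 W - (1 - s) J] dominates a
   primitive of [J] because [(1 - s) Om <= om1]; this avoids exchanging the
   order of integration in the double primitive of [Om ^ 2]. *)
Lemma flux_comparison (Om J W : R -> R) (om1 al be : R) :
  0 <= al -> 0 <= be -> r < 1 ->
  (forall s, 0 <= s <= r -> 0 <= Om s /\ (1 - s) * Om s <= om1) ->
  J 0 = 0 -> (forall s, 0 <= s <= r -> is_derive s 1 J (Om s ^+ 2)) ->
  W 0 = 0 -> (forall s, 0 <= s <= r -> is_derive s 1 W (Om s)) ->
  (forall s, 0 < s < r -> L s <= al * Om s ^+ 2 + be) ->
  m r <= m 0 + al * om1 * W r + be * r ^+ 2 / (2 * k.+2%:R).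
Proof.
move=> al0 be0 r1 hOm J0 dJ W0 dW hL.
have J_ge0 s : 0 <= s <= r -> 0 <= J s.
  move=> /andP[s0 sr]; rewrite -J0; apply: (@derive_ge0_le J (fun u => Om u ^+ 2)) => //.
  - by move=> u /andP[u0 us]; apply: dJ; rewrite (ltW u0) (le_trans (ltW us)).
  - by move=> u _; exact: sqr_ge0.
  - by move=> u /andP[u0 us]; apply/is_derive_continuous/dJ; rewrite u0 (le_trans us).
have k0 : 0 < k.+2%:R :> R by rewrite ltr0n.
(* Bounds [s ^ -(k+1)] times the integral of [t ^ (k+1) (al Om^2 + be)] over [[0, s]]: the [be] term
   is integrated exactly, which gives the factor [1/(k+2)], and [t <= s] is used in the other term
   only. *)
pose B s := al * J s + be / k.+2%:R * s.
have dB s : 0 <= s <= r -> is_derive s 1 B (al * Om s ^+ 2 + be / k.+2%:R).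
  move=> sr; have d1 := dJ s sr; apply: is_derive_eq.
  by rewrite /GRing.scale /= !(mulr0, mul0r, add0r, addr0, mulr1).
have m1B s : 0 < s < r -> m1 s <= B s.
  move=> /andP[s0 sr].
  have dk (u : R) : is_derive u 1 (fun u : R => u ^+ k.+1) (k.+1%:R * u ^+ k).
    apply: DeriveDef; first exact: exprn_derivable.
    by rewrite exp_derive /GRing.scale /= mulr1.
  pose psi (u : R) := u ^+ k.+1 * B u - u ^+ k.+1 * m1 u.
  have : psi 0 <= psi s.
    apply: (@derive_ge0_le psi (fun u : R => (u ^+ k.+1 * (al * Om u ^+ 2 + be / k.+2%:R) +
      B u * (k.+1%:R * u ^+ k)) - u ^+ k.+1 * L u)); first exact: ltW.
    - move=> u /andP[u0 us].
      have ur : 0 <= u <= r by rewrite (ltW u0) ltW// (lt_trans us).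
      have d1 := is_deriveM (dk u) (dB u ur).
      have uro : 0 < u < rho by rewrite u0 (lt_trans us)// (lt_trans sr).
      apply: (is_derive_eq (is_deriveB d1 (dflux uro))).
      by rewrite /GRing.scale /=.
    - move=> u /andP[u0 us].
      have ur : 0 <= u <= r by rewrite (ltW u0) ltW// (lt_trans us).
      have Lu : L u <= al * Om u ^+ 2 + be by apply: hL; rewrite u0 (lt_trans us).
      have uk : 0 < u ^+ k by rewrite exprn_gt0.
      rewrite subr_ge0; apply: (@le_trans _ _ (u ^+ k.+1 * (al * Om u ^+ 2 + be))).
        by rewrite ler_wpM2l// exprn_ge0// ltW.
      rewrite /B exprS -subr_ge0.
      have -> : u * u ^+ k * (al * Om u ^+ 2 + be / k.+2%:R) +
          (al * J u + be / k.+2%:R * u) * (k.+1%:R * u ^+ k) -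
          u * u ^+ k * (al * Om u ^+ 2 + be) = al * J u * (k.+1%:R * u ^+ k).
        have -> : k.+1%:R = k.+2%:R - 1 :> R by rewrite -[in RHS]natr1 addrK.
        by move: (k.+2%:R) k0 => K K0; field; rewrite gt_eqF.
      by rewrite !mulr_ge0// ?J_ge0// ltW.
    - move=> u /andP[u0 us].
      have ur : 0 <= u <= r by rewrite u0 (le_trans us)// ltW.
      have c1 := is_derive_continuous (is_deriveM (dk u) (dB u ur)).
      exact: (continuousB c1 (cflux (norm_lt ur))).
  rewrite /psi expr0n !mul0r subrr subr_ge0.
  by rewrite ler_pM2l// exprn_gt0.
pose chi s := om1 * W s - (1 - s) * J s.
pose F s := al * chi s + be * s ^+ 2 / (2 * k.+2%:R) - m s.
pose F' s := al * (om1 * Om s - ((1 - s) * Om s ^+ 2 - J s)) + be / k.+2%:R * s - m1 s.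
have dF s : 0 <= s <= r -> is_derive s 1 F (F' s).
  move=> sr; have d1 := dJ s sr; have d2 := dW s sr; have d3 := dm (norm_lt sr).
  have d4 : is_derive s 1 (fun u => (1 - u) * J u) ((1 - s) * Om s ^+ 2 - J s).
    by apply: is_derive_eq; rewrite /GRing.scale /=; ring.
  have d5 : is_derive s 1 chi (om1 * Om s - ((1 - s) * Om s ^+ 2 - J s)).
    by apply: is_derive_eq; rewrite /GRing.scale /=; ring.
  have d6 : is_derive s 1 (fun u : R => u ^+ 2) (2 * s).
    apply: DeriveDef; first exact: exprn_derivable.
    by rewrite exp_derive /GRing.scale /= mulr1 expr1.
  have d7 : is_derive s 1 (fun u : R => be * u ^+ 2 / (2 * k.+2%:R)) (be / k.+2%:R * s).
    move: (k.+2%:R) k0 => K K0.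
    by apply: is_derive_eq; rewrite /GRing.scale /=; field; rewrite gt_eqF.
  have d8 : is_derive s 1 (fun u => al * chi u) (al * (om1 * Om s - ((1 - s) * Om s ^+ 2 - J s))).
    by apply: is_derive_eq; rewrite /GRing.scale /=; ring.
  exact: (is_deriveB (is_deriveD d8 d7) d3).
have : F 0 <= F r.
  apply: (@derive_ge0_le F F'); first exact: ltW.
  - by move=> s /andP[s0 sr]; apply: dF; rewrite !ltW.
  - move=> s /andP[s0 sr]; have sr' : 0 <= s <= r by rewrite !ltW.
    have [Om0 Om1] := hOm s sr'.
    have m1s : m1 s <= B s by apply: m1B; rewrite s0 sr.
    rewrite /F'.
    (* Since [(1 - s) Om ^ 2 <= om1 Om], what remains of [F'] is at least [B s - m1 s]. *)
    apply: (@le_trans _ _ (al * (om1 * Om s - ((1 - s) * Om s ^+ 2)))).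
      by rewrite mulr_ge0// expr2 mulrA subr_ge0 ler_wpM2r.
    move: m1s; rewrite /B; move: (be / k.+2%:R) (m1 s) (J s) (Om s) => c m1' j o; lra.
  - by move=> s sr; exact: is_derive_continuous (dF s sr).
have Jr : 0 <= (1 - r) * J r.
  by rewrite mulr_ge0 ?subr_ge0 ?(ltW r1)// J_ge0// lexx ltW.
have aJ : 0 <= al * ((1 - r) * J r) by rewrite mulr_ge0.
have -> : F 0 = - m 0.
  by rewrite /F /chi W0 J0 expr2 !(mulr0, mul0r, subrr, oppr0, addr0, add0r).
have -> : F r = al * om1 * W r - al * ((1 - r) * J r) +
    be * r ^+ 2 / (2 * k.+2%:R) - m r by rewrite /F /chi mulrBr mulrA.
move: (be * r ^+ 2 / _) (al * ((1 - r) * J r)) aJ => X Y Y0; lra.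
Qed.

End flux.

End real_line.

(** * Hoelder's inequality on a probability space *)

Section interpolation.
Variables (R : realType) (d : measure_display) (T : measurableType d).
Variable P : {measure set T -> \bar R}.
Hypothesis P1 : P setT = 1%E.

Lemma powR_AMGM (x y th : R) : 0 <= x -> 0 <= y -> 0 <= th <= 1 ->
  x `^ (1 - th) * y `^ th <= (1 - th) * x + th * y.
Proof.
move=> x0 y0 /andP[t0 t1].
(* At the endpoints one of the conjugate exponents would be infinite, so they are treated apart from
   Young's inequality. *)
have [->|tn0] := eqVneq th 0; first by rewrite subr0 powRr1// powRr0 mulr1 mul1r mul0r addr0.
have [->|tn1] := eqVneq th 1; first by rewrite subrr powRr0 powRr1// !mul1r mul0r add0r.
have tp : 0 < th by rewrite lt_neqAle eq_sym tn0.
have tq : 0 < 1 - th by rewrite subr_gt0 lt_neqAle tn1.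
have ip : 0 < (1 - th)^-1 by rewrite invr_gt0.
have iq : 0 < th^-1 by rewrite invr_gt0.
have e1 : (1 - th)^-1^-1 + th^-1^-1 = 1 by rewrite !invrK subrK.
have := conjugate_powR (powR_ge0 x (1 - th)) (powR_ge0 y th) ip iq e1.
rewrite -!powRrM !mulfV ?gt_eqF// !powRr1// !invrK => /le_trans; apply.
by rewrite (mulrC x) (mulrC y).
Qed.

(** The weighted arithmetic-geometric inequality is applied to [a / al] and [b / be] and integrated.
    Working with positive upper bounds instead of the integrals themselves avoids division by
    zero. *)
Lemma integral_powR_interpolation (a b : T -> R) (M al be th : R) :
  measurable_fun setT a -> measurable_fun setT b ->
  (forall t, 0 <= a t <= M) -> (forall t, 0 <= b t <= M) ->
  0 < al -> 0 < be -> 0 <= th <= 1 ->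
  \int[P]_t a t <= al -> \int[P]_t b t <= be ->
  \int[P]_t (a t `^ (1 - th) * b t `^ th) <= al `^ (1 - th) * be `^ th.
Proof.
move=> ma mb aM bM al0 be0 /[dup] th01 /andP[t0 t1] ale ble.
pose C := al `^ (1 - th) * be `^ th.
have C0 : 0 < C by rewrite mulr_gt0 ?powR_gt0.
have pw t : a t `^ (1 - th) * b t `^ th <= C * ((1 - th) / al * a t + th / be * b t).
  have /andP[a0 _] := aM t; have /andP[b0 _] := bM t.
  have -> : a t `^ (1 - th) * b t `^ th = C * ((a t / al) `^ (1 - th) * (b t / be) `^ th).
    rewrite /C mulrACA -!powRM ?divr_ge0 ?(ltW al0) ?(ltW be0)//.
    by rewrite (mulrC al) divfK ?gt_eqF// (mulrC be) divfK ?gt_eqF.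
  have a0' : 0 <= a t / al by rewrite divr_ge0// ltW.
  have b0' : 0 <= b t / be by rewrite divr_ge0// ltW.
  rewrite ler_pM2l//; apply: le_trans (powR_AMGM a0' b0' th01) _.
  by rewrite le_eqVlt; apply/orP; left; apply/eqP; ring.
have intb (f : T -> R) (K : R) : measurable_fun setT f -> (forall t, `|f t| <= K) ->
    P.-integrable setT (EFin \o f).
  move=> mf fK; apply: measurable_bounded_integrable => //; first by rewrite P1 ltry.
  by exists K; split => [|m Mm t _]; [exact: num_real|exact: le_trans (fK t) (ltW Mm)].
have ia : P.-integrable setT (EFin \o a).
  by apply: (intb _ M) => // t; have /andP[a0 a1] := aM t; rewrite ger0_norm.
have ib : P.-integrable setT (EFin \o b).
  by apply: (intb _ M) => // t; have /andP[a0 a1] := bM t; rewrite ger0_norm.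
have ia' : P.-integrable setT (EFin \o (fun t => (1 - th) / al * a t)).
  by apply: (@integrableZl _ _ _ _ _ measurableT _ (EFin \o a)).
have ib' : P.-integrable setT (EFin \o (fun t => th / be * b t)).
  by apply: (@integrableZl _ _ _ _ _ measurableT _ (EFin \o b)).
have iab : P.-integrable setT (EFin \o (fun t => (1 - th) / al * a t + th / be * b t)).
  by apply: (@integrableD _ _ _ _ _ measurableT _ _ ia' ib').
have iC : P.-integrable setT (EFin \o (fun t => C * ((1 - th) / al * a t + th / be * b t))).
  by apply: (@integrableZl _ _ _ _ _ measurableT _ (EFin \o (fun t => (1 - th) / al * a t + th / be * b t))).
have iL : P.-integrable setT (EFin \o (fun t => a t `^ (1 - th) * b t `^ th)).
  apply: (le_integrable measurableT _ _ iC).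
    apply/measurable_EFinP; apply: measurable_funM.
      exact: (measurableT_comp (measurable_powR _) ma).
    exact: (measurableT_comp (measurable_powR _) mb).
  move=> t _ /=; rewrite lee_fin ger0_norm ?mulr_ge0 ?powR_ge0//.
  exact: le_trans (pw t) (ler_norm _).
apply: (le_trans (le_Rintegral measurableT iL iC (fun t _ => pw t))).
rewrite RintegralZl// RintegralD// !RintegralZl// -[leRHS]mulr1 ler_pM2l//.
apply: (@le_trans _ _ ((1 - th) / al * al + th / be * be)); last first.
  by rewrite !divfK ?gt_eqF// subrK.
apply: lerD; apply: ler_wpM2l => //; apply: divr_ge0; rewrite ?subr_ge0// ltW//.
Qed.

End interpolation.

(** Lagrange's identity: twice the difference of the two sides is a sum of squares. *)
Lemma sum_cauchy_schwarz (R : realType) (I : finType) (a b : I -> R) :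
  (\sum_i a i * b i) ^+ 2 <= (\sum_i a i ^+ 2) * (\sum_i b i ^+ 2).
Proof.
have H : 0 <= \sum_i \sum_j (a i * b j - a j * b i) ^+ 2.
  by apply: sumr_ge0 => i _; apply: sumr_ge0 => j _; exact: sqr_ge0.
have E : \sum_i \sum_j (a i * b j - a j * b i) ^+ 2 =
    2 * ((\sum_i a i ^+ 2) * (\sum_i b i ^+ 2)) - 2 * (\sum_i a i * b i) ^+ 2.
  transitivity (\sum_i \sum_j (a i ^+ 2 * b j ^+ 2 + b i ^+ 2 * a j ^+ 2
      - 2 * ((a i * b i) * (a j * b j)))).
    by apply: eq_bigr => i _; apply: eq_bigr => j _; ring.
  under eq_bigr do rewrite sumrB big_split /= -!mulr_sumr.
  rewrite sumrB big_split /= -!mulr_suml -mulr_sumr -mulr_suml expr2; ring.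
move: H; rewrite E; lra.
Qed.

(** * The power [w ^ q] of [w = eps + |u|^2] and its derivatives *)

Section power_of_squares.
Variables (R : realType) (n : nat).
Local Notation N := (n + n)%N.
Local Notation V := 'rV[R]_N.
Variables (J : finType) (r eps q : R).
Hypothesis eps0 : 0 < eps.
Variables (u : J -> V -> R) (u1 : J -> 'I_N -> V -> R).
Variable (u2 : J -> 'I_N -> 'I_N -> V -> R).

(** With [eps > 0] every real power of this function is as smooth as the [u j], also at their common
    zeros. *)
Definition sqsum (x : V) := eps + \sum_j u j x ^+ 2.
Definition sqsum1 (i : 'I_N) (x : V) := 2 * \sum_j u j x * u1 j i x.
Definition sqsum2 (i l : 'I_N) (x : V) :=
  2 * \sum_j (u1 j l x * u1 j i x + u j x * u2 j i l x).
Definition gradsq (x : V) := \sum_j \sum_i u1 j i x ^+ 2.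

Definition sqpow (x : V) := sqsum x `^ q.
Definition sqpow1 (i : 'I_N) (x : V) := q * sqsum x `^ (q - 1) * sqsum1 i x.
Definition sqpow2 (i l : 'I_N) (x : V) :=
  q * ((q - 1) * sqsum x `^ (q - 2) * sqsum1 l x) * sqsum1 i x
  + q * sqsum x `^ (q - 1) * sqsum2 i l x.

Lemma sqsum_gt0 x : 0 < sqsum x.
Proof. by rewrite ltr_wpDr// sumr_ge0// => j _; exact: sqr_ge0. Qed.

Lemma gradsq_ge0 x : 0 <= gradsq x.
Proof. by apply: sumr_ge0 => j _; apply: sumr_ge0 => i _; exact: sqr_ge0. Qed.

Lemma hasgrad_powR (a : R) (g : V -> R) (G : 'I_N -> R) x : 0 < g x -> hasgrad g G x ->
  hasgrad (fun y => g y `^ a) (fun i => a * g x `^ (a - 1) * G i) x.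
Proof. by move=> g0; exact: (hasgrad_comp (is_derive1_powR a g0)). Qed.

Lemma hasgrad_sqsum x : (forall j, hasgrad (u j) (u1 j ^~ x) x) ->
  hasgrad sqsum (sqsum1 ^~ x) x.
Proof.
move=> du.
have := hasgradD (hasgrad_cst eps x)
  (hasgrad_sum (index_enum J) (fun j => hasgradM (du j) (du j))).
rewrite (_ : (fun y => _) = sqsum) => [/hasgrad_eq|]; last first.
  by apply/funext => y; congr (_ + _); apply: eq_bigr => j _; rewrite expr2.
by apply=> i; rewrite add0r /sqsum1 mulr_sumr; apply: eq_bigr => j _; ring.
Qed.

Lemma sqpow_C1jet : (forall j, C1jet r (u j) (u1 j)) -> C1jet r sqpow sqpow1.
Proof.
move=> uJ x xr.
have hw : hasgrad sqsum (sqsum1 ^~ x) x by apply: hasgrad_sqsum => j; have [] := uJ j x xr.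
split; first exact: (hasgrad_powR q (sqsum_gt0 x) hw).
move=> i; have h := hasgrad_powR (q - 1) (sqsum_gt0 x) hw.
have c1 : {for x, continuous (sqsum1 i)}.
  apply: continuousM; first exact: cst_continuous.
  apply: continuous_at_sum => j; have [h1 h2] := uJ j x xr.
  by apply: continuousM; [exact: hasgrad_cont h1|exact: h2].
have c2 : {for x, continuous (fun y => q * sqsum y `^ (q - 1))}.
  by apply: continuousM; [exact: cst_continuous|exact: hasgrad_cont h].
exact: (continuousM c2 c1).
Qed.

Lemma sqpow_C2jet : (forall j, C2jet r (u j) (u1 j) (u2 j)) -> C2jet r sqpow sqpow1 sqpow2.
Proof.
move=> uJ; split; first by apply: sqpow_C1jet => j; have [] := uJ j.
move=> i x xr.
have du j : hasgrad (u j) (u1 j ^~ x) x by have [/(_ x xr)[]] := uJ j.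
have du1 j k : hasgrad (u1 j k) (u2 j k ^~ x) x by have [_ /(_ k x xr)[]] := uJ j.
have cu2 j k l : {for x, continuous (u2 j k l)} by have [_ /(_ k x xr)[]] := uJ j.
have hw := hasgrad_sqsum du.
have w0 := sqsum_gt0 x.
have hw1 k : hasgrad (sqsum1 k) (sqsum2 k ^~ x) x.
  have := hasgradZ 2 (hasgrad_sum (index_enum J) (fun j => hasgradM (du j) (du1 j k))).
  move=> /hasgrad_eq; apply => l; congr (_ * _); apply: eq_bigr => j _; ring.
have hp1 := hasgrad_powR (q - 1) w0 hw.
have hp2 := hasgrad_powR (q - 2) w0 hw.
split.
  have := hasgradM (hasgradZ q hp1) (hw1 i).
  move=> /hasgrad_eq; apply => l; rewrite /sqpow2 (_ : q - 1 - 1 = q - 2); last by ring.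
  ring.
move=> l.
have c0 k : {for x, continuous (sqsum1 k)} by exact: hasgrad_cont (hw1 k).
have c2 : {for x, continuous (sqsum2 i l)}.
  apply: continuousM; first exact: cst_continuous.
  apply: continuous_at_sum => j; apply: continuousD; apply: continuousM.
  - exact: hasgrad_cont (du1 j l).
  - exact: hasgrad_cont (du1 j i).
  - exact: hasgrad_cont (du j).
  - exact: cu2.
have c3 : {for x, continuous (fun y => q * sqsum y `^ (q - 1))}.
  by apply: continuousM; [exact: cst_continuous|exact: hasgrad_cont hp1].
have c4 : {for x, continuous (fun y => q * ((q - 1) * sqsum y `^ (q - 2) * sqsum1 l y))}.
  apply: continuousM; first exact: cst_continuous.
  apply: continuousM; last exact: c0.
  by apply: continuousM; [exact: cst_continuous|exact: hasgrad_cont hp2].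
exact: (continuousD (continuousM c4 (c0 i)) (continuousM c3 c2)).
Qed.

Lemma powRB1 (w a : R) : 0 < w -> w `^ (a - 1) * w = w `^ a.
Proof.
move=> w0; rewrite -{2}(powRr1 (ltW w0)) -powRD ?subrK//.
by apply/implyP => _; rewrite gt_eqF.
Qed.

Lemma sum_sqsum1_le x : \sum_i sqsum1 i x ^+ 2 <= 4 * (sqsum x * gradsq x).
Proof.
rewrite /gradsq exchange_big /= mulr_sumr mulr_sumr; apply: ler_sum => i _.
rewrite /sqsum1 exprMn (_ : 2 ^+ 2 = 4) ?ler_pM2l//; last by rewrite expr2; ring.
apply: (le_trans (sum_cauchy_schwarz _ _)).
by rewrite ler_wpM2r ?sumr_ge0// => [j _|]; [exact: sqr_ge0|rewrite lerDr ltW].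
Qed.

(** [Delta (w ^ q) = q (q - 1) w ^ (q - 2) |grad w|^2 + q w ^ (q - 1) Delta w], where
    [Delta w = 2 (|Du|^2 + sum cj u_j^2)]. Every term is nonnegative as [q >= 1] and [cj >= 0]. For
    the upper bound [|grad w|^2 <= 4 w |Du|^2], and the coefficients of [w ^ (q - 1) |Du|^2] add up
    to [4q (q - 1) + 2q = 2q (2q - 1)]. *)
Lemma laplacian_sqpow (c : R) (cj : J -> R) x : 1 <= q -> 0 <= c ->
  (forall j, 0 <= cj j <= c) -> (forall j, \sum_i u2 j i i x = cj j * u j x) ->
  0 <= \sum_i sqpow2 i i x <=
    2 * q * (2 * q - 1) * (sqsum x `^ (q - 1) * gradsq x) + 2 * q * c * sqpow x.
Proof.
move=> q1 c0 hc hu.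
have w0 := sqsum_gt0 x; have G0 := gradsq_ge0 x.
pose S := \sum_j cj j * u j x ^+ 2.
have S0 : 0 <= S.
  by apply: sumr_ge0 => j _; have /andP[? _] := hc j; rewrite mulr_ge0 ?sqr_ge0.
have Sc : S <= c * sqsum x.
  apply: (@le_trans _ _ (c * \sum_j u j x ^+ 2)).
    rewrite mulr_sumr; apply: ler_sum => j _; have /andP[_ ?] := hc j.
    by rewrite ler_wpM2r// sqr_ge0.
  by rewrite ler_wpM2l// lerDr ltW.
pose Q := \sum_i sqsum1 i x ^+ 2.
have Q0 : 0 <= Q by apply: sumr_ge0 => i _; exact: sqr_ge0.
have -> : \sum_i sqpow2 i i x =
    q * (q - 1) * sqsum x `^ (q - 2) * Q + 2 * q * sqsum x `^ (q - 1) * (gradsq x + S).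
  have -> : gradsq x + S = \sum_i \sum_j (u1 j i x * u1 j i x + u j x * u2 j i i x).
    rewrite exchange_big /= /gradsq /S -big_split /=; apply: eq_bigr => j _.
    rewrite big_split /= -mulr_sumr hu.
    by under [in RHS]eq_bigr do rewrite -expr2; ring.
  rewrite /Q !mulr_sumr -big_split /=; apply: eq_bigr => i _.
  by rewrite /sqpow2 /sqsum2; ring.
have p1 : 0 <= sqsum x `^ (q - 1) := powR_ge0 _ _.
have p2 : 0 <= sqsum x `^ (q - 2) := powR_ge0 _ _.
have qq : 0 <= q * (q - 1) by rewrite mulr_ge0 ?subr_ge0// (le_trans ler01).
have q0 : 0 <= q by exact: le_trans ler01 q1.
apply/andP; split.
  by rewrite addr_ge0// !mulr_ge0// ?subr_ge0// addr_ge0.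
have e1 : q * (q - 1) * sqsum x `^ (q - 2) * Q <=
    q * (q - 1) * 4 * (sqsum x `^ (q - 1) * gradsq x).
  have -> : q * (q - 1) * 4 * (sqsum x `^ (q - 1) * gradsq x) =
      q * (q - 1) * sqsum x `^ (q - 2) * (4 * (sqsum x * gradsq x)).
    rewrite -(powRB1 (q - 1) w0) (_ : q - 1 - 1 = q - 2); first by ring.
    by ring.
  by rewrite ler_wpM2l ?sum_sqsum1_le// mulr_ge0.
have e2 : 2 * q * sqsum x `^ (q - 1) * S <= 2 * q * c * sqpow x.
  rewrite /sqpow -(powRB1 q w0).
  have -> : 2 * q * c * (sqsum x `^ (q - 1) * sqsum x) =
    2 * q * sqsum x `^ (q - 1) * (c * sqsum x) by ring.
  by rewrite ler_wpM2l// !mulr_ge0.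
have -> : 2 * q * sqsum x `^ (q - 1) * (gradsq x + S) =
    2 * q * (sqsum x `^ (q - 1) * gradsq x) + 2 * q * sqsum x `^ (q - 1) * S by ring.
move: e1 e2.
move: (q * (q - 1) * _ * Q) (sqsum x `^ (q - 1) * gradsq x) (2 * q * _ * S) (2 * q * c * _).
by move=> X Y U W; lra.
Qed.

End power_of_squares.

(** * The estimate for the mean of [w ^ q] *)

Section mean_estimates.
Variables (R : realType) (n : nat).
Hypothesis n0 : (0 < n)%N.
Local Notation N := (n + n)%N.
Local Notation V := 'rV[R]_N.
Variables (d : measure_display) (T : measurableType d).
Variables (P : {measure set T -> \bar R}) (Z : T -> V).
Hypothesis P1 : P setT = 1%E.
Hypothesis mZ : forall i, measurable_fun setT (fun t => Z t 0 i).
Hypothesis Z1 : forall t, enorm (Z t) = 1.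
Local Notation smean := (mean P Z).

(* Hoelder's inequality: [w] stands for a [q]-th root of the first factor *)
Lemma mean_interpolation (w g : V -> R) (q al be th : R) :
  sphere_continuous w -> sphere_continuous g ->
  (forall x, 0 < w x) -> (forall x, 0 <= g x) -> 1 <= q -> 0 <= th <= 1 ->
  sphere_continuous (fun x => w x `^ q) ->
  0 < al -> 0 < be ->
  smean (fun x => w x `^ q) <= al -> smean (fun x => g x `^ q) <= be ->
  smean (fun x => w x `^ (q * (1 - th)) * g x `^ (q * th)) <= al `^ (1 - th) * be `^ th.
Proof.
move=> cw cg w0 g0 q1 th01 cwq al0 be0 hal hbe.
have q0 : 0 <= q by exact: le_trans ler01 q1.
have [Mw Mw0 wM] := sphere_bounded cw.
have [Mg Mg0 gM] := sphere_bounded cg.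
rewrite /mean.
have -> : \int[P]_t (w (Z t) `^ (q * (1 - th)) * g (Z t) `^ (q * th)) =
    \int[P]_t ((w (Z t) `^ q) `^ (1 - th) * (g (Z t) `^ q) `^ th).
  by apply: eq_Rintegral => t _; rewrite -!powRrM.
have le_pow (y K : R) : 0 <= y -> y <= K -> y `^ q <= K `^ q.
  by move=> y0 yK; rewrite ge0_ler_powR// nnegrE (le_trans y0).
apply: (@integral_powR_interpolation _ _ _ P P1 _ _ (Num.max Mw Mg `^ q)) => //.
- exact: (measurable_sphere mZ Z1 cwq).
- exact: (measurableT_comp (measurable_powR _) (measurable_sphere mZ Z1 cg)).
- move=> t; rewrite powR_ge0 /=; apply: le_pow; first exact: ltW.
  by rewrite le_max (le_trans (ler_norm _) (wM _ (Z1 t))).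
- move=> t; rewrite powR_ge0 /=; apply: le_pow => //.
  by rewrite le_max (le_trans (ler_norm _) (gM _ (Z1 t))) orbT.
Qed.

Variables (J : finType) (rho eps q r : R).
Hypotheses (eps0 : 0 < eps) (q1 : 1 <= q) (r0 : 0 < r) (rrho : r < rho) (r1 : r < 1).
Variables (u : J -> V -> R) (u1 : J -> 'I_N -> V -> R).

Local Notation w := (sqsum eps u).

Let m (s : R) := smean (fun z => sqpow eps q u (s *: z)).

Lemma sphere_continuous_sqsum (s : R) : (forall j, C1jet rho (u j) (u1 j)) ->
  `|s| < rho -> sphere_continuous (fun z => w (s *: z)).
Proof.
move=> uJ sr; apply: (sphere_continuous_scale sr) => x xr.
by apply: (hasgrad_cont (G := sqsum1 u u1 ^~ x)); apply: hasgrad_sqsum => j; have [] := uJ j x xr.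
Qed.

Lemma sphere_continuous_sqpow (s a : R) : (forall j, C1jet rho (u j) (u1 j)) ->
  `|s| < rho -> sphere_continuous (fun z => w (s *: z) `^ a).
Proof.
move=> uJ sr; apply: (sphere_continuous_scale (g := sqpow eps a u) sr) => x xr.
exact: (C1jet_cont (sqpow_C1jet a eps0 uJ) xr).
Qed.

Let m_gt0 s : (forall j, C1jet rho (u j) (u1 j)) -> `|s| < rho -> 0 < m s.
Proof.
move=> uJ sr; have e0 : 0 < eps `^ q by rewrite powR_gt0.
apply: (lt_le_trans e0); rewrite -(mean_cst Z P1 (eps `^ q)).
apply: (le_mean P1 mZ Z1); first exact: sphere_continuous_cst.
  exact: sphere_continuous_sqpow.
move=> x _; rewrite ge0_ler_powR// ?nnegrE ?(le_trans ler01 q1)//.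
- exact: ltW.
- by apply/ltW/sqsum_gt0.
- by rewrite lerDl sumr_ge0// => j _; exact: sqr_ge0.
Qed.

Let m0E : m 0 = w 0 `^ q.
Proof.
rewrite /m -(mean_cst Z P1 (w 0 `^ q)); apply: eq_mean => // x _.
by rewrite scale0r.
Qed.

(** The heart of the proof. [4 g] stands for [|Du|^2] up to the error [del]; the 4 anticipates that
    the square of [Dstar] is a quarter of the real Hessian norm squared. Monotonicity of [m] and
    Hoelder bound the mean Laplacian by [A] times known quantities plus [2q c m r]; the radial
    comparison then bounds [m r], and a factor [A] cancels throughout. *)
Lemma subharmonic_estimate (u2 : J -> 'I_N -> 'I_N -> V -> R) (c del K om1 : R)
    (cj : J -> R) (g : V -> R) (Om Om2 W : R -> R) :
  (forall (F : 'I_N -> V -> R) (F' : 'I_N -> 'I_N -> V -> R),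
    (forall x, enorm x = 1 -> forall i,
      hasgrad (F i) (F' i ^~ x) x /\ forall j, {for x, continuous (F' i j)}) ->
    (forall x, enorm x = 1 -> \sum_i x 0 i * F i x = 0) ->
    smean (tan_div F') = 0) ->
  (forall j, C2jet rho (u j) (u1 j) (u2 j)) ->
  0 <= c -> (forall j, 0 <= cj j <= c) ->
  (forall j x, enorm x < rho -> \sum_i u2 j i i x = cj j * u j x) ->
  (forall x, 0 <= g x) -> (forall x, enorm x < rho -> {for x, continuous g}) ->
  0 <= del -> (forall x, enorm x <= r -> gradsq u1 x <= 4 * g x + del) ->
  0 < K -> (forall s, 0 <= s <= r -> 0 < Om s /\ (1 - s) * Om s <= om1) ->
  Om2 0 = 0 -> (forall s : R, 0 <= s <= r -> is_derive s 1 Om2 (Om s ^+ 2)) ->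
  W 0 = 0 -> (forall s : R, 0 <= s <= r -> is_derive s 1 W (Om s)) ->
  (forall s, 0 < s < r -> smean (fun z => g (s *: z) `^ q) <= (K * Om s) `^ (2 * q)) ->
  (1 - 2 * q * c * r ^+ 2 / (2 * N%:R)) * m r `^ q^-1 <=
  w 0 + 2 * q * (2 * q - 1) * (4 * K ^+ 2 * om1 * W r + del * r ^+ 2 / (2 * N%:R)).
Proof.
move=> divZ uJ c0 hcj hlap g0 cg del0 hgrad K0 hOm O20 dO2 W0 dW hmean.
have uJ1 j : C1jet rho (u j) (u1 j) by have [] := uJ j.
have vJ := sqpow_C2jet q eps0 uJ.
have q0 : 0 < q by exact: lt_le_trans ltr01 q1.
have qn : q != 0 by rewrite gt_eqF.
have sin (s : R) : 0 <= s <= r -> `|s| < rho.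
  by move=> /andP[s0 sr]; rewrite ger0_norm// (le_lt_trans sr).
pose L (s : R) := smean (fun z => \sum_i sqpow2 eps q u u1 u2 i i (s *: z)).
pose m1 (s : R) := smean (fun z => \sum_i z 0 i * sqpow1 eps q u u1 i (s *: z)).
have [k Nk] : exists k, N = k.+2.
  by case: (n) n0 => // k _; exists (k + k)%N; rewrite addSn addnS.
have dm (s : R) : `|s| < rho -> is_derive s 1 m (m1 s).
  exact: (is_derive_mean_radial P1 mZ Z1 vJ).
have cm1 (s : R) : `|s| < rho -> {for s, continuous m1}.
  by move=> sr; exact: is_derive_continuous (is_derive_mean_radial2 P1 mZ Z1 vJ sr).
have dflux (s : R) : 0 < s < rho ->
    is_derive s 1 (fun t : R => t ^+ k.+1 * m1 t) (s ^+ k.+1 * L s).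
  have -> : k.+1 = N.-1 by rewrite Nk.
  exact: (is_derive_mean_flux n0 P1 mZ Z1 divZ vJ).
have cv2 (s : R) i : `|s| < rho -> sphere_continuous (fun z => sqpow2 eps q u u1 u2 i i (s *: z)).
  by move=> sr; apply: (sphere_continuous_scale sr) => x xr; have [_] := vJ.2 i x xr; exact.
have lapb (x : V) : enorm x < rho -> 0 <= \sum_i sqpow2 eps q u u1 u2 i i x <=
    2 * q * (2 * q - 1) * (w x `^ (q - 1) * gradsq u1 x) + 2 * q * c * sqpow eps q u x.
  by move=> xr; exact: (laplacian_sqpow eps0 u1 q1 c0 hcj (fun j => hlap j x xr)).
have L0 (s : R) : 0 < s < r -> 0 <= L s.
  move=> /andP[s0 sr]; have sr' : `|s| < rho by apply: sin; rewrite !ltW.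
  rewrite -(mean_cst Z P1 0); apply: (le_mean P1 mZ Z1).
  - exact: sphere_continuous_cst.
  - by apply: sphere_continuous_sum => i; exact: cv2.
  - by move=> x x1; have /andP[] := lapb (s *: x) (ltac:(by rewrite enormZ x1 mulr1)).
have mono := flux_ge0_nondecreasing rrho dm cm1 dflux L0.
have mr0 : 0 < m r by apply: m_gt0 => //; apply: sin; rewrite lexx ltW.
(* This power of the mean at the final radius majorizes the Hoelder factor at every smaller
   radius. *)
pose A := m r `^ (1 - q^-1).
have A0 : 0 < A by rewrite powR_gt0.
have th01 : 0 <= q^-1 <= 1 by rewrite invr_ge0 ltW//= invf_le1.
have qth : q * (1 - q^-1) = q - 1 by rewrite mulrBr mulr1 divff.
have q2 : 1 <= 2 * q by rewrite mulr_natl mulr2n ler_wpDr// ltW.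
have q21 : 0 <= 2 * q * (2 * q - 1).
  by apply: mulr_ge0; [exact: le_trans ler01 q2|rewrite subr_ge0].
have hL (s : R) : 0 < s < r -> L s <=
    2 * q * (2 * q - 1) * 4 * K ^+ 2 * A * Om s ^+ 2 +
    (2 * q * (2 * q - 1) * del * A + 2 * q * c * m r).
  move=> /andP[s0 sr]; have ss : 0 <= s <= r by rewrite !ltW.
  have sr' := sin s ss.
  have ms : m s <= m r by apply: mono => //; exact: ltW.
  have [Om0 _] := hOm s ss.
  have cw := sphere_continuous_sqsum uJ1 sr'.
  have cwp a : sphere_continuous (fun z => w (s *: z) `^ a).
    exact: (sphere_continuous_sqpow uJ1 sr').
  have cgs : sphere_continuous (fun z => g (s *: z)) by exact: (sphere_continuous_scale sr' cg).
  have i1 : smean (fun z => w (s *: z) `^ (q - 1) * g (s *: z)) <= A * (K * Om s) ^+ 2.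
    have := @mean_interpolation _ _ q (m r) ((K * Om s) `^ (2 * q)) q^-1 cw cgs.
    rewrite qth => H; have := H _ _ q1 th01 (cwp q) mr0 _ ms (hmean s _).
    have -> : ((K * Om s) `^ (2 * q)) `^ q^-1 = (K * Om s) ^+ 2.
      by rewrite -powRrM mulfK// powR_mulrn// mulr_ge0 ?ltW.
    have -> : smean (fun x => w (s *: x) `^ (q - 1) * g (s *: x) `^ (q * q^-1)) =
        smean (fun z => w (s *: z) `^ (q - 1) * g (s *: z)).
      by apply: eq_mean => // x _; rewrite divff// powRr1.
    apply => //; first by move=> x; exact: sqsum_gt0.
    - by rewrite powR_gt0// mulr_gt0.
    - by rewrite s0 sr.
  (* The same interpolation with [g] replaced by 1; it serves the error term [del]. *)
  have i2 : smean (fun z => w (s *: z) `^ (q - 1)) <= A.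
    have := @mean_interpolation _ _ q (m r) 1 q^-1 cw (@sphere_continuous_cst R n 1).
    have w0' (x : V) : 0 < w (s *: x) by exact: sqsum_gt0.
    have hc : smean (fun=> 1 `^ q) <= 1 by rewrite powR1 mean_cst.
    rewrite qth => /(_ w0' (fun=> ler01) q1 th01 (cwp q) mr0 ltr01 ms hc).
    rewrite powR1 mulr1; apply: le_trans; rewrite le_eqVlt; apply/orP; left; apply/eqP.
    by apply: eq_mean => // x _; rewrite /= ?powR1 mulr1.
  pose C1 := 2 * q * (2 * q - 1).
  have cgw : sphere_continuous (fun z => w (s *: z) `^ (q - 1) * g (s *: z)).
    exact: sphere_continuousM.
  have c1 : sphere_continuous (fun z => C1 * 4 * (w (s *: z) `^ (q - 1) * g (s *: z))).
    by apply: sphere_continuousM => //; exact: sphere_continuous_cst.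
  have c2 : sphere_continuous (fun z => C1 * del * w (s *: z) `^ (q - 1)).
    by apply: sphere_continuousM; [exact: sphere_continuous_cst|exact: cwp].
  have c3 : sphere_continuous (fun z => 2 * q * c * w (s *: z) `^ q).
    by apply: sphere_continuousM; [exact: sphere_continuous_cst|exact: cwp].
  apply: (@le_trans _ _ (smean (fun z => C1 * 4 * (w (s *: z) `^ (q - 1) * g (s *: z)) +
     (C1 * del * w (s *: z) `^ (q - 1) + 2 * q * c * w (s *: z) `^ q)))).
    apply: (le_mean P1 mZ Z1).
    - by apply: sphere_continuous_sum => i; exact: cv2.
    - by apply: sphere_continuousD => //; exact: sphere_continuousD.
    - move=> x x1; have sxr : enorm (s *: x) < rho by rewrite enormZ x1 mulr1.
      have /andP[_ /le_trans] := lapb _ sxr; apply.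
      rewrite addrA lerD2r.
      have -> : C1 * 4 * (w (s *: x) `^ (q - 1) * g (s *: x)) +
          C1 * del * w (s *: x) `^ (q - 1) =
          C1 * (w (s *: x) `^ (q - 1) * (4 * g (s *: x) + del)) by ring.
      apply: ler_wpM2l => //; apply: ler_wpM2l; first exact: powR_ge0.
      by apply: hgrad; rewrite enormZ x1 mulr1 ger0_norm ltW.
  have e1 : smean (fun z => C1 * 4 * (w (s *: z) `^ (q - 1) * g (s *: z))) =
      C1 * 4 * smean (fun z => w (s *: z) `^ (q - 1) * g (s *: z)).
    exact: (meanZ P1 mZ Z1 _ cgw).
  have e2 : smean (fun z => C1 * del * w (s *: z) `^ (q - 1)) =
      C1 * del * smean (fun z => w (s *: z) `^ (q - 1)).
    exact: (meanZ P1 mZ Z1 _ (cwp (q - 1))).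
  have e3 : smean (fun z => 2 * q * c * w (s *: z) `^ q) = 2 * q * c * m s.
    exact: (meanZ P1 mZ Z1 _ (cwp q)).
  rewrite (meanD P1 mZ Z1 c1 (sphere_continuousD c2 c3)) (meanD P1 mZ Z1 c2 c3) e1 e2 e3.
  have c1' : C1 * 4 * smean (fun z => w (s *: z) `^ (q - 1) * g (s *: z)) <=
      C1 * 4 * (A * (K * Om s) ^+ 2) by rewrite ler_wpM2l// mulr_ge0.
  have c2' : C1 * del * smean (fun z => w (s *: z) `^ (q - 1)) <= C1 * del * A.
    by rewrite ler_wpM2l// mulr_ge0.
  have c3' : 2 * q * c * m s <= 2 * q * c * m r.
    by rewrite ler_wpM2l// !mulr_ge0// ltW.
  apply: (le_trans (lerD c1' (lerD c2' c3'))).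
  rewrite le_eqVlt; apply/orP; left; apply/eqP; rewrite exprMn -/C1.
  by move: (C1) (A) (m r) (Om s) => x1 x2 x3 x4; ring.
have hOm' (s : R) : 0 <= s <= r -> 0 <= Om s /\ (1 - s) * Om s <= om1.
  by move=> /hOm[/ltW].
have A0' := ltW A0; have mr0' := ltW mr0; have q0' := ltW q0.
have al0 : 0 <= 2 * q * (2 * q - 1) * 4 * K ^+ 2 * A.
  by apply: mulr_ge0 => //; apply: mulr_ge0; [exact: mulr_ge0|exact: sqr_ge0].
have be0 : 0 <= 2 * q * (2 * q - 1) * del * A + 2 * q * c * m r.
  apply: addr_ge0; apply: mulr_ge0 => //; first exact: mulr_ge0.
  by apply: mulr_ge0 => //; exact: mulr_ge0.
have := flux_comparison r0 rrho dm cm1 dflux al0 be0 r1 hOm' O20 dO2 W0 dW hL.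
have mrE : m r = A * m r `^ q^-1.
  by rewrite /A -powRD ?subrK ?powRr1 ?ltW//; apply/implyP => _; rewrite gt_eqF.
(* [m 0 = m 0 ^ (1 - 1/q) * w 0], and the first factor is at most [A] by monotonicity. *)
have m0le : m 0 <= A * w 0.
  have wq : w 0 = m 0 `^ q^-1.
    by rewrite m0E -powRrM divff// powRr1// ltW// sqsum_gt0.
  have m00 : 0 < m 0 by rewrite m0E powR_gt0// sqsum_gt0.
  rewrite wq -[leLHS](powRr1 (ltW m00)) -[X in m 0 `^ X](subrK q^-1) powRD; last first.
    by apply/implyP => _; rewrite gt_eqF.
  apply: ler_wpM2r; first exact: powR_ge0.
  apply: ge0_ler_powR; rewrite ?nnegrE.
  - by have /andP[_ q1'] := th01; rewrite subr_ge0.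
  - exact: ltW m00.
  - exact: mr0'.
  - by apply: mono => //; exact: ltW.
rewrite -Nk; set X := r ^+ 2; set Y := _ * N%:R; rewrite [in X in X -> _]mrE => H.
(* All terms now carry the factor [A]; the part of [be] with [m r = A * m r ^ (1/q)] goes to the
   left-hand side. *)
rewrite -(ler_pM2l A0).
have {}H := le_trans H (lerD (lerD m0le (lexx _)) (lexx _)).
rewrite -subr_ge0; apply: (@le_trans _ _ (A * w 0 +
  2 * q * (2 * q - 1) * 4 * K ^+ 2 * A * om1 * W r +
  (2 * q * (2 * q - 1) * del * A + 2 * q * c * (A * m r `^ q^-1)) * X / Y -
  A * m r `^ q^-1)); first by rewrite subr_ge0; exact: H.
rewrite le_eqVlt; apply/orP; left; apply/eqP.
by move: (A) (m r `^ q^-1) (X) (Y^-1) (w 0) (W r) => x1 x2 x3 x4 x5 x6; ring.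
Qed.

End mean_estimates.

(** * From a bound on the gradient to a bound on the function *)

Section growth.
Variables (R : realType) (n : nat).
Local Notation N := (n + n)%N.
Local Notation V := 'rV[R]_N.
Variables (d : measure_display) (T : measurableType d).
Variables (P : {measure set T -> \bar R}) (Z : T -> V).
Hypothesis P1 : P setT = 1%E.
Hypothesis mZ : forall i, measurable_fun setT (fun t => Z t 0 i).
Hypothesis Z1 : forall t, enorm (Z t) = 1.
Local Notation smean := (mean P Z).
Variables (J : finType) (rho eps q r : R).
Hypotheses (eps0 : 0 < eps) (q1 : 1 <= q) (r0 : 0 < r) (rrho : r < rho) (r1 : r < 1).
Variables (u : J -> V -> R) (u1 : J -> 'I_N -> V -> R).
Hypothesis uJ : forall j, C1jet rho (u j) (u1 j).
Local Notation w := (sqsum eps u).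

(** Cauchy-Schwarz twice: over the coordinates, where [z] is a unit vector, and over [j], where
    [|u| <= w ^ (1/2)]. The exponent [q - 1/2] is [q (1 - th)] for the [th = 1/(2q)] used in the
    next lemma. *)
Lemma radial_sqpow_le (x z : V) : enorm z = 1 ->
  \sum_i z 0 i * sqpow1 eps q u u1 i x <=
  2 * q * (w x `^ (q - 2^-1) * gradsq u1 x `^ 2^-1).
Proof.
move=> z1; have w0 := sqsum_gt0 eps0 u x; have G0 := gradsq_ge0 u1 x.
pose D j := \sum_i z 0 i * u1 j i x.
have q0 : 0 <= q by exact: le_trans ler01 q1.
have -> : \sum_i z 0 i * sqpow1 eps q u u1 i x =
    2 * q * (w x `^ (q - 1) * \sum_j u j x * D j).
  transitivity (\sum_i \sum_j 2 * q * (w x `^ (q - 1) * (u j x * (z 0 i * u1 j i x)))).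
    apply: eq_bigr => i _; rewrite /sqpow1 /sqsum1 !mulr_sumr.
    by apply: eq_bigr => j _; ring.
  rewrite exchange_big /= !mulr_sumr; apply: eq_bigr => j _.
  by rewrite /D !mulr_sumr.
have DG : \sum_j D j ^+ 2 <= gradsq u1 x.
  apply: ler_sum => j _; apply: (le_trans (sum_cauchy_schwarz _ _)).
  have -> : \sum_i z 0 i ^+ 2 = 1 by rewrite -[LHS]/(sqnorm z) -sqr_enorm z1 expr1n.
  by rewrite mul1r.
have uD : \sum_j u j x * D j <= w x `^ 2^-1 * gradsq u1 x `^ 2^-1.
  apply: (le_trans (ler_norm _)); rewrite -sqrtr_sqr -powRM ?(ltW w0)//.
  rewrite powR12_sqrt ?mulr_ge0 ?(ltW w0)//; apply: ler_wsqrtr.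
  apply: (le_trans (sum_cauchy_schwarz _ _)); apply: ler_pM => //.
  - by apply: sumr_ge0 => j _; exact: sqr_ge0.
  - by apply: sumr_ge0 => j _; exact: sqr_ge0.
  - by rewrite lerDr ltW.
have -> : w x `^ (q - 2^-1) = w x `^ (q - 1) * w x `^ 2^-1.
  rewrite -powRD; last by apply/implyP => _; rewrite gt_eqF.
  by congr (_ `^ _); field.
apply: ler_wpM2l; first exact: mulr_ge0.
by rewrite -mulrA; apply: ler_wpM2l => //; exact: powR_ge0.
Qed.

(** By Hoelder [m' <= 2q m ^ (1 - th) C / sqrt (1 - s)] with [th = 1/(2q)], so the derivative of
    [m ^ th] is at most [C / sqrt (1 - s)], whose integral over [[0, 1]] is [2C]. *)
Lemma growth_estimate (C : R) : 0 < C ->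
  (forall s, 0 < s < r -> smean (fun z => gradsq u1 (s *: z) `^ q) <=
     (C / Num.sqrt (1 - s)) `^ (2 * q)) ->
  smean (fun z => sqpow eps q u (r *: z)) `^ (2 * q)^-1 <= w 0 `^ 2^-1 + 2 * C.
Proof.
move=> C0 hmean.
have aux (a b c e : R) : - b <= c - e - a -> 0 <= e -> a <= b + c by lra.
pose m (s : R) := smean (fun z => sqpow eps q u (s *: z)).
pose m1 (s : R) := smean (fun z => \sum_i z 0 i * sqpow1 eps q u u1 i (s *: z)).
have q0 : 0 < q by exact: lt_le_trans ltr01 q1.
have vJ := sqpow_C1jet q eps0 uJ.
have sin (s : R) : 0 <= s <= r -> `|s| < rho.
  by move=> /andP[s0 sr]; rewrite ger0_norm// (le_lt_trans sr).
have dm (s : R) : `|s| < rho -> is_derive s 1 m (m1 s).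
  move=> sr; have := is_derive_mean P1 mZ Z1 (@sphere_continuous_cst R n 1) vJ sr.
  have -> : (fun u0 : R => smean (fun z => 1 * sqpow eps q u (u0 *: z))) = m.
    by apply/funext => t; apply: eq_mean => // x _; rewrite mul1r.
  have -> // : smean (fun z => 1 * \sum_i z 0 i * sqpow1 eps q u u1 i (s *: z)) = m1 s.
  by apply: eq_mean => // x _; rewrite mul1r.
have cw (s : R) : `|s| < rho -> sphere_continuous (fun z => w (s *: z)).
  exact: (sphere_continuous_sqsum (u1 := u1)).
have cwp (s a : R) : `|s| < rho -> sphere_continuous (fun z => w (s *: z) `^ a).
  exact: (sphere_continuous_sqpow eps0 uJ).
have cu1 j i (s : R) : `|s| < rho -> sphere_continuous (fun z => u1 j i (s *: z)).
  by move=> sr; apply: (sphere_continuous_scale sr) => x xr; have [_] := uJ j xr; exact.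
have cG (s : R) : `|s| < rho -> sphere_continuous (fun z => gradsq u1 (s *: z)).
  move=> sr; apply: sphere_continuous_sum => j; apply: sphere_continuous_sum => i.
  rewrite (_ : (fun x => _) = (fun x => u1 j i (s *: x) * u1 j i (s *: x))).
    by apply: sphere_continuousM; exact: cu1.
  by apply/funext => x; rewrite expr2.
have m0 (s : R) : `|s| < rho -> 0 < m s.
  move=> sr; have e0 : 0 < eps `^ q by rewrite powR_gt0.
  apply: (lt_le_trans e0); rewrite -(mean_cst Z P1 (eps `^ q)).
  apply: (le_mean P1 mZ Z1); [exact: sphere_continuous_cst|exact: cwp|move=> x _].
  apply: ge0_ler_powR; rewrite ?nnegrE; [exact: ltW|exact: ltW|exact/ltW/sqsum_gt0|].
  by rewrite lerDl sumr_ge0// => j _; exact: sqr_ge0.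
pose th := (2 * q)^-1.
have q2 : 0 < 2 * q by rewrite mulr_gt0.
have th01 : 0 <= th <= 1.
  apply/andP; split; first by rewrite invr_ge0 ltW.
  by rewrite invf_le1// mulr_natl mulr2n ler_wpDr// ltW.
have th0 : th != 0 by rewrite invr_eq0 gt_eqF.
have qth : q * th = 2^-1 by rewrite /th; field; rewrite gt_eqF.
have m1B (s : R) : 0 < s < r -> m1 s <= 2 * q * (m s `^ (1 - th) * (C / Num.sqrt (1 - s))).
  move=> /andP[s0 sr]; have sr' : `|s| < rho by apply: sin; rewrite !ltW.
  have B0 : 0 < C / Num.sqrt (1 - s).
    by rewrite divr_gt0// sqrtr_gt0 subr_gt0 (lt_trans sr).
  have := hmean s; rewrite s0 sr => /(_ isT) hms.
  have cwG : sphere_continuous (fun z => w (s *: z) `^ (q - 2^-1) * gradsq u1 (s *: z) `^ 2^-1).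
    apply: sphere_continuousM; first exact: cwp.
    rewrite (_ : (fun z => _) = (fun z => Num.sqrt (gradsq u1 (s *: z)))); last first.
      by apply/funext => z; rewrite powR12_sqrt// gradsq_ge0.
    move=> x x1; apply: continuous_comp; [exact: cG|exact: sqrt_continuous].
  apply: (@le_trans _ _ (smean (fun z => 2 * q *
      (w (s *: z) `^ (q - 2^-1) * gradsq u1 (s *: z) `^ 2^-1)))).
    apply: (le_mean P1 mZ Z1).
    - apply: sphere_continuous_sum => i; apply: sphere_continuousM; first exact: sphere_continuous_coord.
      by apply: (sphere_continuous_scale sr') => x xr; have [_] := vJ x xr; exact.
    - by apply: sphere_continuousM => //; exact: sphere_continuous_cst.
    - by move=> x x1; exact: radial_sqpow_le.
  have -> : smean (fun z => 2 * q * (w (s *: z) `^ (q - 2^-1) * gradsq u1 (s *: z) `^ 2^-1)) =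
     2 * q * smean (fun z => w (s *: z) `^ (q - 2^-1) * gradsq u1 (s *: z) `^ 2^-1).
    exact: (meanZ P1 mZ Z1 _ cwG).
  apply: ler_wpM2l; first exact: ltW.
  have w0' (x : V) : 0 < w (s *: x) by exact: sqsum_gt0.
  have := @mean_interpolation R n d T P Z P1 mZ Z1 _ _ q (m s)
    ((C / Num.sqrt (1 - s)) `^ (2 * q)) th (cw s sr') (cG s sr') w0' (fun x => gradsq_ge0 u1 _)
    q1 th01 (cwp s q sr') (m0 s sr') (powR_gt0 _ B0) (lexx _) hms.
  rewrite mulrBr mulr1 qth; congr (_ <= _ * _).
  by rewrite -powRrM divff ?gt_eqF// powRr1// ltW.
(* [2C (1 - sqrt (1 - s))] is the primitive of [C / sqrt (1 - s)] that vanishes at 0. *)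
pose F (s : R) := 2 * C * (1 - Num.sqrt (1 - s)) - m s `^ th.
pose F' (s : R) := C / Num.sqrt (1 - s) - th * m s `^ (th - 1) * m1 s.
have dF (s : R) : 0 <= s <= r -> is_derive s 1 F (F' s).
  move=> ss; have sr' := sin s ss; have /andP[s0 sr] := ss.
  have s1 : 0 < 1 - s by rewrite subr_gt0 (le_lt_trans sr).
  have d1 : is_derive s 1 (fun t => m t `^ th) (th * m s `^ (th - 1) * m1 s).
    exact: (@is_derive1_comp R (fun y => y `^ th) m s _ _ (is_derive1_powR th (m0 s sr')) (dm s sr')).
  have d2 : is_derive s 1 (fun t : R => 1 - t) (-1).
    by apply: is_derive_eq; rewrite add0r mul1r.
  have d3 : is_derive s 1 (fun t => Num.sqrt (1 - t)) ((2 * Num.sqrt (1 - s))^-1 * -1).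
    exact: (@is_derive1_comp R _ (fun t : R => 1 - t) s _ _ (is_derive1_sqrt s1) d2).
  have d4 : is_derive s 1 (fun t => 2 * C * (1 - Num.sqrt (1 - t))) (C / Num.sqrt (1 - s)).
    apply: is_derive_eq; rewrite /GRing.scale /=; field.
    by rewrite gt_eqF// sqrtr_gt0.
  exact: (is_deriveB d4 d1).
have F0r : F 0 <= F r.
  apply: (@derive_ge0_le R F F' 0 r); first exact: ltW.
  - by move=> s /andP[s0 sr]; apply: dF; rewrite !ltW.
  - move=> s /andP[s0 sr]; have sr' : `|s| < rho by apply: sin; rewrite !ltW.
    have := m1B s; rewrite s0 sr => /(_ isT) h; rewrite /F' subr_ge0.
    have ms := m0 s sr'.
    have thp : 0 <= th * m s `^ (th - 1).
      by apply: mulr_ge0; [have /andP[] := th01|exact: powR_ge0].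
    apply: (le_trans (ler_wpM2l thp h)); rewrite le_eqVlt; apply/orP; left; apply/eqP.
    have e1 : m s `^ (th - 1) * m s `^ (1 - th) = 1.
      rewrite -powRD; last by apply/implyP => _; rewrite gt_eqF.
      by rewrite (_ : th - 1 + (1 - th) = 0) ?powRr0//; ring.
    have e2 : th * (2 * q) = 1 by rewrite mulVf ?gt_eqF.
    transitivity (th * (2 * q) * ((m s `^ (th - 1) * m s `^ (1 - th)) * (C / Num.sqrt (1 - s)))).
      by move: (m s `^ (th - 1)) (m s `^ (1 - th)) (C / _) => x2 x3 x4; ring.
    by rewrite e1 e2 !mul1r.
  - by move=> s ss; exact: is_derive_continuous (dF s ss).
have F00 : F 0 = - w 0 `^ 2^-1.
  have m0E : m 0 = w 0 `^ q.
    rewrite /m -(mean_cst Z P1 (w 0 `^ q)); apply: eq_mean => // x _.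
    by rewrite scale0r.
  by rewrite /F subr0 sqrtr1 subrr mulr0 sub0r m0E -powRrM qth.
have H : - w 0 `^ 2^-1 <= 2 * C * (1 - Num.sqrt (1 - r)) - m r `^ th by rewrite -F00.
have s0 : 0 <= 2 * C * Num.sqrt (1 - r) by rewrite mulr_ge0 ?sqrtr_ge0// mulr_ge0// ltW.
change (m r `^ th <= w 0 `^ 2^-1 + 2 * C).
by apply: (aux _ _ _ _ _ s0); move: H; rewrite mulrBr mulr1.
Qed.

End growth.

(** * Mixed partials and difference quotients *)

Section partial_derivatives.
Variables (R : realType) (n : nat).
Local Notation N := (n + n)%N.
Local Notation V := 'rV[R]_N.
Implicit Types (g : V -> R) (x y : V).

Lemma enorm_triangle x y : enorm (x + y) <= enorm x + enorm y.
Proof.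
rewrite -(ler_pXn2r (n := 2)) ?nnegrE ?enorm_ge0 ?addr_ge0 ?enorm_ge0//.
rewrite sqr_enorm sqrrD !sqr_enorm.
have -> : sqnorm (x + y) = sqnorm x + 2 * (\sum_i x 0 i * y 0 i) + sqnorm y.
  rewrite /sqnorm mulr_sumr -!big_split /=; apply: eq_bigr => i _.
  by rewrite !mxE; ring.
rewrite lerD2r lerD2l -[leRHS]mulr_natl ler_pM2l//.
apply: (le_trans (ler_norm _)); rewrite -sqrtr_sqr -sqrtrM ?sqnorm_ge0//.
exact: ler_wsqrtr (sum_cauchy_schwarz _ _).
Qed.

Lemma near_enorm_lt x (r : R) : enorm x < r -> \forall y \near x, enorm y < r.
Proof.
have /cvgrPdist_lt/(_ (r - enorm x)) := @enorm_continuous R n x.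
rewrite subr_gt0 => H /H; apply: filterS => y; rewrite distrC => h.
have := ler_norm (enorm y - enorm x); lra.
Qed.

Lemma C2_on_jet g : C2_on (@unit_ball R n) g ->
  C2jet 1 g (fun i => pd i g) (fun i j => pd j (pd i g)).
Proof.
move=> [c0 [d1 [c1 [d2 c2]]]]; split=> [x x1|i x x1]; split.
- apply: C1_hasgrad; last by move=> i; exact: c1.
  by apply: filterS (near_enorm_lt x1) => y y1 i; exact: d1.
- by move=> i; exact: c1.
- apply: C1_hasgrad; last by move=> j; exact: c2.
  by apply: filterS (near_enorm_lt x1) => y y1 j; exact: d2.
- by move=> j; exact: c2.
Qed.

Lemma norm_delta_le1 i : `|delta_mx 0 i : V| <= 1.
Proof.
rewrite [leLHS]/Num.Def.normr/= mx_normrE; apply: bigmax_le => // -[a b] _ /=.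
by rewrite mxE; case: (_ && _); rewrite ?normr1 ?normr0.
Qed.

Lemma hasgrad_shift g (G : 'I_N -> R) (a x : V) :
  hasgrad g G (a + x) -> hasgrad (fun y => g (a + y)) G x.
Proof.
move=> /hasgradP H; apply/hasgradP => e e0; have := H e e0.
rewrite (near_shift x (a + x)) addrK; apply: filterS => y /=.
by rewrite (addrC y a) opprD addrACA subrr add0r.
Qed.

(** The mean value theorem is used twice: in direction [i] for the increment of [g] in direction
    [j], then in direction [j] for [g1 i]. *)
Lemma second_difference g (g1 : 'I_N -> V -> R) (g2 : 'I_N -> 'I_N -> V -> R)
    (i j : 'I_N) (h : R) x : C2jet 1 g g1 g2 -> 0 < h ->
  (forall a b : R, 0 <= a <= h -> 0 <= b <= h ->
     enorm (a *: delta_mx 0 j + (b *: delta_mx 0 i + x)) < 1) ->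
  exists a b : R, [/\ 0 <= a <= h, 0 <= b <= h &
   g (h *: delta_mx 0 j + (h *: delta_mx 0 i + x)) - g (h *: delta_mx 0 i + x) -
   (g (h *: delta_mx 0 j + x) - g x) =
   h * (h * g2 i j (a *: delta_mx 0 j + (b *: delta_mx 0 i + x)))].
Proof.
move=> [J1 J2] h0 hB; have h0' := ltW h0.
have h00 : 0 <= (0 : R) <= h by rewrite lexx ltW.
have hh : 0 <= h <= h by rewrite lexx ltW.
have hb (b : R) : 0 <= b <= h -> enorm (b *: delta_mx 0 i + x) < 1.
  by move=> bh; have := hB 0 b h00 bh; rewrite scale0r add0r.
pose phi y := g (h *: delta_mx 0 j + y) + (-1) * g y.
have dphi (b : R) : 0 <= b <= h -> hasgrad phi
   (fun k => g1 k (h *: delta_mx 0 j + (b *: delta_mx 0 i + x)) +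
      (-1) * g1 k (b *: delta_mx 0 i + x)) (b *: delta_mx 0 i + x).
  move=> bh; apply: hasgradD.
    by apply: hasgrad_shift; have [] := J1 _ (hB h b hh bh).
  by apply: hasgradZ; have [] := J1 _ (hb b bh).
have [|b] := @line_MVT _ _ phi (delta_mx 0 i) x h.
  rewrite (min_l h0') (max_r h0') => t th.
  by have [] := hasgrad_partial i (dphi t th).
rewrite (min_l h0') (max_r h0') => bh.
have [_ ->] := hasgrad_partial i (dphi b bh) => E1.
have [|a] := @line_MVT _ _ (g1 i) (delta_mx 0 j) (b *: delta_mx 0 i + x) h.
  rewrite (min_l h0') (max_r h0') => t th.
  have [Hi _] := J2 i _ (hB t b th bh).
  by have [] := hasgrad_partial j Hi.
rewrite (min_l h0') (max_r h0') => ah.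
have [Hi _] := J2 i _ (hB a b ah bh).
have [_ ->] := hasgrad_partial j Hi => E2.
exists a, b; split => //; rewrite -E2.
move: E1; rewrite /phi !mulN1r => ->.
by [].
Qed.

(** The second difference is symmetric in [i] and [j], so both mixed partials take a common value at
    points arbitrarily close to [x]. It is needed because [lap] is built from Wirtinger derivatives,
    which produce mixed terms. *)
Lemma mixed_partials g (g1 : 'I_N -> V -> R) (g2 : 'I_N -> 'I_N -> V -> R) x i j :
  C2jet 1 g g1 g2 -> enorm x < 1 -> g2 i j x = g2 j i x.
Proof.
move=> gJ x1; apply/eqP; rewrite -subr_eq0 -normr_le0; apply/ler_addgt0Pr => e e0.
rewrite add0r.
have e2 : 0 < e / 2 by rewrite divr_gt0.
have c2 k l : {for x, continuous (g2 k l)} by have [_] := gJ.2 k x x1; exact.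
have : \forall y \near x, [/\ enorm y < 1, `|g2 i j y - g2 i j x| <= e / 2 &
    `|g2 j i y - g2 j i x| <= e / 2].
  near=> y; split.
  - by near: y; exact: near_enorm_lt.
  - by near: y; have /cvgrPdist_le/(_ _ e2) := c2 i j; apply: filterS => y; rewrite distrC.
  - by near: y; have /cvgrPdist_le/(_ _ e2) := c2 j i; apply: filterS => y; rewrite distrC.
move=> /nbhs_ballP[d /= d0 dP].
pose h := d / 3; have h0 : 0 < h by rewrite divr_gt0.
have inB (a b : R) k l : 0 <= a <= h -> 0 <= b <= h ->
    ball x d (a *: delta_mx 0 k + (b *: delta_mx 0 l + x)).
  move=> /andP[a0 ah] /andP[b0 bh]; rewrite -ball_normE /ball_ /= addrA opprD addrCA subrr addr0 normrN.
  apply: (le_lt_trans (ler_normD _ _)); rewrite !normrZ !ger0_norm//.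
  apply: (@le_lt_trans _ _ (h + h)).
    by apply: lerD; rewrite -[leRHS]mulr1; apply: ler_pM => //; exact: norm_delta_le1.
  by rewrite /h; lra.
have [a [b [ah bh E1]]] := second_difference (i := i) (j := j) gJ h0
  (fun a b ah bh => let: And3 H _ _ := dP _ (inB a b j i ah bh) in H).
have [a' [b' [ah' bh' E2]]] := second_difference (i := j) (j := i) gJ h0
  (fun a b ah bh => let: And3 H _ _ := dP _ (inB a b i j ah bh) in H).
have [_ H1 _] := dP _ (inB a b j i ah bh).
have [_ _ H2] := dP _ (inB a' b' i j ah' bh').
have E : g2 i j (a *: delta_mx 0 j + (b *: delta_mx 0 i + x)) =
    g2 j i (a' *: delta_mx 0 i + (b' *: delta_mx 0 j + x)).
  apply: (@mulfI _ (h * h)); first by rewrite mulf_neq0 ?gt_eqF.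
  rewrite -[LHS]mulrA -[RHS]mulrA -E1 -E2.
  have -> : h *: delta_mx 0 j + (h *: delta_mx 0 i + x) =
      h *: delta_mx 0 i + (h *: delta_mx 0 j + x) by rewrite addrCA.
  by ring.
rewrite E in H1.
have -> : g2 i j x - g2 j i x =
  (g2 j i (a' *: delta_mx 0 i + (b' *: delta_mx 0 j + x)) - g2 j i x) -
  (g2 j i (a' *: delta_mx 0 i + (b' *: delta_mx 0 j + x)) - g2 i j x) by ring.
rewrite (splitr e); apply: (le_trans (ler_normB _ _)); exact: lerD.
Unshelve. all: by end_near. Qed.

Definition diffq (h : R) (k : 'I_N) g x := h^-1 * (g (h *: delta_mx 0 k + x) - g x).

Lemma C1jet_diffq (rho h : R) k g (g1 : 'I_N -> V -> R) : rho + `|h| <= 1 ->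
  C1jet 1 g g1 -> C1jet rho (diffq h k g) (fun i => diffq h k (g1 i)).
Proof.
move=> rh gJ x xr.
have hx : enorm (h *: delta_mx 0 k + x) < 1.
  apply: (le_lt_trans (enorm_triangle _ _)); rewrite enormZ enorm_delta mulr1.
  by apply: lt_le_trans rh; rewrite addrC ltrD2r.
have x1 : enorm x < 1 by apply: (lt_le_trans xr); apply: le_trans rh; rewrite lerDl.
have [hg hc] := gJ x x1; have [hg' hc'] := gJ _ hx.
split.
  have := hasgradZ h^-1 (hasgradD (hasgrad_shift hg') (hasgradZ (-1) hg)).
  rewrite (_ : (fun y => _) = diffq h k g) => [/hasgrad_eq|]; last first.
    by apply/funext => y; rewrite /diffq mulN1r.
  by apply=> i; rewrite /diffq mulN1r.
move=> i; have cs : {for x, continuous (fun y => g1 i (h *: delta_mx 0 k + y))}.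
  apply: (@continuous_comp _ _ _ (fun y => h *: delta_mx 0 k + y)); last exact: hc'.
  exact: (cvgD (cvg_cst _) (@cvg_id _ (nbhs x))).
apply: (@continuousM _ _ (fun=> h^-1)); first exact: cst_continuous.
exact: (continuousB cs (hc i)).
Qed.

(** Uniform continuity on the compact ball, including shifts that leave it; hence a covering
    argument based on continuity at points of the open unit ball. *)
Lemma uniform_shift g (r e : R) (v : V) : r < 1 -> 0 < e ->
  (forall x, enorm x < 1 -> {for x, continuous g}) ->
  \forall c \near (0 : R), forall x, enorm x <= r -> `|g (c *: v + x) - g x| <= e.
Proof.
move=> r1 e0 cg.
have := (compact_near_coveringP _).1 (@compact_ball R n r).
move=> /(_ R (nbhs (0 : R)) (fun c x => `|g (c *: v + x) - g x| <= e)); apply.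
move=> x /= xr; have gx := cg x (le_lt_trans xr r1).
have e2 : 0 < e / 2 by rewrite divr_gt0.
have cs : yc.2 *: v + yc.1 @[yc --> (x, (0 : R))] --> x.
  have : yc.2 *: v + yc.1 @[yc --> (x, (0 : R))] --> 0 *: v + x.
    apply: cvgD; last exact: cvg_fst.
    by apply: cvgZr_tmp; exact: cvg_snd.
  by rewrite scale0r add0r.
have /cvgrPdist_le/(_ _ e2) g2 := gx.
have n2 : \forall yc \near (x, (0 : R)), `|g x - g (yc.2 *: v + yc.1)| <= e / 2.
  exact: (cs _ g2).
have n1 : \forall yc \near (x, (0 : R)), `|g x - g yc.1| <= e / 2.
  exact: (@cvg_fst V R (nbhs x) (nbhs (0 : R)) _ _ g2).
near=> yc => /=.
rewrite (_ : _ - _ = (g x - g yc.1) - (g x - g (yc.2 *: v + yc.1))); last by ring.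
rewrite (splitr e); apply: (le_trans (ler_normB _ _)); apply: lerD.
  by near: yc; exact: n1.
by near: yc; exact: n2.
Unshelve. all: by end_near. Qed.

(** The quotient is a value of [g1 k] at a point of the segment, and [uniform_shift] compares it
    with the value at [x]; [|h| < 1 - r] keeps the segment in the unit ball. *)
Lemma diffq_uniform (r e : R) g (g1 : 'I_N -> V -> R) k : r < 1 -> 0 < e -> C1jet 1 g g1 ->
  \forall h \near (0 : R), h != 0 -> forall x, enorm x <= r -> `|diffq h k g x - g1 k x| <= e.
Proof.
move=> r1 e0 gJ; pose q := (r + 1) / 2.
have cg1 x : enorm x < 1 -> {for x, continuous (g1 k)} by move=> /gJ[_]; exact.
have := uniform_shift (delta_mx 0 k) r1 e0 cg1.
move=> /nbhs_ballP[d /= d0 dP].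
apply/nbhs_ballP; exists (Num.min d (1 - r)) => /=; first by rewrite lt_min d0 subr_gt0.
move=> h; rewrite -ball_normE /ball_ /= sub0r normrN lt_min => /andP[hd hr] h0 x xr.
have between (t : R) : Num.min 0 h <= t <= Num.max 0 h -> `|t| <= `|h|.
  by case: (leP 0 h) => h0' /andP[t0 t1]; [rewrite !ger0_norm//; lra|rewrite !ler0_norm//; lra].
have [|c ch E] := @line_MVT _ _ g (delta_mx 0 k) x h.
  move=> t /between tb.
  have tx : enorm (t *: delta_mx 0 k + x) < 1.
    apply: (le_lt_trans (enorm_triangle _ _)); rewrite enormZ enorm_delta mulr1.
    by have := le_lt_trans tb hr; lra.
  by have [H _] := gJ _ tx; have [] := hasgrad_partial k H.
have cx : enorm (c *: delta_mx 0 k + x) < 1.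
  apply: (le_lt_trans (enorm_triangle _ _)); rewrite enormZ enorm_delta mulr1.
  by have := le_lt_trans (between _ ch) hr; lra.
have [H _] := gJ _ cx; have [_ D] := hasgrad_partial k H.
rewrite /diffq E D mulKf//; apply: dP => //.
rewrite -ball_normE /ball_ /= sub0r normrN.
exact: le_lt_trans (between _ ch) hd.
Qed.

Lemma diffq_sqr_uniform (r e : R) g (g1 : 'I_N -> V -> R) k : r < 1 -> 0 < e -> C1jet 1 g g1 ->
  \forall h \near (0 : R), h != 0 -> forall x, enorm x <= r ->
    `|diffq h k g x ^+ 2 - g1 k x ^+ 2| <= e.
Proof.
move=> r1 e0 gJ.
have [M M0 gM] : exists2 M, 0 <= M & forall x, enorm x <= r -> `|g1 k x| <= M.
  apply: (continuous_compact_bounded (@compact_ball R n r)) => x xr.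
  by have [_] := gJ x (le_lt_trans xr r1); exact.
(* In [a^2 - b^2 = (a - b) ((a - b) + 2b)] the second factor is then at most [2M + 1]. *)
pose e' := Num.min 1 (e / (2 * M + 1)).
have M1 : 0 < 2 * M + 1 by rewrite ltr_wpDl// mulr_ge0.
have e'0 : 0 < e' by rewrite lt_min ltr01 divr_gt0.
apply: filterS (diffq_uniform k r1 e'0 gJ) => h H h0 x xr.
have {}H := H h0 x xr; have Mx := gM x xr.
have -> : diffq h k g x ^+ 2 - g1 k x ^+ 2 =
    (diffq h k g x - g1 k x) * ((diffq h k g x - g1 k x) + 2 * g1 k x) by ring.
rewrite normrM; apply: (@le_trans _ _ (e / (2 * M + 1) * (2 * M + 1))); last first.
  by rewrite divfK ?gt_eqF.
apply: ler_pM => //; first by apply: (le_trans H); rewrite ge_min lexx orbT.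
apply: (le_trans (ler_normD _ _)); rewrite addrC; apply: lerD.
  by rewrite normrM ger0_norm// ler_wpM2l.
by apply: (le_trans H); rewrite ge_min lexx.
Qed.

End partial_derivatives.

(** * The estimate for the mean of the gradient *)

Section gradient_means.
Variables (R : realType) (n : nat).
Hypothesis n0 : (0 < n)%N.
Local Notation N := (n + n)%N.
Local Notation V := 'rV[R]_N.
Variables (d : measure_display) (T : measurableType d).
Variables (P : {measure set T -> \bar R}) (Z : T -> V).
Hypothesis P1 : P setT = 1%E.
Hypothesis mZ : forall i, measurable_fun setT (fun t => Z t 0 i).
Hypothesis Z1 : forall t, enorm (Z t) = 1.
Local Notation smean := (mean P Z).
Hypothesis divZ : forall (F : 'I_N -> V -> R) (F' : 'I_N -> 'I_N -> V -> R),
  (forall x, enorm x = 1 -> forall i,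
    hasgrad (F i) (F' i ^~ x) x /\ forall j, {for x, continuous (F' i j)}) ->
  (forall x, enorm x = 1 -> \sum_i x 0 i * F i x = 0) ->
  smean (tan_div F') = 0.
Variables (B : finType) (phi : B -> V -> R) (phi1 : B -> 'I_N -> V -> R).
Variable phi2 : B -> 'I_N -> 'I_N -> V -> R.
Hypothesis phiJ : forall b, C2jet 1 (phi b) (phi1 b) (phi2 b).

Definition grad2 (x : V) := \sum_(j : B * 'I_N) phi1 j.1 j.2 x ^+ 2.
(** In each entry [j.2] is the direction of the outer derivative, the one that a difference quotient
    will replace. *)
Definition hess2 (x : V) := \sum_(j : B * 'I_N) \sum_i phi2 j.1 i j.2 x ^+ 2.

Lemma grad2_ge0 x : 0 <= grad2 x.
Proof. by apply: sumr_ge0 => j _; exact: sqr_ge0. Qed.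

Lemma hess2_ge0 x : 0 <= hess2 x.
Proof. by apply: sumr_ge0 => j _; apply: sumr_ge0 => i _; exact: sqr_ge0. Qed.

Lemma continuous_sqr_at (g : V -> R) x : {for x, continuous g} ->
  {for x, continuous (fun y => g y ^+ 2)}.
Proof. by move=> cg; exact: (continuousM cg cg). Qed.

Lemma hess2_cont x : enorm x < 1 -> {for x, continuous hess2}.
Proof.
move=> x1; apply: continuous_at_sum => j; apply: continuous_at_sum => i.
apply: continuous_sqr_at; have [_ /(_ i x x1)[_]] := phiJ j.1; exact.
Qed.

Lemma grad2_cont x : enorm x < 1 -> {for x, continuous grad2}.
Proof.
move=> x1; apply: continuous_at_sum => j; apply: continuous_sqr_at.
by have [/(_ x x1)[_ c1] _] := phiJ j.1; exact: c1.
Qed.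

Lemma sphere_continuous_powR (g : V -> R) (s q : R) : 1 <= q -> `|s| < 1 ->
  (forall x, 0 <= g x) -> (forall x, enorm x < 1 -> {for x, continuous g}) ->
  P.-integrable setT (EFin \o (fun t => g (s *: Z t) `^ q)).
Proof.
move=> q1 s1 g0 cg.
have cgs : sphere_continuous (fun z => g (s *: z)) by exact: (sphere_continuous_scale s1 cg).
have [M M0 gM] := sphere_bounded cgs.
apply: (integrable_bounded P1 (M := M `^ q)).
  exact: (measurableT_comp (measurable_powR _) (measurable_sphere mZ Z1 cgs)).
move=> t; rewrite ger0_norm ?powR_ge0//; apply: ge0_ler_powR; rewrite ?nnegrE//.
  exact: le_trans ler01 q1.
exact: le_trans (ler_norm _) (gM _ (Z1 t)).
Qed.

(** [subharmonic_estimate] is applied to the difference quotients of all [phi b] in all directions.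
    Up to [del], uniformly on the closed ball of radius [r], their squares sum to [grad2] and the
    squares of their gradients to [hess2]; shift invariance of the equation gives the same [cb]. *)
Lemma gradient_mean_estimate (c q r K om1 : R) (cb : B -> R) (Om Om2 W : R -> R) :
  1 <= q -> 0 < r < 1 -> 0 <= c -> (forall b, 0 <= cb b <= c) ->
  (forall b x, enorm x < 1 -> \sum_i phi2 b i i x = cb b * phi b x) ->
  0 < K -> (forall s, 0 <= s <= r -> 0 < Om s /\ (1 - s) * Om s <= om1) ->
  Om2 0 = 0 -> (forall s : R, 0 <= s <= r -> is_derive s 1 Om2 (Om s ^+ 2)) ->
  W 0 = 0 -> (forall s : R, 0 <= s <= r -> is_derive s 1 W (Om s)) ->
  (forall s, 0 < s < r ->
    smean (fun z => (hess2 (s *: z) / 4) `^ q) <= (K * Om s) `^ (2 * q)) ->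
  0 <= 1 - 2 * q * c * r ^+ 2 / (2 * N%:R) ->
  (1 - 2 * q * c * r ^+ 2 / (2 * N%:R)) * smean (fun z => grad2 (r *: z) `^ q) `^ q^-1 <=
  grad2 0 + 2 * q * (2 * q - 1) * (4 * K ^+ 2 * om1 * W r).
Proof.
have aux (a b s : R) : a - b <= s -> s + a <= b + 2 * s by lra.
move=> q1 /andP[r0 r1] c0 hcb hlap K0 hOm O20 dO2 W0 dW hmean coef0.
have q0 : 0 < q by exact: lt_le_trans ltr01 q1.
apply/ler_addgt0Pr => e e0.
(* The coefficient of [del] in [subharmonic_estimate]. Replacing the value at 0 by [grad2 0] costs
   another [2 * del], so [del = e / (2 + X)] makes the total error [e]. *)
pose X := 2 * q * (2 * q - 1) * (r ^+ 2 / (2 * N%:R)).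
have q2 : 1 <= 2 * q by rewrite mulr_natl mulr2n ler_wpDr// ltW.
have X0 : 0 <= X.
  apply: mulr_ge0; last by rewrite divr_ge0 ?sqr_ge0// mulr_ge0.
  by apply: mulr_ge0; [exact: le_trans ler01 q2|rewrite subr_ge0].
have X2 : 0 < 2 + X by rewrite ltr_wpDr.
pose del := e / (2 + X).
have del0 : 0 < del by rewrite divr_gt0.
pose J := (B * 'I_N)%type.
(* More than the number of squares in either sum, so an error [del / m] in each square adds up to at
   most [del]. *)
pose m : R := (#|{: J}| + #|{: J * 'I_N}|).+1%:R.
have m0 : 0 < m by rewrite ltr0n.
have dm0 : 0 < del / m by rewrite divr_gt0.
pose rho := (1 + r) / 2.
have [rrho rho1] : r < rho /\ rho < 1 by rewrite /rho; split; lra.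
have phiJ1 b : C1jet 1 (phi b) (phi1 b) by have [] := phiJ b.
have phiJ2 b i : C1jet 1 (phi1 b i) (phi2 b i) by have [_] := phiJ b; exact.
have fall (I : finType) (Q : I -> R -> Prop) :
    (forall i, \forall h \near (0 : R), Q i h) -> \forall h \near (0 : R), forall i, Q i h.
  by move=> H; exact: (filter_forall (@nbhs_filter R^o (0 : R)) H).
have : \forall h \near (0 : R), h != 0 ->
    (forall (j : J) x, enorm x <= r ->
       `|diffq h j.2 (phi j.1) x ^+ 2 - phi1 j.1 j.2 x ^+ 2| <= del / m) /\
    (forall (ji : J * 'I_N) x, enorm x <= r ->
       `|diffq h ji.1.2 (phi1 ji.1.1 ji.2) x ^+ 2 - phi2 ji.1.1 ji.2 ji.1.2 x ^+ 2| <= del / m).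
  have n1 : \forall h \near (0 : R), forall j : J, h != 0 -> forall x, enorm x <= r ->
       `|diffq h j.2 (phi j.1) x ^+ 2 - phi1 j.1 j.2 x ^+ 2| <= del / m.
    by apply: fall => j; exact: (diffq_sqr_uniform j.2 r1 dm0 (phiJ1 j.1)).
  have n2 : \forall h \near (0 : R), forall ji : J * 'I_N, h != 0 -> forall x, enorm x <= r ->
       `|diffq h ji.1.2 (phi1 ji.1.1 ji.2) x ^+ 2 - phi2 ji.1.1 ji.2 ji.1.2 x ^+ 2| <= del / m.
    by apply: fall => ji; exact: (diffq_sqr_uniform ji.1.2 r1 dm0 (phiJ2 ji.1.1 ji.2)).
  near=> h => h0; split.
    by move=> j; move: j h0; near: h; exact: n1.
  by move=> j; move: j h0; near: h; exact: n2.
move=> /nbhs_ballP[eta /= eta0 etaP].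
(* Small enough for the approximation, and such that points of the ball of radius [rho] stay in the
   unit ball after the shift. *)
pose h := Num.min (eta / 2) (1 - rho).
have h0 : 0 < h by rewrite lt_min divr_gt0// subr_gt0.
have hrho : rho + `|h| <= 1.
  by rewrite ger0_norm ?(ltW h0)// addrC -lerBrDr ge_min lexx orbT.
have heta : ball 0 eta h.
  rewrite -ball_normE /ball_ /= sub0r normrN ger0_norm ?(ltW h0)//.
  have le2 : h <= eta / 2 by rewrite ge_min lexx.
  by apply: (le_lt_trans le2); rewrite ltr_pdivrMr// ltr_pMr// ltr1n.
have [A1 A2] := etaP h heta (lt0r_neq0 h0).
pose u (j : J) := diffq h j.2 (phi j.1).
pose u1 (j : J) i := diffq h j.2 (phi1 j.1 i).
pose u2 (j : J) i l := diffq h j.2 (phi2 j.1 i l).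
have uJ j : C2jet rho (u j) (u1 j) (u2 j).
  by split=> [|i]; exact: C1jet_diffq.
have ulap j x : enorm x < rho -> \sum_i u2 j i i x = cb j.1 * u j x.
  move=> xr; have x1 : enorm x < 1 by exact: lt_trans rho1.
  have hx : enorm (h *: delta_mx 0 j.2 + x) < 1.
    apply: (le_lt_trans (enorm_triangle _ _)); rewrite enormZ enorm_delta mulr1.
    by apply: lt_le_trans hrho; rewrite addrC ltrD2r.
  rewrite /u2 /u /diffq -mulr_sumr sumrB !hlap//; ring.
have bigm (c1 c2 : nat) : (c1 + c2).+1 = (#|{: J}| + #|{: J * 'I_N}|).+1 ->
    c1%:R * (del / m) <= del /\ c2%:R * (del / m) <= del.
  move=> E; have mE : m = c1%:R + c2%:R + 1 by rewrite /m -E -natr1 natrD.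
  split; rewrite mulrCA ler_piMr ?(ltW del0)// ler_pdivrMr// mul1r mE.
    by rewrite -addrA lerDl addr_ge0.
  by rewrite addrC addrA lerDr addr_ge0.
have [b1 b2] := bigm _ _ erefl.
have S1 x : enorm x <= r -> `|\sum_j u j x ^+ 2 - grad2 x| <= del.
  move=> xr; rewrite /grad2 -sumrB; apply: (le_trans (ler_norm_sum _ _ _)).
  apply: le_trans b1; rewrite mulr_natl -sumr_const.
  by apply: ler_sum => j _; exact: A1.
have S2 x : enorm x <= r -> gradsq u1 x <= hess2 x + del.
  move=> xr; rewrite -lerBlDl; apply: (le_trans (ler_norm _)).
  rewrite /hess2 /gradsq -sumrB.
  under eq_bigr do rewrite -sumrB.
  rewrite pair_bigA /=; apply: (le_trans (ler_norm_sum _ _ _)).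
  apply: le_trans b2; rewrite mulr_natl -sumr_const.
  by apply: ler_sum => ji _; exact: A2.
have hg0 x : 0 <= hess2 x / 4 by rewrite divr_ge0// hess2_ge0.
have hgc x : enorm x < rho -> {for x, continuous (fun y => hess2 y / 4)}.
  move=> xr; apply: (@continuousM _ _ hess2 (fun=> 4^-1)); last exact: cst_continuous.
  by apply: hess2_cont; exact: lt_trans rho1.
have hgb x : enorm x <= r -> gradsq u1 x <= 4 * (hess2 x / 4) + del.
  by move=> /S2; rewrite mulrC divfK.
have := @subharmonic_estimate R n n0 d T P Z P1 mZ Z1 J rho del q r del0 q1 r0 rrho r1
  u u1 u2 c del K om1 (fun j => cb j.1) (fun x => hess2 x / 4) Om Om2 W divZ uJ c0
  (fun j => hcb j.1) ulap hg0 hgc (ltW del0) hgb K0 hOm O20 dO2 W0 dW hmean.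
set M := smean _; set M' := smean _ => key.
(* [grad2 <= del + |u|^2] on this sphere: the regularizing constant also absorbs the approximation
   error. *)
have MM : M' <= M.
  have sr : `|r| < rho by rewrite ger0_norm// ltW.
  have sr1 : `|r| < 1 by rewrite ger0_norm// ltW.
  apply: le_Rintegral => //.
  - exact: (sphere_continuous_powR q1 sr1 grad2_ge0 grad2_cont).
  - apply: (integrable_sphere P1 mZ Z1 (h := fun z => sqsum del u (r *: z) `^ q)).
    have uJ1 j : C1jet rho (u j) (u1 j) by have [] := uJ j.
    exact: (sphere_continuous_sqpow del0 uJ1 sr).
  - move=> t _; apply: ge0_ler_powR; rewrite ?nnegrE.
    + exact: ltW.
    + exact: grad2_ge0.
    + by apply/ltW/sqsum_gt0.
    + have : enorm (r *: Z t) <= r by rewrite enormZ Z1 mulr1 ger0_norm// ltW.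
      move=> /S1; rewrite distrC => /(le_trans (ler_norm _)).
      by rewrite /sqsum lerBlDr.
have M'0 : 0 <= M' by apply: Rintegral_ge0 => t _; exact: powR_ge0.
have MM' : M' `^ q^-1 <= M `^ q^-1.
  have qV0 : 0 <= q^-1 by rewrite invr_ge0 ltW.
  exact: (ge0_ler_powR qV0 M'0 (le_trans M'0 MM) MM).
apply: (le_trans (ler_wpM2l coef0 MM')); apply: (le_trans key).
have w0le : sqsum del u 0 <= grad2 0 + 2 * del.
  have : enorm (0 : V) <= r by rewrite enorm0 ltW.
  by move=> /S1 /(le_trans (ler_norm _)); exact: aux.
have eE : e = 2 * del + X * del by rewrite -mulrDl mulrC divfK// gt_eqF.
have -> : 2 * q * (2 * q - 1) * (4 * K ^+ 2 * om1 * W r + del * r ^+ 2 / (2 * N%:R)) =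
   2 * q * (2 * q - 1) * (4 * K ^+ 2 * om1 * W r) + X * del by rewrite /X; ring.
rewrite eE; apply: (le_trans (lerD w0le (lexx _))).
by rewrite le_eqVlt; apply/orP; left; apply/eqP; ring.
Unshelve. all: by end_near. Qed.

End gradient_means.

(** * From Wirtinger derivatives to real partials *)

Section complex_gradient.
Variables (R : realType) (n : nat).
Local Notation N := (n + n)%N.
Local Notation V := 'rV[R]_N.
Variable f : V -> R * R.

Definition part (b : bool) (x : V) : R := if b then (f x).1 else (f x).2.
Definition part1 b (i : 'I_N) : V -> R := pd i (part b).
Definition part2 b (i j : 'I_N) : V -> R := pd j (part1 b i).

Let wirtinger_sqr (a b c e : R) :
  cabs2 ((a + e) / 2, (c - b) / 2) + cabs2 ((a - e) / 2, (c + b) / 2) =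
  (a ^+ 2 + b ^+ 2 + (c ^+ 2 + e ^+ 2)) / 2.
Proof. by rewrite /cabs2 /=; field. Qed.

Let wirtinger_sqr_dz k x (g : V -> R * R) :
  cabs2 (dz k g x) + cabs2 (dzb k g x) =
  (dx k (fun y => (g y).1) x ^+ 2 + dy k (fun y => (g y).1) x ^+ 2 +
   (dx k (fun y => (g y).2) x ^+ 2 + dy k (fun y => (g y).2) x ^+ 2)) / 2.
Proof. exact: wirtinger_sqr. Qed.

(** The parallelogram identity for [f_z] and [f_zbar]. It is algebra in the real partials, so it
    holds at every point. *)
Lemma sqr_normDf x : normDf f x ^+ 2 = grad2 part1 x / 2.
Proof.
rewrite sqr_sqrtr; last first.
  by apply: sumr_ge0 => k _; rewrite /cabs2 !addr_ge0 ?sqr_ge0.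
rewrite /grad2 -(pair_bigA _ (fun b i => part1 b i x ^+ 2)) /= big_bool /=.
rewrite !big_split_ord /= -!big_split /= mulr_suml.
by apply: eq_bigr => k _; rewrite wirtinger_sqr_dz.
Qed.

Hypothesis fC2 : cC2_on (@unit_ball R n) f.

Let part_C2 b : C2_on (@unit_ball R n) (part b).
Proof. by case: fC2 => f1 f2; case: b; [exact: f1|exact: f2]. Qed.

Lemma part_jet b : C2jet 1 (part b) (part1 b) (part2 b).
Proof. exact: (C2_on_jet (part_C2 b)). Qed.

Let pd_half (s : R) i (g h : V -> R) x : derivable g x (delta_mx 0 i) ->
  derivable h x (delta_mx 0 i) ->
  pd i (fun y => (g y + s * h y) / 2) x = (pd i g x + s * pd i h x) / 2.
Proof.
move=> dg dh.
have -> : (fun y => (g y + s * h y) / 2) = 2^-1 \*: (g + s \*: h).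
  by apply/funext => y /=; rewrite mulrC.
have dsh : derivable (s \*: h) x (delta_mx 0 i) by exact: derivableZ.
by rewrite /pd deriveZ; [rewrite deriveD// deriveZ//= mulrC|exact: derivableD].
Qed.

Let dpart b i j x : enorm x < 1 -> derivable (part1 b i) x (delta_mx 0 j).
Proof.
by move=> x1; have [_ [_ [_ [d2 _]]]] := part_C2 b; exact: (d2 i j x x1).
Qed.

Let pd_dz b i k x : enorm x < 1 ->
  pd i (fun y => if b then (dz k f y).1 else (dz k f y).2) x =
  (part2 b (lshift n k) i x + (if b then 1 else -1) * part2 (~~ b) (rshift n k) i x) / 2.
Proof.
move=> x1; rewrite /part2.
rewrite -[RHS](pd_half (if b then 1 else -1) (@dpart b (lshift n k) i x x1)
  (@dpart (~~ b) (rshift n k) i x x1)).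
by case: b => /=; congr (pd i _ x); apply/funext => y; rewrite ?mul1r ?mulN1r.
Qed.

Let pd_dzb b i k x : enorm x < 1 ->
  pd i (fun y => if b then (dzb k f y).1 else (dzb k f y).2) x =
  (part2 b (lshift n k) i x + (if b then -1 else 1) * part2 (~~ b) (rshift n k) i x) / 2.
Proof.
move=> x1; rewrite /part2.
rewrite -[RHS](pd_half (if b then -1 else 1) (@dpart b (lshift n k) i x x1)
  (@dpart (~~ b) (rshift n k) i x x1)).
by case: b => /=; congr (pd i _ x); apply/funext => y; rewrite ?mul1r ?mulN1r.
Qed.

Let pd_wirtinger i k x : enorm x < 1 ->
  [/\ pd i (fun y => (dz k f y).1) x =
      (part2 true (lshift n k) i x + part2 false (rshift n k) i x) / 2,
    pd i (fun y => (dz k f y).2) x =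
      (part2 false (lshift n k) i x - part2 true (rshift n k) i x) / 2,
    pd i (fun y => (dzb k f y).1) x =
      (part2 true (lshift n k) i x - part2 false (rshift n k) i x) / 2 &
    pd i (fun y => (dzb k f y).2) x =
      (part2 false (lshift n k) i x + part2 true (rshift n k) i x) / 2].
Proof.
move=> x1; split.
- by have := @pd_dz true i k x x1; rewrite mul1r.
- by have := @pd_dz false i k x x1; rewrite mulN1r.
- by have := @pd_dzb true i k x x1; rewrite mulN1r.
- by have := @pd_dzb false i k x x1; rewrite mul1r.
Qed.

Let hessian_sqr (a1 b1 c1 e1 a2 b2 c2 e2 : R) :
  (((a1 + e1) / 2) ^+ 2 + ((a2 + e2) / 2) ^+ 2 +
   (((c1 - b1) / 2) ^+ 2 + ((c2 - b2) / 2) ^+ 2)) / 2 +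
  (((a1 - e1) / 2) ^+ 2 + ((a2 - e2) / 2) ^+ 2 +
   (((c1 + b1) / 2) ^+ 2 + ((c2 + b2) / 2) ^+ 2)) / 2 =
  (a1 ^+ 2 + b1 ^+ 2 + (a2 ^+ 2 + b2 ^+ 2) +
   (c1 ^+ 2 + e1 ^+ 2 + (c2 ^+ 2 + e2 ^+ 2))) / 4.
Proof. by field. Qed.

Let laplacian_re (a x b : R) : 4 * (((a - x) / 2 + (x + b) / 2) / 2) = a + b.
Proof. by field. Qed.

Let laplacian_im (a x b : R) : 4 * (((a + x) / 2 - (x - b) / 2) / 2) = a + b.
Proof. by field. Qed.

Let sum_halves (s : 'I_N -> R) :
  \sum_i s i = \sum_(k < n) (s (lshift n k) + s (rshift n k)).
Proof. by rewrite big_split_ord /= -big_split. Qed.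

Let sum_blocks (s : 'I_N -> 'I_N -> R) :
  \sum_l \sum_i s i l ^+ 2 = \sum_(j < n) \sum_(k < n)
    (s (lshift n k) (lshift n j) ^+ 2 + s (rshift n k) (lshift n j) ^+ 2 +
     (s (lshift n k) (rshift n j) ^+ 2 + s (rshift n k) (rshift n j) ^+ 2)).
Proof.
have Es (l : 'I_N) : \sum_i s i l ^+ 2 =
    \sum_(k < n) (s (lshift n k) l ^+ 2 + s (rshift n k) l ^+ 2).
  by rewrite big_split_ord /= -big_split.
rewrite big_split_ord /= -big_split /=; apply: eq_bigr => j _.
by rewrite !Es -big_split.
Qed.

(** The parallelogram identity once for each of the two differentiations, hence the factor 1/4. The
    point must lie in the ball so that the real partials can be differentiated termwise. *)
Lemma sqr_Dstar x : enorm x < 1 -> Dstar f x ^+ 2 = hess2 part2 x / 4.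
Proof.
move=> x1; rewrite sqr_sqrtr; last first.
  by do 2![apply: sumr_ge0 => ? _]; rewrite /cabs2 !addr_ge0 ?sqr_ge0.
rewrite /hess2 -(pair_bigA _ (fun b l => \sum_i part2 b i l x ^+ 2)) /= big_bool /=.
rewrite [X in (X + _) / _](sum_blocks (fun i l => part2 true i l x)).
rewrite [X in (_ + X) / _](sum_blocks (fun i l => part2 false i l x)).
rewrite -big_split /= mulr_suml; apply: eq_bigr => j _.
rewrite -big_split /= mulr_suml; apply: eq_bigr => k _.
rewrite -addrA !wirtinger_sqr_dz /dx /dy.
have [-> -> -> ->] := pd_wirtinger (lshift n j) k x1.
have [-> -> -> ->] := pd_wirtinger (rshift n j) k x1.
exact: hessian_sqr.
Qed.

(** In [dz (dzb f)] the mixed partials of the other component occur with opposite signs and cancel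
    by symmetry. *)
Lemma lap_part x : enorm x < 1 ->
  lap f x = (\sum_i part2 true i i x, \sum_i part2 false i i x).
Proof.
move=> x1; rewrite /lap !mulr_sumr; congr (_, _).
all: rewrite sum_halves; apply: eq_bigr => k _; rewrite /dz /= /dx /dy;
  have [_ _ e1 e2] := pd_wirtinger (lshift n k) k x1;
  have [_ _ e3 e4] := pd_wirtinger (rshift n k) k x1.
- rewrite e1 e4 (mixed_partials (rshift n k) (lshift n k) (part_jet false) x1).
  exact: laplacian_re.
- rewrite e2 e3 (mixed_partials (rshift n k) (lshift n k) (part_jet true) x1).
  exact: laplacian_im.
Qed.

End complex_gradient.

(** * Majorants and the primitives of [omega (1 / (1 - s))] *)

Section majorants.
Variables (R : realType) (omega : R -> R).
Hypothesis om : majorant omega.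
Local Notation Om := (fun s : R => omega (1 / (1 - s))).

Lemma majorant_gt0 t : 0 < t -> 0 < omega t.
Proof. by case: om => _ inc o0 _ _ t0; rewrite -o0; exact: inc. Qed.

Lemma majorant_Om_gt0 s : s < 1 -> 0 < Om s.
Proof. by move=> s1; apply: majorant_gt0; rewrite divr_gt0// subr_gt0. Qed.

(** Monotonicity of [omega t / t] between 1 and [1 / (1 - s)]. *)
Lemma majorant_Om_le s : 0 <= s < 1 -> (1 - s) * Om s <= omega 1.
Proof.
move=> /andP[s0 s1]; have d0 : 0 < 1 - s by rewrite subr_gt0.
have t1 : 1 <= 1 / (1 - s) by rewrite ler_pdivlMr// mul1r lerBlDr lerDl.
case: om => _ _ _ _ /(_ 1 (1 / (1 - s)) ltr01 t1).
by rewrite !div1r invrK invr1 mulr1 mulrC.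
Qed.

Lemma majorant_continuous t : 0 < t -> {for t, continuous omega}.
Proof.
move=> t0; case: om => com _ _ _ _.
have co : {within [set u : R | 0 < u], continuous omega}.
  by apply: continuous_subspaceW com => u /=; exact: ltW.
move: co; rewrite continuous_open_subspace; last exact: open_gt.
by move=> /(_ t); apply; rewrite inE.
Qed.

Lemma majorant_Om_continuous s : s < 1 -> {for s, continuous Om}.
Proof.
move=> s1; have d0 : 0 < 1 - s by rewrite subr_gt0.
have cd : {for s, continuous (fun u : R => 1 - u)}.
  by apply: continuousB; [exact: cst_continuous|exact: cvg_id].
have cV : {for s, continuous (fun u : R => 1 / (1 - u))}.
  apply: continuousM; first exact: cst_continuous.
  by apply: continuousV => //; exact: lt0r_neq0.
apply: (@continuous_comp _ _ _ (fun u : R => 1 / (1 - u)) omega s) => //.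
by apply: majorant_continuous; rewrite divr_gt0.
Qed.

Lemma majorant_primitives r : 0 < r < 1 -> exists Om2 W : R -> R,
  [/\ Om2 0 = 0, (forall s : R, `|s| <= r -> is_derive s 1 Om2 (Om s ^+ 2)),
      W 0 = 0 & forall s : R, `|s| <= r -> is_derive s 1 W (Om s)].
Proof.
move=> /andP[r0 r1].
have [rc c1] : r < (1 + r) / 2 /\ (1 + r) / 2 < 1 by split; lra.
have c0 := lt_trans r0 rc.
have lt1 (s : R) : `|s| <= (1 + r) / 2 -> s < 1.
  by move=> h; apply: le_lt_trans c1; exact: le_trans (ler_norm s) h.
have c2 (s : R) : `|s| <= (1 + r) / 2 -> {for s, continuous (fun u : R => Om u ^+ 2)}.
  by move=> /lt1/majorant_Om_continuous cs; exact: (continuousM cs cs).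
have [Om2 z2 d2] := primitive_exists c0 c2.
have [W zW dW] := primitive_exists c0 (fun s sc => majorant_Om_continuous (lt1 s sc)).
by exists Om2, W; split=> // s sr; [apply: d2|apply: dW]; exact: le_lt_trans rc.
Qed.

(** On [[0, r]] the integrand is at most [omega 1 / (1 - s) <= omega 1 / (1 - r)]. This crude bound
    is what gives the growth [(1 - r) ^ (-1/2)] of the gradient. *)
Lemma primitive_majorant_le (W : R -> R) r : 0 < r < 1 -> W 0 = 0 ->
  (forall s : R, `|s| <= r -> is_derive s 1 W (Om s)) ->
  W r / r <= omega 1 / (1 - r).
Proof.
move=> /andP[r0 r1] W0 dW.
have o1 : 0 < omega 1 by exact: majorant_gt0.
have d0 : 0 < 1 - r by rewrite subr_gt0.
have rin (s : R) : 0 <= s <= r -> `|s| <= r by case/andP => s0 sr; rewrite ger0_norm.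
have dG (s : R) : 0 <= s <= r ->
    is_derive s 1 (fun u : R => omega 1 / (1 - r) * u - W u) (omega 1 / (1 - r) - Om s).
  move=> sr; have dWs := dW s (rin s sr).
  have dL : is_derive s 1 (fun u : R => omega 1 / (1 - r) * u) (omega 1 / (1 - r)).
    have := @is_deriveZ _ _ _ (id : R -> R) (omega 1 / (1 - r)) s 1 1 (is_derive_id _ _).
    by rewrite /GRing.scale /= mulr1.
  exact: (is_deriveB dL dWs).
have := @derive_ge0_le R (fun u : R => omega 1 / (1 - r) * u - W u)
  (fun s => omega 1 / (1 - r) - Om s) 0 r (ltW r0).
rewrite mulr0 W0 subr0 subr_ge0 => H.
have : W r <= omega 1 / (1 - r) * r.
  apply: H => s.
  - by move=> /andP[s0 sr]; apply: dG; rewrite !ltW.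
  - move=> /andP[s0 sr]; rewrite subr_ge0 ler_pdivlMr// mulrC.
    have s1 : s < 1 by exact: lt_trans r1.
    apply: le_trans (majorant_Om_le (s := s) _); last by rewrite (ltW s0) s1.
    by rewrite ler_wpM2r ?(ltW (majorant_Om_gt0 s1))// lerD2l lerN2 ltW.
  - by move=> sr; exact: (is_derive_continuous (dG s sr)).
by rewrite ler_pdivrMr.
Qed.

(** The substitution [s = r t], done by differentiating [W (r t) / r]. *)
Lemma integral_majorant (W : R -> R) r : 0 < r < 1 -> W 0 = 0 ->
  (forall s : R, `|s| <= r -> is_derive s 1 W (Om s)) ->
  (\int[@lebesgue_measure R]_(t in `[0%R, 1%R]) (omega (1 / (1 - r * t)))%:E)%E =
  (W r / r)%:E.
Proof.
move=> /andP[r0 r1] W0 dW.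
have rt (t : R) : 0 <= t <= 1 -> `|r * t| <= r.
  move=> /andP[t0 t1]; rewrite ger0_norm ?mulr_ge0 ?(ltW r0)//.
  by rewrite ler_piMr// ltW.
have dF (t : R) : 0 <= t <= 1 ->
    is_derive t 1 (fun u : R => W (r * u) / r) (omega (1 / (1 - r * t))).
  move=> t01.
  have dL : is_derive t 1 (fun u : R => r * u) r.
    have := @is_deriveZ _ _ _ (id : R -> R) r t 1 1 (is_derive_id _ _).
    by rewrite /GRing.scale /= mulr1.
  have dc := @is_derive1_comp R W (fun u : R => r * u) t _ _ (dW _ (rt t t01)) dL.
  have -> : (fun u : R => W (r * u) / r) = r^-1 \*: (W \o (fun u : R => r * u)).
    by apply/funext => u /=; rewrite mulrC.
  apply: (is_derive_eq (is_deriveZ r^-1 dc)).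
  by rewrite /GRing.scale /= mulrCA mulVf ?gt_eqF// mulr1.
have cF (t : R) : 0 <= t <= 1 -> {for t, continuous (fun u : R => W (r * u) / r)}.
  by move=> t01; exact: (is_derive_continuous (dF t t01)).
rewrite (@continuous_FTC2 R _ (fun u : R => W (r * u) / r) 0 1 ltr01).
- by rewrite mulr1 mulr0 W0 mul0r sube0.
- apply: continuous_in_subspaceT => t; rewrite inE/= in_itv/= => t01.
  have cr : {for t, continuous (fun u : R => r * u)}.
    by apply: continuousM; [exact: cst_continuous|exact: cvg_id].
  have rt1 : r * t < 1.
    by apply: le_lt_trans r1; exact: le_trans (ler_norm _) (rt t t01).
  exact: (@continuous_comp _ _ _ (fun u : R => r * u) Om t cr (majorant_Om_continuous rt1)).
- split.
  + by move=> t; rewrite in_itv/= => /andP[t0 t1]; have [] := dF t; rewrite ?(ltW t0) ?(ltW t1).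
  + by apply: cvg_at_right_filter; apply: cF; rewrite lexx ler01.
  + by apply: cvg_at_left_filter; apply: cF; rewrite lexx ler01.
- move=> t; rewrite in_itv/= => /andP[t0 t1].
  have t01 : 0 <= t <= 1 by rewrite !ltW.
  by rewrite derive1E; have [_ ->] := dF t t01.
Qed.

Lemma primitive_majorant_ge0 (W : R -> R) r : 0 < r < 1 -> W 0 = 0 ->
  (forall s : R, `|s| <= r -> is_derive s 1 W (Om s)) -> 0 <= W r.
Proof.
move=> r01 W0 dW; have /andP[r0 r1] := r01.
have : (0 <= (W r / r)%:E)%E.
  rewrite -(integral_majorant r01 W0 dW); apply: integral_ge0 => t.
  rewrite /= in_itv/= => /andP[t0 t1]; rewrite lee_fin ltW// majorant_Om_gt0//.
  by apply: le_lt_trans r1; rewrite ler_piMr// ltW.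
by rewrite lee_fin pmulr_lge0// invr_gt0.
Qed.

End majorants.

(** * [Mp] in terms of means over [P] *)

Section power_means.
Variables (R : realType) (n : nat).
Local Notation N := (n + n)%N.
Local Notation V := 'rV[R]_N.
Variables (d : measure_display) (T : measurableType d).
Variables (P : {measure set T -> \bar R}) (Z : T -> V).
Hypothesis P1 : P setT = 1%E.
Hypothesis mZ : forall i, measurable_fun setT (fun t => Z t 0 i).
Hypothesis Z1 : forall t, enorm (Z t) = 1.
Hypothesis intZ : forall h : V -> R, (forall x, 0 <= h x) ->
  measurable_fun setT (fun t => h (Z t)) ->
  sphere_int (fun x => (h x)%:E) = (\int[P]_t (h (Z t))%:E)%E.
Local Notation smean := (mean P Z).

(** The quantities of interest are square roots whose squares have convenient continuous expressions
    [G] in the ball. Passing to [G] at exponent [p / 2] yields measurability, and finiteness of the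
    mean. *)
Lemma Mp_sqr (p r : R) (g G : V -> R) : 2 <= p -> 0 < r < 1 ->
  (forall x, 0 <= g x) -> (forall x, 0 <= G x) ->
  (forall x, enorm x < 1 -> {for x, continuous G}) ->
  (forall x, enorm x < 1 -> g x ^+ 2 = G x) ->
  Mp p r g = (smean (fun z => G (r *: z) `^ (p / 2)) `^ p^-1)%:E.
Proof.
move=> p2 /andP[r0 r1] g0 G0 cG gG.
have q1 : 1 <= p / 2 by rewrite ler_pdivlMr// mul1r.
have nr : `|r| < 1 by rewrite ger0_norm ?ltW.
have iG := sphere_continuous_powR P1 mZ Z1 q1 nr G0 cG.
have gE t : g (r *: Z t) `^ p = G (r *: Z t) `^ (p / 2).
  rewrite -gG; last by rewrite enormZ Z1 mulr1.
  rewrite -[in RHS](powR_mulrn 2 (g0 _)) -powRrM mulrC divfK// pnatr_eq0.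
have E : (fun t : T => g (r *: Z t) `^ p) = (fun t : T => G (r *: Z t) `^ (p / 2)).
  exact: funext gE.
rewrite /Mp intZ; [|by move=> x; exact: powR_ge0|]; last first.
  by rewrite E; apply/measurable_EFinP; have := measurable_int P iG.
under eq_integral do rewrite gE.
by rewrite -(fineK (integrable_fin_num measurableT iG)) poweR_EFin.
Qed.

Lemma smean_powR_half (q r : R) (G : V -> R) : 1 <= q -> 0 < r < 1 ->
  (forall x, 0 <= G x) -> (forall x, enorm x < 1 -> {for x, continuous G}) ->
  smean (fun z => (G (r *: z) / 2) `^ q) `^ q^-1 =
  smean (fun z => G (r *: z) `^ q) `^ q^-1 / 2.
Proof.
move=> q1 /andP[r0 r1] G0 cG.
have nr : `|r| < 1 by rewrite ger0_norm ?ltW.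
have iG := sphere_continuous_powR P1 mZ Z1 q1 nr G0 cG.
have q0 : q != 0 by rewrite gt_eqF// (lt_le_trans ltr01).
have -> : smean (fun z => (G (r *: z) / 2) `^ q) =
    2^-1 `^ q * smean (fun z => G (r *: z) `^ q).
  rewrite /mean -RintegralZl//; apply: eq_Rintegral => t _.
  by rewrite mulrC powRM// invr_ge0.
rewrite powRM ?powR_ge0//; last by apply: Rintegral_ge0 => t _; exact: powR_ge0.
by rewrite -powRrM mulfV// powRr1 ?invr_ge0// mulrC.
Qed.

Lemma powR_root_le (m a s : R) : 0 <= m -> 0 < s -> m `^ s^-1 <= a -> m <= a `^ s.
Proof.
move=> m0 s0 ma.
have -> : m = (m `^ s^-1) `^ s by rewrite -powRrM mulVf ?gt_eqF// powRr1.
have a0 : 0 <= a by apply: le_trans ma; exact: powR_ge0.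
by apply: (ge0_ler_powR (ltW s0)) => //; rewrite nnegrE ?powR_ge0.
Qed.

End power_means.

(** * The constants of the theorem *)

Section theorem_estimates.
Variables (R : realType) (n : nat) (p : R) (omega : R -> R) (tau eta Mstar : R).
Variable f : 'rV[R]_(n + n) -> R * R.
Local Notation N := (n + n)%N.
Local Notation V := 'rV[R]_N.
Hypotheses (n0 : (0 < n)%N) (p2 : 2 <= p) (om : majorant omega).
Hypotheses (tau0 : 0 <= tau) (eta0 : 0 <= eta) (hc : eta + tau < 4 * n%:R / p).
Hypothesis fC2 : cC2_on (@unit_ball R n) f.
Hypothesis flap : forall x, @unit_ball R n x ->
  lap f x = (tau * (f x).1 + eta * (f x).1, tau * (f x).2).
Hypothesis M0 : 0 < Mstar.
Hypothesis hD : forall r, 0 < r < 1 ->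
  (Mp p r (Dstar f) <= (Mstar * omega (1 / (1 - r)))%:E)%E.
Variables (d : measure_display) (T : measurableType d).
Variables (P : {measure set T -> \bar R}) (Z : T -> V).
Hypothesis P1 : P setT = 1%E.
Hypothesis mZ : forall i, measurable_fun setT (fun t => Z t 0 i).
Hypothesis Z1 : forall t, enorm (Z t) = 1.
Hypothesis intZ : forall h : V -> R, (forall x, 0 <= h x) ->
  measurable_fun setT (fun t => h (Z t)) ->
  sphere_int (fun x => (h x)%:E) = (\int[P]_t (h (Z t))%:E)%E.
Local Notation smean := (mean P Z).
Hypothesis divZ : forall (F : 'I_N -> V -> R) (F' : 'I_N -> 'I_N -> V -> R),
  (forall x, enorm x = 1 -> forall i,
    hasgrad (F i) (F' i ^~ x) x /\ forall j, {for x, continuous (F' i j)}) ->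
  (forall x, enorm x = 1 -> \sum_i x 0 i * F i x = 0) ->
  smean (tan_div F') = 0.

Local Notation lam := (p * (eta + tau) / (4 * n%:R)).
Local Notation b := (2 * p * (2 * p - 3) * Mstar ^+ 2 * omega 1).
Local Notation g2 := (grad2 (part1 f)).
Local Notation gmean r := (smean (fun z => g2 (r *: z) `^ (p / 2)) `^ (p / 2)^-1).

Let p0 : 0 < p. Proof. exact: lt_le_trans p2. Qed.

Let q1 : 1 <= p / 2. Proof. by rewrite ler_pdivlMr// mul1r. Qed.

Let p2K : 2 * (p / 2) = p. Proof. by rewrite mulrC divfK// pnatr_eq0. Qed.

Let g2c x : enorm x < 1 -> {for x, continuous g2}.
Proof. exact: (grad2_cont (part_jet fC2)). Qed.

Let lam_ge0 : 0 <= lam.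
Proof. by rewrite divr_ge0 ?mulr_ge0 ?addr_ge0// ltW. Qed.

Let lam_lt1 : lam < 1.
Proof.
have n4 : 0 < 4 * n%:R :> R by rewrite mulr_gt0// ltr0n.
by rewrite ltr_pdivrMr// mul1r mulrC -ltr_pdivlMr.
Qed.

Let b_ge0 : 0 <= b.
Proof.
rewrite mulr_ge0 ?(ltW (majorant_gt0 om ltr01))// mulr_ge0 ?sqr_ge0// mulr_ge0//.
  by rewrite mulr_ge0// ltW.
have := p2; lra.
Qed.

(** [s] stands for [r^2], [w] for [W r], and [v] for [W r / r]. The step loses [r^2 <= 1], [w <= v]
    and [p - 1 <= 2p - 3], the last being where [p >= 2] enters. *)
Let final_algebra (X l s F B w v : R) : 0 <= X -> 0 <= l -> s <= 1 -> 0 <= w -> w <= v ->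
  0 <= B -> (1 - l * s) * X <= 2 * F + p * (p - 1) * (4 * B * w) ->
  (1 - l) * (X / 2) <= F + 2 * p * (2 * p - 3) * B * v.
Proof.
move=> X0 l0 s1 w0 wv B0 H.
have h1 : l * X * s <= l * X * 1 by rewrite ler_wpM2l// mulr_ge0.
have h2 : p * (p - 1) * (B * w) <= p * (2 * p - 3) * (B * v).
  have pm : 0 <= p - 1 by have := p2; lra.
  apply: ler_pM; rewrite ?mulr_ge0 ?(ltW p0)//.
    by rewrite ler_pM2l//; have := p2; lra.
  exact: ler_wpM2l.
by move: h1 h2 H; lra.
Qed.

Lemma gradient_bound (W : R -> R) r : 0 < r < 1 -> W 0 = 0 ->
  (forall s : R, `|s| <= r -> is_derive s 1 W (omega (1 / (1 - s)))) ->
  (1 - lam) * (gmean r / 2) <= normDf f 0 ^+ 2 + b * (W r / r).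
Proof.
move=> r01 W0 dW; have /andP[r0 r1] := r01.
have [Om2 [_ [e20 d20 _ _]]] := majorant_primitives om r01.
have rin (s : R) : 0 <= s <= r -> `|s| <= r by case/andP => s0 sr; rewrite ger0_norm.
have c0 : 0 <= eta + tau by exact: addr_ge0.
(* The real part of [f] has eigenvalue [tau + eta], the imaginary part [tau]. *)
have hcb (b : bool) : 0 <= (if b then tau + eta else tau) <= eta + tau.
  by case: b; rewrite ?addr_ge0//= ?(addrC tau) ?lexx// tau0 lerDr.
have hlap (b : bool) (x : V) : enorm x < 1 ->
    \sum_i part2 f b i i x = (if b then tau + eta else tau) * part f b x.
  move=> x1; have := flap x1; rewrite lap_part// => -[e1 e2].
  by case: b; [rewrite e1 mulrDl|rewrite e2].
have hOm (s : R) : 0 <= s <= r ->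
    0 < omega (1 / (1 - s)) /\ (1 - s) * omega (1 / (1 - s)) <= omega 1.
  move=> /andP[s0 sr]; have s1 := le_lt_trans sr r1.
  by split; [exact: majorant_Om_gt0|apply: majorant_Om_le; rewrite // s0 s1].
have hmean (s : R) : 0 < s < r ->
    smean (fun z => (hess2 (part2 f) (s *: z) / 4) `^ (p / 2)) <=
    (Mstar * omega (1 / (1 - s))) `^ (2 * (p / 2)).
  move=> /andP[s0 sr]; have s01 : 0 < s < 1 by rewrite s0 (lt_trans sr).
  have := hD s01.
  have cH (x : V) : enorm x < 1 -> {for x, continuous (fun y => hess2 (part2 f) y / 4)}.
    move=> x1; apply: (@continuousM _ _ (hess2 (part2 f)) (fun=> 4^-1)).
      exact: (hess2_cont (part_jet fC2) x1).
    exact: cst_continuous.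
  rewrite (Mp_sqr P1 mZ Z1 intZ p2 s01 (G := fun x => hess2 (part2 f) x / 4) _ _ cH).
  - rewrite lee_fin p2K; apply: powR_root_le => //.
    by apply: Rintegral_ge0 => t _; exact: powR_ge0.
  - by move=> x; exact: sqrtr_ge0.
  - by move=> x; rewrite divr_ge0// hess2_ge0.
  - by move=> x x1; exact: sqr_Dstar.
have r21 : r ^+ 2 <= 1 by rewrite expr_le1 ?ltW.
(* Here [N = 2n] and [q = p / 2] turn the general coefficient into the one of the theorem, times
   [r^2]. *)
have coefE : 2 * (p / 2) * (eta + tau) * r ^+ 2 / (2 * N%:R) = lam * r ^+ 2.
  have nN : n%:R != 0 :> R by rewrite pnatr_eq0 -lt0n.
  rewrite natrD; field.
  by rewrite nN /= -mulr2n mulrn_eq0.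
have coef0 : 0 <= 1 - 2 * (p / 2) * (eta + tau) * r ^+ 2 / (2 * N%:R).
  rewrite coefE subr_ge0; apply: (le_trans (ler_piMr lam_ge0 r21)); exact: ltW.
have := gradient_mean_estimate n0 P1 mZ Z1 divZ (part_jet fC2) (Om2 := Om2) (W := W)
  q1 r01 c0 hcb hlap M0 hOm e20 (fun s sr => d20 s (rin s sr)) W0
  (fun s sr => dW s (rin s sr)) hmean coef0.
rewrite coefE p2K.
have -> : g2 0 = 2 * normDf f 0 ^+ 2 by rewrite sqr_normDf mulrC divfK// pnatr_eq0.
have W0r := primitive_majorant_ge0 om r01 W0 dW.
(* [W r / r] is the integral over [[0, 1]] in the theorem, while the estimate produces [W r]. *)
have Wr : W r <= W r / r by rewrite ler_pdivlMr// ler_piMr// ltW.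
have B0 : 0 <= Mstar ^+ 2 * omega 1.
  by rewrite mulr_ge0 ?sqr_ge0// ltW// (majorant_gt0 om).
rewrite -(mulrA 4 (Mstar ^+ 2)) -(mulrA (2 * p * (2 * p - 3)) (Mstar ^+ 2)).
by apply: final_algebra => //; exact: powR_ge0.
Qed.

Lemma Mp_normDf r : 0 < r < 1 -> Mp p r (normDf f) = (Num.sqrt (gmean r / 2))%:E.
Proof.
move=> r01.
have cG (x : V) : enorm x < 1 -> {for x, continuous (fun y => g2 y / 2)}.
  move=> x1; apply: (@continuousM _ _ g2 (fun=> 2^-1)); first exact: g2c.
  exact: cst_continuous.
rewrite (Mp_sqr P1 mZ Z1 intZ p2 r01 (G := fun x => g2 x / 2) _ _ cG).
- congr EFin; rewrite -(smean_powR_half P1 mZ Z1 q1 r01 (grad2_ge0 _) g2c).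
  rewrite -powR12_sqrt ?powR_ge0// -powRrM; congr (_ `^ _).
  by rewrite -invfM mulrC p2K.
- by move=> x; exact: sqrtr_ge0.
- by move=> x; rewrite divr_ge0// grad2_ge0.
- by move=> x _; exact: sqr_normDf.
Qed.

Lemma Mp_normDf_le r : 0 < r < 1 ->
  (Mp p r (normDf f) <=
      (Num.sqrt (1 / (1 - lam)))%:E *
      (((normDf f 0) ^+ 2)%:E
        + b%:E * \int[@lebesgue_measure R]_(t in `[0%R, 1%R]) (omega (1 / (1 - r * t)))%:E)
      `^ (2^-1))%E.
Proof.
move=> r01; have /andP[r0 r1] := r01.
have [_ [W [_ _ W0 dW]]] := majorant_primitives om r01.
rewrite (integral_majorant om r01 W0 dW) (Mp_normDf r01).
have -> : ((normDf f 0 ^+ 2)%:E + b%:E * (W r / r)%:E)%E =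
  (normDf f 0 ^+ 2 + b * (W r / r))%:E by [].
rewrite poweR_EFin -EFinM.
have Wr0 : 0 <= W r / r by rewrite divr_ge0 ?(primitive_majorant_ge0 om r01 W0 dW)// ltW.
have S0 : 0 <= normDf f 0 ^+ 2 + b * (W r / r).
  by rewrite addr_ge0 ?sqr_ge0// mulr_ge0.
have l0 : 0 < 1 - lam by rewrite subr_gt0.
rewrite lee_fin (powR12_sqrt S0) -sqrtrM ?divr_ge0 ?(ltW l0)//.
by apply: ler_wsqrtr; rewrite mulrAC mul1r ler_pdivlMr// mulrC; exact: gradient_bound.
Qed.

Lemma gradsq_grad2 (x : V) : gradsq (part1 f) x = g2 x.
Proof. by rewrite /gradsq /grad2 pair_bigA. Qed.

(** Multiplied by [1 - s], the gradient bound is bounded uniformly in [s], so the gradient mean is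
    at most [C / sqrt (1 - s)], and [growth_estimate] integrates this up to the boundary. Only
    boundedness matters here, so the regularizing constant is fixed at 1. *)
Lemma Hgp_of_gradient_bound : Hgp p f.
Proof.
have aux (x a t : R) : x / 2 * (1 - t) <= a -> x * (1 - t) <= 2 * a + 1 by lra.
have l0 : 0 < 1 - lam by rewrite subr_gt0.
pose A := (normDf f 0 ^+ 2 + b * omega 1) / (1 - lam).
have bo : 0 <= b * omega 1 by rewrite mulr_ge0// ltW// (majorant_gt0 om).
have A0 : 0 <= A by rewrite divr_ge0 ?(ltW l0)// addr_ge0 ?sqr_ge0.
(* The bound needs [2A], from [grad2 = 2 |D_f|^2]; the added 1 makes [C] positive even if
   [A = 0]. *)
pose C := Num.sqrt (2 * A + 1).
have C20 : 0 < 2 * A + 1 by apply: ltr_wpDl => //; exact: mulr_ge0.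
have C0 : 0 < C by rewrite sqrtr_gt0.
exists (sqsum 1 (part f) 0 `^ 2^-1 + 2 * C) => r r01; have /andP[r0 r1] := r01.
have [rrho rho1] : r < (1 + r) / 2 /\ (1 + r) / 2 < 1 by split; lra.
have uJ bb : C1jet ((1 + r) / 2) (part f bb) (part1 f bb).
  by move=> x xr; have [h _] := part_jet fC2 bb; apply: h; exact: lt_trans rho1.
have hmean (s : R) : 0 < s < r -> smean (fun z => gradsq (part1 f) (s *: z) `^ (p / 2)) <=
    (C / Num.sqrt (1 - s)) `^ (2 * (p / 2)).
  move=> /andP[s0 sr]; have s1 := lt_trans sr r1.
  have s01 : 0 < s < 1 by rewrite s0.
  have d0 : 0 < 1 - s by rewrite subr_gt0.
  have [_ [W [_ _ W0 dW]]] := majorant_primitives om s01.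
  have -> : (fun z : V => gradsq (part1 f) (s *: z) `^ (p / 2)) =
      (fun z : V => g2 (s *: z) `^ (p / 2)).
    by apply: funext => z; rewrite gradsq_grad2.
  rewrite powRrM powR_mulrn ?divr_ge0 ?sqrtr_ge0 ?(ltW C0)//.
  apply: powR_root_le.
  - by apply: Rintegral_ge0 => t _; exact: powR_ge0.
  - exact: lt_le_trans q1.
  have WB := primitive_majorant_le om s01 W0 dW.
  have := gradient_bound s01 W0 dW.
  move: (gmean s) => X.
  move=> H; have -> : (C / Num.sqrt (1 - s)) ^+ 2 = (2 * A + 1) / (1 - s).
    by rewrite expr_div_n (sqr_sqrtr (ltW d0)) (sqr_sqrtr (ltW C20)).
  rewrite ler_pdivlMr//.
  have H2 : (1 - lam) * (X / 2) * (1 - s) <= normDf f 0 ^+ 2 + b * omega 1.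
    apply: (@le_trans _ _ ((normDf f 0 ^+ 2 + b * (omega 1 / (1 - s))) * (1 - s))).
      rewrite ler_pM2r//; apply: (le_trans H).
      by rewrite lerD2l; exact: ler_wpM2l.
    rewrite mulrDl mulrA divfK ?gt_eqF// lerD2r ler_piMr ?sqr_ge0//.
    by rewrite lerBlDr lerDl ltW.
  have : X / 2 * (1 - s) <= A by rewrite ler_pdivlMr// mulrC mulrA.
  exact: aux.
have := growth_estimate P1 mZ Z1 ltr01 q1 r0 rrho r1 uJ C0 hmean.
rewrite p2K => key.
pose G (x : V) := \sum_bb part f bb x ^+ 2.
have G0 x : 0 <= G x by apply: sumr_ge0 => bb _; exact: sqr_ge0.
have cG (x : V) : enorm x < 1 -> {for x, continuous G}.
  move=> x1; apply: continuous_at_sum => bb; apply: continuous_sqr_at.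
  by have [h _] := part_jet fC2 bb; exact: (C1jet_cont h x1).
have nr : `|r| < 1 by rewrite ger0_norm ?ltW.
have nr' : `|r| < (1 + r) / 2 by rewrite ger0_norm ?ltW.
rewrite (Mp_sqr P1 mZ Z1 intZ p2 r01 _ G0 cG); last 2 first.
- by move=> x; exact: sqrtr_ge0.
- move=> x _; rewrite sqr_sqrtr; last by rewrite /cabs2 addr_ge0 ?sqr_ge0.
  by rewrite /G big_bool.
rewrite lee_fin; apply: le_trans key; apply: ge0_ler_powR; rewrite ?nnegrE ?invr_ge0 ?(ltW p0)//.
- by apply: Rintegral_ge0 => t _; exact: powR_ge0.
- by apply: Rintegral_ge0 => t _; exact: powR_ge0.
apply: le_Rintegral => //.
- exact: (sphere_continuous_powR P1 mZ Z1 q1 nr G0 cG).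
- apply: (integrable_sphere P1 mZ Z1 (h := fun z => sqsum 1 (part f) (r *: z) `^ (p / 2))).
  exact: (sphere_continuous_sqpow ltr01 uJ nr').
- move=> t _; apply: ge0_ler_powR; rewrite ?nnegrE ?(le_trans ler01 q1) ?G0//.
    by apply/ltW/sqsum_gt0.
  by rewrite /sqsum lerDr.
Qed.

End theorem_estimates.

Unset Implicit Arguments.

Theorem theorem1p3 (R : realType) (n : nat) (p : R) (omega : R -> R)
  (tau eta Mstar : R) (f : 'rV[R]_(n + n) -> R * R) :
  (0 < n)%N -> 2 <= p -> majorant omega ->
  0 <= tau -> 0 <= eta -> eta + tau < 4 * n%:R / p ->
  cC2_on (@unit_ball R n) f ->
  (forall x, @unit_ball R n x ->
     lap f x = (tau * (f x).1 + eta * (f x).1, tau * (f x).2)) ->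
  0 < Mstar ->
  (forall r, 0 < r < 1 ->
     (Mp p r (Dstar f) <= (Mstar * omega (1 / (1 - r)))%:E)%E) ->
  (forall r, 0 < r < 1 ->
     (Mp p r (normDf f) <=
      (Num.sqrt (1 / (1 - p * (eta + tau) / (4 * n%:R))))%:E *
      (((normDf f 0) ^+ 2)%:E
        + (2 * p * (2 * p - 3) * Mstar ^+ 2 * omega 1)%:E *
          \int[@lebesgue_measure R]_(t in `[0%R, 1%R]) (omega (1 / (1 - r * t)))%:E)
      `^ (2^-1))%E)
  /\ Hgp p f.
Proof.
move=> n0 p2 om tau0 eta0 hc fC2 flap M0 hD.
have [d [T [P [Z [P1 mZ Z1 intZ divZ]]]]] := @sphere_measure_exists R n n0.
split=> [r r01|].
  exact: (Mp_normDf_le n0 p2 om tau0 eta0 hc fC2 flap M0 hD P1 mZ Z1 intZ divZ r01).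
exact: (Hgp_of_gradient_bound n0 p2 om tau0 eta0 hc fC2 flap M0 hD P1 mZ Z1 intZ divZ).
Qed.
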